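(* Let $\mathscr C$ be a hereditary class of graphs. Then the following are equivalent: (i) the class $\mathscr C$ is weakly $\chi_p$-bounded for every positive integer $p$; (ii) the class $\mathscr C$ and all the classes ${\rm ITM}_r^e(\mathscr C)$ ($r\geq 1$) are $\chi$-bounded; (iii) the class $\mathscr C$ is $\chi$-bounded and for every positive integer $r$ we have $\overline{\rm d}({\rm ITM}_r^e(\mathscr C))<\infty$; (iv) $\mathscr C$ is $\chi$-bounded and for each positive integer $p$ there is a function $f_p$ such that for every graph $G\in\mathscr C$ we have $\chi_p(G)\leq f_p({\rm b}\omega(G))$, where ${\rm b}\omega(G)=\max\{s\mid K_{s,s}\subseteq G\}$; (v) $\mathscr C$ is $\chi$-bounded and for each positive integer $s$ the class $\{G\in\mathscr C\mid K_{s,s}\not\subseteq_i G\}$ is strongly $\chi_p$-bounded for every positive integer $p$.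
   Context: All graphs are finite, simple and undirected. $H\subseteq G$ means $H$ is a subgraph of $G$ and $H\subseteq_i G$ means $H$ is an induced subgraph of $G$. A class is hereditary if it is closed under induced subgraphs. $\omega(G)$ is the clique number and $\chi(G)$ the chromatic number. (${\rm b}\omega(G)=0$ if $G$ has no edge.) For an invariant $f$ and a class $\mathscr D$, $f(\mathscr D)=\sup_{G\in\mathscr D}f(G)$; $\overline{\rm d}(G)$ is the average degree of $G$. A $(\leq r)$-subdivision of $H$ is a graph obtained by subdividing each edge of $H$ by at most $r$ vertices; the $r$-subdivision $H^{(r)}$ is obtained by subdividing each edge by exactly $r$ vertices. ${\rm TM}_r(G)$ is the class of all graphs $H$ such that some $(\leq r)$-subdivision of $H$ is a subgraph of $G$. ${\rm ITM}_r^e(G)$ is the class of all graphs $H$ such that $H^{(r)}$ is an induced subgraph of $G$, and ${\rm ITM}_r^e(\mathscr C)=\bigcup_{G\in\mathscr C}{\rm ITM}_r^e(G)$. The tree-depth ${\rm td}(G)$ is the minimum height (number of vertices on a longest root-to-leaf path) of a rooted forest $Y$ such that $G$ is a subgraph of the closure of $Y$ (the graph in which each vertex is adjacent to all its ancestors in $Y$). $\chi_p(G)$ is the minimum number of colors in a vertex coloring of $G$ such that every set $I$ of at most $p$ colors induces a subgraph of tree-depth at most $|I|$. A hereditary class $\mathscr C$ is $\chi$-bounded if there is a function $f$ with $\chi(G)\leq f(\omega(G))$ for every $G\in\mathscr C$; strongly $\chi_p$-bounded if there is a function $f_p$ with $\chi_p(G)\leq f_p(\omega(G))$ for every $G\in\mathscr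 C$; weakly $\chi_p$-bounded if there is a function $g_p$ with $\chi_p(G)\leq g_p(\omega({\rm TM}_{p-1}(G)))$ for every $G\in\mathscr C$. *)

(* Defs.v *)
From mathcomp Require Import all_boot all_order all_algebra.
From mathcomp Require Import boolp classical_sets.

Set Implicit Arguments.
Unset Strict Implicit.
Unset Printing Implicit Defensive.

Record sgraph := SGraph {
  vertex :> finType;
  adj : rel vertex;
  adj_sym : symmetric adj;
  adj_irrefl : irreflexive adj }.

(* A plain predicate: the universe of [set] lies strictly below that of
   [finType], so [set sgraph] is not well-formed. *)
Definition graph_class := sgraph -> Prop.

(* Containment is up to isomorphism. *)
Definition subgraph (H G : sgraph) : bool :=
  [exists f : {ffun H -> G}, injectiveb f &&
    [forall x, forall y, adj x y ==> adj (f x) (f y)]].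

Definition induced_subgraph (H G : sgraph) : bool :=
  [exists f : {ffun H -> G}, injectiveb f &&
    [forall x, forall y, adj x y == adj (f x) (f y)]].

(* Since [induced_subgraph] is up to isomorphism, a hereditary class is in
   particular closed under isomorphism. *)
Definition hereditary (C : graph_class) : Prop :=
  forall G H : sgraph, C G -> induced_subgraph H G -> C H.

Section Induced.
Variables (G : sgraph) (A : {set G}).
Definition induced_vertex : finType := {x : G | x \in A}.
Definition induced_adj : rel induced_vertex :=
  fun x y => adj (val x) (val y).
Lemma induced_adj_sym : symmetric induced_adj.
Proof. by move=> x y; exact: adj_sym. Qed.
Lemma induced_adj_irrefl : irreflexive induced_adj.
Proof. by move=> x; exact: adj_irrefl. Qed.
Definition induced : sgraph := SGraph induced_adj_sym induced_adj_irrefl.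
End Induced.

Section CompleteBipartite.
Variables m n : nat.
Definition Kmn_adj : rel ('I_m + 'I_n) :=
  fun u v => match u, v with
    | inl _, inr _ | inr _, inl _ => true
    | _, _ => false
    end.
Lemma Kmn_adj_sym : symmetric Kmn_adj. Proof. by case=> ? []. Qed.
Lemma Kmn_adj_irrefl : irreflexive Kmn_adj. Proof. by case. Qed.
Definition Kmn : sgraph := SGraph Kmn_adj_sym Kmn_adj_irrefl.
End CompleteBipartite.

Definition values (T : Type) (f : sgraph -> T) (D : graph_class) : set T :=
  [set t | exists2 G, D G & f G = t]%classic.

Definition clique (G : sgraph) (A : {set G}) : bool :=
  [forall x in A, forall y in A, (x != y) ==> adj x y].

Definition omega (G : sgraph) : nat := \max_(A : {set G} | clique A) #|A|.

Definition colorable (G : sgraph) (k : nat) : bool :=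
  [exists c : {ffun G -> 'I_k}, forall x, forall y, adj x y ==> (c x != c y)].

Lemma ex_colorable (G : sgraph) : exists k, colorable G k.
Proof.
exists #|G|; apply/existsP; exists [ffun x => enum_rank x].
apply/forallP=> x; apply/forallP=> y; apply/implyP=> xy; rewrite !ffunE.
by apply/eqP=> /enum_rank_inj eq_xy; rewrite eq_xy adj_irrefl in xy.
Qed.

Definition chi (G : sgraph) : nat := ex_minn (ex_colorable G).

(* For the graph with no vertex the quotient is [0 / 0 = 0]. *)
Definition avg_degree (G : sgraph) : rat :=
  ((\sum_(x : G) #|[set y | adj x y]|)%N%:R / #|G|%:R)%R.

Lemma ex_biclique (G : sgraph) : exists s, subgraph (Kmn s s) G.
Proof.
exists 0; apply/existsP.
have f0 (u : Kmn 0 0) : G by case: u => -[].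
exists [ffun u => f0 u]; apply/andP; split; first by apply/injectiveP => -[] [].
by apply/forallP => -[] [].
Qed.

Lemma subgraph_card (H G : sgraph) : subgraph H G -> #|H| <= #|G|.
Proof. by move=> /existsP[f /andP[/injectiveP/leq_card]]. Qed.

Lemma biclique_bound (G : sgraph) s : subgraph (Kmn s s) G -> s <= #|G|.
Proof.
move/subgraph_card; apply: leq_trans.
by rewrite card_sum card_ord leq_addr.
Qed.

(* [Kmn 0 0] is a subgraph of every graph, so this is 0 on edgeless graphs. *)
Definition bomega (G : sgraph) : nat :=
  ex_maxn (ex_biclique G) (@biclique_bound G).

(* Each edge of H is represented once, oriented along the enumeration of H. *)
Definition arc (H : sgraph) : finType :=
  {p : H * H | adj p.1 p.2 && (enum_rank p.1 < enum_rank p.2)}.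

(* Edge p is replaced by the path
     (val p).1, (p, 0), ..., (p, (k p).-1), (val p).2
   with k p new vertices; if k p = 0 it is kept as an edge. *)
Section Subdivision.
Variables (H : sgraph) (k : arc H -> nat).

Definition subdiv_vertex : finType := (H + {p : arc H & 'I_(k p)})%type.

Definition subdiv_end (x : H) (w : {p : arc H & 'I_(k p)}) : bool :=
  let p := tag w in let i : nat := tagged w in
  ((x == (val p).1) && (i == 0)) || ((x == (val p).2) && (i.+1 == k p)).

Definition subdiv_adj : rel subdiv_vertex :=
  fun u v => match u, v with
  | inl x, inl y =>
      [exists p : arc H, (k p == 0) && ((val p == (x, y)) || (val p == (y, x)))]
  | inl x, inr w | inr w, inl x => subdiv_end x w
  | inr w, inr w' =>
      let i : nat := tagged w in let j : nat := tagged w' in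
      (tag w == tag w') && ((i.+1 == j) || (j.+1 == i))
  end.

Lemma subdiv_adj_sym : symmetric subdiv_adj.
Proof.
case=> [x|w] [y|w'] //=; last by rewrite eq_sym orbC.
by apply: eq_existsb => p; rewrite orbC.
Qed.

Lemma subdiv_adj_irrefl : irreflexive subdiv_adj.
Proof.
case=> [x|w] /=; last by rewrite eqxx orbb /= eqn_leq ltnn.
apply/existsP=> -[[[y z] /= /andP[yz _]]] /andP[_].
by rewrite orbb => /eqP[yx zx]; rewrite yx zx adj_irrefl in yz.
Qed.

Definition subdivision : sgraph := SGraph subdiv_adj_sym subdiv_adj_irrefl.
End Subdivision.

Definition exact_subdivision (r : nat) (H : sgraph) : sgraph :=
  @subdivision H (fun=> r).

Definition TM (r : nat) (G : sgraph) : graph_class :=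
  fun H => exists2 k : arc H -> nat,
    (forall p, k p <= r) & subgraph (subdivision k) G.

Definition ITMe (r : nat) (G : sgraph) : graph_class :=
  fun H => induced_subgraph (exact_subdivision r H) G.

Definition class_ITMe (r : nat) (C : graph_class) : graph_class :=
  fun H => exists2 G, C G & ITMe r G H.

(* [supremum 0 A] is 0 when A is empty or unbounded; the only sets it is used
   on, those of [sup_inv omega (TM r G)], are neither: see [sup_omega_TM]. *)
Definition sup_inv (f : sgraph -> nat) (D : graph_class) : nat :=
  supremum 0 (values f D).

(* The supremum of the average degree over D is finite. *)
Definition bounded_avg_degree (D : graph_class) : Prop :=
  has_ubound (values avg_degree D).

(* Rooted forests as parent functions; the roots have no parent. *)
Definition parent_rel (V : finType) (parent : V -> option V) : rel V :=
  fun x y => parent x == Some y.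

Record rforest := RForest {
  node :> finType;
  parent : node -> option node;
  parent_acyclic :
    forall x y, parent x = Some y -> ~~ connect (parent_rel parent) y x }.

Section Forest.
Variable Y : rforest.

(* [below x y]: y is x or an ancestor of x *)
Definition below : rel Y := connect (parent_rel (@parent Y)).

(* The path from x to its root consists of x and its ancestors, and the longest
   of these paths start at leaves. *)
Definition height : nat := \max_(x : Y) #|[set y | below x y]|.

Definition closure_adj : rel Y :=
  fun x y => (x != y) && (below x y || below y x).
Lemma closure_adj_sym : symmetric closure_adj.
Proof. by move=> x y; rewrite /closure_adj eq_sym orbC. Qed.
Lemma closure_adj_irrefl : irreflexive closure_adj.
Proof. by move=> x; rewrite /closure_adj eqxx. Qed.
Definition forest_closure : sgraph := SGraph closure_adj_sym closure_adj_irrefl.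
End Forest.

Definition td_le_witness (G : sgraph) (h : nat) : Prop :=
  exists2 Y : rforest, height Y = h & subgraph G (forest_closure Y).

Section LinearForest.
Variable G : sgraph.

Definition lin_parent (x : G) : option G :=
  [pick y | (enum_rank y).+1 == enum_rank x :> nat].

Lemma lin_parentP x y :
  lin_parent x = Some y <-> (enum_rank y).+1 = enum_rank x :> nat.
Proof.
rewrite /lin_parent; case: pickP => [z /eqP zx|no]; split => //.
- by case=> <-.
- move=> yx; congr Some; apply: enum_rank_inj; apply: val_inj => /=.
  by apply: succn_inj; rewrite zx yx.
- by move=> yx; move: (no y); rewrite yx eqxx.
Qed.

Lemma lin_connect_le x y :
  connect (parent_rel lin_parent) x y -> enum_rank y <= enum_rank x.
Proof.
case/connectP => p; elim: p x => [x _ ->|z p IH x] //=.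
case/andP=> /eqP/lin_parentP zx /IH{}IH /IH yz.
by rewrite -zx; apply: leqW.
Qed.

Lemma lin_acyclic x y :
  lin_parent x = Some y -> ~~ connect (parent_rel lin_parent) y x.
Proof.
by move/lin_parentP => yx; apply/negP=> /lin_connect_le; rewrite -yx ltnn.
Qed.

Definition lin_forest : rforest := RForest lin_acyclic.

Lemma lin_below (x y : G) : enum_rank y <= enum_rank x -> @below lin_forest x y.
Proof.
move En: (nat_of_ord (enum_rank x)) => n.
elim: n x En => [|n IH] x En.
  rewrite leqn0 => /eqP y0; suff -> : x = y by exact: connect0.
  by apply: enum_rank_inj; apply: val_inj; rewrite /= En y0.
rewrite leq_eqVlt => /orP[/eqP yn|yn].
  suff -> : x = y by exact: connect0.
  by apply: enum_rank_inj; apply: val_inj; rewrite /= En yn.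
have nG : n < #|G| by apply: ltn_trans (ltn_ord (enum_rank x)); rewrite En.
pose z := enum_val (Ordinal nG).
have zn : enum_rank z = n :> nat by rewrite /z enum_valK.
apply: (@connect_trans _ _ z); last exact: IH.
by apply: connect1; apply/eqP/lin_parentP; rewrite zn En.
Qed.

Lemma lin_closure : subgraph G (forest_closure lin_forest).
Proof.
apply/existsP; exists [ffun x => (x : lin_forest)]; apply/andP; split.
  by apply/injectiveP => x y; rewrite !ffunE.
apply/forallP=> x; apply/forallP=> y; apply/implyP=> xy; rewrite !ffunE /=.
rewrite /closure_adj; apply/andP; split.
  by apply/eqP=> e; rewrite e adj_irrefl in xy.
by case/orP: (leq_total (enum_rank y) (enum_rank x)) => /lin_below -> //;
  rewrite orbT.
Qed.

Lemma lin_height : height lin_forest <= #|G|.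
Proof. by apply/bigmax_leqP => x _; exact: max_card. Qed.

End LinearForest.

Lemma ex_td (G : sgraph) : exists h, `[< td_le_witness G h >].
Proof.
by exists (height (lin_forest G)); apply/asboolP; exists (lin_forest G) => //;
  exact: lin_closure.
Qed.

Definition td (G : sgraph) : nat := ex_minn (ex_td G).

Lemma td_le_card (G : sgraph) : td G <= #|G|.
Proof.
rewrite /td; case: ex_minnP => h _ minh; apply: leq_trans (lin_height G).
by apply: minh; apply/asboolP; exists (lin_forest G) => //; exact: lin_closure.
Qed.

(* The colorings are not required to be proper; for 1 <= p they are. *)
Definition td_colorable (p : nat) (G : sgraph) (k : nat) : bool :=
  [exists c : {ffun G -> 'I_k}, forall I : {set 'I_k},
    (#|I| <= p) ==> (td (induced [set x | c x \in I]) <= #|I|)].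

Lemma ex_td_colorable p (G : sgraph) : exists k, td_colorable p G k.
Proof.
exists #|G|; apply/existsP; exists [ffun x => enum_rank x].
apply/forallP => I; apply/implyP=> _; apply: leq_trans (td_le_card _) _.
rewrite /= card_sig -[leqRHS](card_imset _ (@enum_val_inj G predT)).
apply: subset_leq_card; apply/fintype.subsetP=> x; rewrite !inE ffunE => xI.
by apply/imsetP; exists (enum_rank x) => //; rewrite enum_rankK.
Qed.

Definition chi_p (p : nat) (G : sgraph) : nat := ex_minn (ex_td_colorable p G).

Definition chi_bounded (C : graph_class) : Prop :=
  exists f : nat -> nat, forall G, C G -> chi G <= f (omega G).

Definition strongly_chi_p_bounded (p : nat) (C : graph_class) : Prop :=
  exists f : nat -> nat, forall G, C G -> chi_p p G <= f (omega G).

Definition weakly_chi_p_bounded (p : nat) (C : graph_class) : Prop :=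
  exists g : nat -> nat,
    forall G, C G -> chi_p p G <= g (sup_inv omega (TM p.-1 G)).

Lemma omega_le_card (G : sgraph) : omega G <= #|G|.
Proof. by apply/bigmax_leqP => A _; exact: max_card. Qed.

Lemma omega_TM_bound r (G H : sgraph) : TM r G H -> omega H <= #|G|.
Proof.
case=> k _ /subgraph_card; apply: leq_trans; apply: leq_trans (omega_le_card H) _.
by rewrite /= card_sum leq_addr.
Qed.

Lemma TM_refl r (G : sgraph) : TM r G G.
Proof.
exists (fun=> 0) => //; apply/existsP.
have f0 (u : @subdivision G (fun=> 0)) : {x : G | u = inl x}.
  by case: u => [x|[p []//]]; exists x.
pose g u := sval (f0 u); have gK u : u = inl (g u) by exact: svalP (f0 u).
exists [ffun u => g u]; apply/andP; split.
  by apply/injectiveP => u v; rewrite !ffunE => guv; rewrite (gK u) guv -gK.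
apply/forallP => u; apply/forallP=> v; rewrite !ffunE; apply/implyP.
rewrite {1}(gK u) {1}(gK v) /=.
case/existsP=> -[[a b] /= /andP[ab _]] /orP[] /eqP[<- <-] //.
by rewrite adj_sym.
Qed.

Lemma sup_omega_TM r (G : sgraph) :
  supremums (values omega (TM r G)) (sup_inv omega (TM r G)).
Proof.
set A := values omega (TM r G).
have A0 : (A !=set0)%classic by exists (omega G), G => //; exact: TM_refl.
have exA : exists n, `[< ubound A n >].
  by exists #|G|; apply/asboolP => _ [H HH <-]; exact: omega_TM_bound HH.
rewrite /sup_inv -/A /supremum.
have -> : (A == set0)%classic = false by apply/negbTE/set0P.
case: xgetP => [n -> //|no]; exfalso.
case: (ex_minnP exA) => m /asboolP ubm minm.
by apply: (no m); split => // n ubn; apply: minm; apply/asboolP.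
Qed.

(* Main.v *)
(** Write ITM_r for the class of the graphs whose r-subdivision is an induced
    subgraph of a member of C.

    (i) => (ii): in a colouring of the r-subdivision of H, an edge of H with ends of
    the same colour becomes a path with at most r+1 colours, which has a topmost
    vertex in a forest of height at most r+1; orienting the edge accordingly bounds
    the out-degrees, hence the chromatic number of H.

    (ii) => (iii): triangle-free shift graphs bound the cliques, and therefore the
    chromatic numbers, of the members of ITM_r. A graph of huge average degree
    contains a 1-subdivision of a graph of large chromatic number (choose a random
    path of length two through each vertex of a large set), so a dense member of
    ITM_r would give a member of ITM_(2r+1) of large chromatic number.

    (iii) => (iv): let G be K-colourable without K_(s,s) as a subgraph. If a subgraph
    of G were dense, random sampling would give a dense member of ITM_1; hence G is
    degenerate. In a degenerate graph, sampling the vertices also turns a dense system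
    of internally disjoint short paths into an induced subdivision, so shallow
    topological minors of G are sparse. Hence G has bounded admissibility, so it has
    an ordering with few weakly reachable vertices, and a greedy colouring that
    separates each vertex from those that it weakly reaches is p-centered.

    (iv) => (v): by chi-boundedness a large biclique contains a large induced one.
    (v) => (i): K_(n^2,n^2) contains the 1-subdivision of K_n. *)

Require Import Defs.
From mathcomp Require Import all_boot all_order all_algebra.
From mathcomp Require Import zify.
From mathcomp Require Import boolp.

Set Implicit Arguments.
Unset Strict Implicit.
Unset Printing Implicit Defensive.

(** * Orderings, colourings and sampling in finite sets *)

(** The obstacle is that (iii) controls induced subdivisions, whereas density only produces
    subgraphs; the vertices causing unwanted edges have to be removed. Keeping each vertex with
    probability 1/2 succeeds whenever boundedly many vertices are prescribed per path. Degeneracy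
    provides such a bound: an unwanted edge is charged to its later end, which has at most D earlier
    neighbours.

    Degeneracy itself has to be proved without that bound. There the vertices of one side of a
    bipartite graph are kept with probability about the inverse of the degrees on the other side, so
    that a constant proportion of that other side keeps exactly s neighbours, and excluding K_(s,s)
    limits how often the same s-set occurs. All probabilities are counts over finite sets of subsets
    or of functions.

    For (i) => (ii) the bound in (i) must be turned into one in omega(H): a clique with more than
    three vertices can be a topological minor of the r-subdivision of H, with at most r subdivisions
    per edge, only if H contains it. The class C itself is the case r = 0. *)

Lemma sum_card_exchange (I J : finType) (A : {pred I}) (B : {pred J}) (R : I -> J -> bool) :
  \sum_(i in A) #|[set j in B | R i j]| = \sum_(j in B) #|[set i in A | R i j]|.
Proof.
have E i : #|[set j in B | R i j]| = \sum_(j in B) R i j.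
  by rewrite -sum1_card -big_mkcondr; apply: eq_bigl => j; rewrite inE.
rewrite (eq_bigr _ (fun i _ => E i)) exchange_big /=; apply: eq_bigr => j _.
by rewrite -sum1_card -big_mkcondr; apply: eq_bigl => i; rewrite inE.
Qed.

Lemma sum_ltn (I : finType) (F H : I -> nat) :
  0 < #|I| -> (forall i, F i < H i) -> \sum_i F i < \sum_i H i.
Proof.
move=> I0 FH; apply: (@leq_trans (\sum_i (F i).+1)); last exact: leq_sum.
have -> : \sum_i (F i).+1 = \sum_i F i + #|I|.
  by rewrite -sum1_card -big_split; apply: eq_bigr => i _; rewrite /= addn1.
by rewrite -addn1 leq_add2l.
Qed.

Section FiniteTypes.
Variable T : finType.
Implicit Types (S X : {set T}) (e : rel T).

(** A vertex picked from the set of those still present gets the largest rank among them, so the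
    initial segment of [rho] at v is the set from which v was picked. With [Q] abstract, this serves
    both degeneracy and admissibility. *)
Lemma elimination_order (Q : T -> {set T} -> Prop) :
  (forall S, S != set0 -> exists2 v, v \in S & Q v S) ->
  exists2 rho : T -> nat, injective rho &
    forall v, Q v [set u | rho u <= rho v].
Proof.
move=> hQ.
suff [rho inj_rho rhoQ] : exists2 rho : T -> nat, {in [set: T] &, injective rho} &
    {in [set: T], forall v, rho v < #|[set: T]| /\
                            Q v [set u in [set: T] | rho u <= rho v]}.
  exists rho => [u v|v]; first by apply: inj_rho; rewrite inE.
  have [_] := rhoQ v (in_setT v); congr Q.
  by apply/setP => u; rewrite !inE.
move: [set: T] => S; move En: #|S| => n; elim: n S En => [|n IH] S En.
  have -> : S = set0 by apply/eqP; rewrite -cards_eq0 En.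
  by exists (fun=> 0) => [x y|x]; rewrite inE.
have /hQ[v vS Qv] : S != set0 by rewrite -card_gt0 En.
have En' : #|S :\ v| = n by move: (cardsD1 v S); rewrite vS En => -[].
have [rho inj_rho rhoQ] := IH _ En'.
have SD x : x \in S -> x != v -> x \in S :\ v by move=> xS xv; rewrite !inE xv.
exists (fun x => if x == v then n else rho x).
  move=> x y xS yS /=; case: eqVneq => [->|xv]; case: eqVneq => [->|yv] //.
  - by have [yn _] := rhoQ y (SD _ yS yv) => eqn; rewrite -eqn ltnn in yn.
  - by have [xn _] := rhoQ x (SD _ xS xv) => eqn; rewrite eqn ltnn in xn.
  - by apply: inj_rho; apply: SD.
move=> x xS; case: (eqVneq x v) => [->|xv].
  split=> //; move: Qv; congr Q; apply/setP => u; rewrite !inE.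
  case uS: (u \in S) => //=; case: (eqVneq u v) => [//|uv]; first by rewrite leqnn.
  by have [/ltnW] := rhoQ u (SD _ uS uv) => ->.
have [xn Qx] := rhoQ x (SD _ xS xv).
split; first exact: leq_trans xn _.
move: Qx; congr Q; apply/setP => u; rewrite !inE.
by case: (eqVneq u v) => [->|uv] //=; rewrite leqNgt xn andbF.
Qed.

(** Greedy colouring, with a vertex of few neighbours coloured last. Loops of [e] are tolerated
    because weak reachability, one of the relations to be coloured, is reflexive. *)
Lemma degenerate_coloring e d : symmetric e ->
  (forall S, S != set0 -> exists2 v, v \in S & #|[set u in S | e v u]| <= d) ->
  exists c : T -> 'I_d.+1, forall x y, e x y -> x != y -> c x != c y.
Proof.
move=> e_sym hd.
suff [c cP] : exists c : T -> 'I_d.+1,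
    {in [set: T] &, forall x y, e x y -> x != y -> c x != c y}.
  by exists c => x y; apply: cP; rewrite inE.
move: [set: T] => S; move En: #|S| => n; elim: n S En => [|n IH] S En.
  have -> : S = set0 by apply/eqP; rewrite -cards_eq0 En.
  by exists (fun=> ord0) => x y; rewrite inE.
have /hd[v vS dv] : S != set0 by rewrite -card_gt0 En.
have En' : #|S :\ v| = n by move: (cardsD1 v S); rewrite vS En => -[].
have [c cP] := IH _ En'.
have [k kP] : exists k, k \notin c @: [set u in S | e v u].
  have : c @: [set u in S | e v u] \proper [set: 'I_d.+1].
    rewrite properEcard subsetT cardsT card_ord ltnS.
    exact: leq_trans (leq_imset_card _ _) dv.
  by case/properP => _ [k _ kP]; exists k.
exists (fun x => if x == v then k else c x) => x y xS yS exy xy.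
case: (eqVneq x v) => [xv|xv]; case: (eqVneq y v) => [yv|yv].
- by rewrite xv yv eqxx in xy.
- apply/negP => /eqP kc; case/negP: kP; rewrite kc; apply: imset_f.
  by rewrite inE yS -xv.
- apply/negP => /eqP kc; case/negP: kP; rewrite -kc; apply: imset_f.
  by rewrite inE xS e_sym -yv.
- by apply: cP => //; rewrite !inE ?xv ?yv.
Qed.

Lemma card_set_pairs e : #|[set p | e p.1 p.2]| = \sum_x #|[set y | e x y]|.
Proof.
rewrite -sum1_card (eq_bigl (fun p => true && e p.1 p.2)); last by move=> p; rewrite inE.
rewrite -(pair_big_dep xpredT (fun x y => e x y) (fun _ _ => 1)) /=.
by apply: eq_bigr => x _; rewrite -sum1_card; apply: eq_bigl => y; rewrite inE.
Qed.

(** Deleting a vertex of degree at most [d] lowers the degree sum by at most [2 * d], so the density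
    survives each deletion and keeps the remaining set nonempty. *)
Lemma min_degree_subset e d X : symmetric e -> irreflexive e ->
  \sum_(x in X) #|[set y in X | e x y]| > 2 * d * #|X| ->
  exists Y : {set T}, [/\ Y \subset X, Y != set0 &
    forall y, y \in Y -> d < #|[set z in Y | e y z]|].
Proof.
move=> e_sym e_irr.
move En: #|X| => n; elim: n X En => [|n IH] X En.
  by rewrite big1 // => x; rewrite (cards0_eq En) inE.
move=> dense; case: (boolP [forall y in X, d < #|[set z in X | e y z]|]).
  move/forall_inP => deg; exists X; split=> //; first by rewrite -card_gt0 En.
case/forall_inPn => v vX; rewrite -leqNgt => degv.
have En' : #|X :\ v| = n by move: (cardsD1 v X); rewrite vX En => -[].
have : 2 * d * n < \sum_(x in X :\ v) #|[set y in X :\ v | e x y]|.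
  rewrite -(ltn_add2r (2 * d)) addnC -mulnS; apply: leq_trans dense _.
  have E x : x \in X :\ v -> #|[set y in X | e x y]| =
      #|[set y in X :\ v | e x y]| + (e v x).
    move=> xX; rewrite (cardsD1 v) addnC inE vX e_sym /=; congr (_ + _).
    by apply: eq_card => y; rewrite !inE andbA.
  rewrite (big_setD1 v) //= (eq_bigr _ E) big_split /=.
  have -> : \sum_(x in X :\ v) e v x = #|[set y in X | e v y]|.
    rewrite -sum1_card -[LHS]big_mkcondr; apply: eq_bigl => x; rewrite !inE.
    by case: (eqVneq x v) => [->|_]; rewrite ?e_irr ?andbF /=.
  by move: degv; rewrite addnC -addnA mul2n -addnn leq_add2l => h; rewrite leq_add.
move=> /(IH _ En')[Y [YX Y0 Yd]]; exists Y; split=> //.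
exact: subset_trans YX (subsetDl _ _).
Qed.

(* Each of the 2^#|T| sets X is equally likely, and a given pair is kept with
   probability at least 2^-k. *)
Lemma half_sampling (I : finType) (J : {set I}) (P O : I -> {set T}) k :
  (forall i, i \in J -> [disjoint P i & O i] /\ #|P i| + #|O i| <= k) ->
  exists X : {set T},
    #|J| <= 2 ^ k * #|[set i in J | (P i \subset X) && [disjoint O i & X]]|.
Proof.
move=> PO; pose K X := [set i in J | (P i \subset X) && [disjoint O i & X]].
have count i : i \in J ->
    2 ^ #|T| <= 2 ^ k * #|[set X | i \in K X]|.
  move=> iJ; have [dPO lek] := PO _ iJ; pose W := ~: (P i :|: O i).
  have cW : #|T| <= k + #|W|.
    rewrite -(cardsC (P i :|: O i)) leq_add2r cardsU.
    exact: leq_trans (leq_subr _ _) lek.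
  rewrite -(leq_exp2l _ _ (isT : 1 < 2)) expnD -card_powerset in cW.
  apply: leq_trans cW _; rewrite leq_mul2l; apply/orP; right.
  have inj : {in powerset W &, injective (fun Y => Y :|: P i)}.
    have YP Y : Y \in powerset W -> (Y :|: P i) :\: P i = Y.
      rewrite inE setDUl setDv setU0 => /fintype.subsetP YW; apply/setDidPl.
      rewrite disjoints_subset; apply/fintype.subsetP => x /YW.
      by rewrite !inE negb_or => /andP[].
    by move=> Y Z /YP {2}<- /YP {2}<- ->.
  rewrite -(card_in_imset inj); apply: subset_leq_card.
  apply/fintype.subsetP => _ /imsetP[Y YW ->]; rewrite !inE iJ subsetUr /=.
  rewrite disjoints_subset setCU subsetI -!disjoints_subset [X in _ && X]disjoint_sym dPO.
  rewrite andbT disjoint_sym disjoints_subset.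
  move: YW; rewrite inE => /fintype.subsetP YW; apply/fintype.subsetP => x /YW.
  by rewrite !inE negb_or => /andP[].
apply: contrapT => no; have lt X : 2 ^ k * #|K X| < #|J|.
  by rewrite ltnNge; apply/negP => h; apply: no; exists X.
have : \sum_(X : {set T}) 2 ^ k * #|K X| < \sum_(X : {set T}) #|J|.
  by apply: sum_ltn => //; apply/card_gt0P; exists set0.
rewrite ltnNge -big_distrr /= sum_nat_const => /negP; apply.
have -> : \sum_X #|K X| = \sum_(i in J) #|[set X | i \in K X]|.
  rewrite (eq_bigr (fun X => #|[set i in J | i \in K X]|)); last first.
    by move=> X _; apply: eq_card => i; rewrite !inE; case: (i \in J).
  by rewrite sum_card_exchange; apply: eq_bigr.
have -> : #|{: {set T}}| = 2 ^ #|T| 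
  by rewrite -(cardsT T) -card_powerset; apply: eq_card => X; rewrite !inE subsetT.
rewrite big_distrr /= mulnC -sum_nat_const; exact: leq_sum count.
Qed.
End FiniteTypes.

(** * Tree-depth and weak reachability *)

Lemma td_le_height (G : sgraph) (Y : rforest) :
  subgraph G (forest_closure Y) -> td G <= height Y.
Proof.
move=> GY; rewrite /td; case: ex_minnP => h _; apply; apply/asboolP.
by exists Y.
Qed.

Lemma chi_p_le p (G : sgraph) k : td_colorable p G k -> chi_p p G <= k.
Proof. by rewrite /chi_p; case: ex_minnP => h _; apply. Qed.

Lemma chi_pP p (G : sgraph) : td_colorable p G (chi_p p G).
Proof. by rewrite /chi_p; case: ex_minnP. Qed.

Lemma chi_le (G : sgraph) k : colorable G k -> chi G <= k.
Proof. by rewrite /chi; case: ex_minnP => h _; apply. Qed.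

Lemma chiP (G : sgraph) : colorable G (chi G).
Proof. by rewrite /chi; case: ex_minnP. Qed.

Lemma tdP (G : sgraph) : exists2 Y : rforest,
  height Y = td G & subgraph G (forest_closure Y).
Proof. by rewrite /td; case: ex_minnP => h /asboolP. Qed.

Section EliminationForest.
Variables (G : sgraph) (rho : G -> nat).
Hypothesis rho_inj : injective rho.

Definition above u : rel G := fun x y => [&& adj x y, rho u <= rho x & rho u <= rho y].

(** The ancestors of v in the elimination forest of the ordering: u has least rank on some walk from
    v to u. This is weak reachability without a bound on the length. *)
Definition anc v u := connect (above u) v u.

Lemma above_sym u : symmetric (above u).
Proof. by move=> x y; rewrite /above adj_sym [(_ <= rho x) && _]andbC. Qed.

Lemma connect_above_sym u : connect_sym (above u).
Proof. by apply/sym_connect_sym/above_sym. Qed.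

Lemma connect_above_le u v x y : rho u <= rho v ->
  connect (above v) x y -> connect (above u) x y.
Proof.
move=> uv; apply: connect_sub => a b /and3P[ab va vb]; apply: connect1.
by rewrite /above ab !(leq_trans uv).
Qed.

Lemma anc_le v u : anc v u -> rho u <= rho v.
Proof. by case/connectP => -[|x p] /= => [_ -> //|/andP[/and3P[]]]. Qed.

Lemma anc_trans v u w : anc v u -> anc u w -> anc v w.
Proof.
move=> vu uw; apply: (connect_trans _ uw).
exact: connect_above_le (anc_le uw) vu.
Qed.

(** Both walks start at v and stay at ranks at least [rho u]; joined at v they lead from u' to u.
    The ancestors of v thus form a chain, and the highest proper one can serve as its parent. *)
Lemma anc_chain v u u' : anc v u -> anc v u' -> rho u <= rho u' -> anc u' u.
Proof.
move=> vu vu' le; apply: (connect_trans _ vu).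
by rewrite connect_above_sym; apply: connect_above_le le _.
Qed.

Definition elim_parent v := [pick u | [&& u != v, anc v u &
  [forall w, (w != v) && anc v w ==> (rho w <= rho u)]]].

Lemma elim_parentP v u : elim_parent v = Some u ->
  [/\ rho u < rho v, anc v u & forall w, w != v -> anc v w -> anc u w].
Proof.
rewrite /elim_parent; case: pickP => // x /and3P[xv vx /forallP max] [<-].
split=> // [|w wv vw].
  rewrite ltn_neqAle anc_le // andbT; apply: contraNN xv => /eqP /rho_inj ->.
  exact: eqxx.
by apply: (anc_chain vw vx); move: (max w); rewrite wv vw.
Qed.

Lemma elim_parent_exists v w : w != v -> anc v w -> exists u, elim_parent v = Some u.
Proof.
move=> wv vw; pose P u := (u != v) && anc v u.
have Pw : P w by rewrite /P wv.
case: (arg_maxnP rho Pw) => u /andP[uv vu] max.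
rewrite /elim_parent; case: pickP => [x _|/(_ u)]; first by exists x.
rewrite uv vu /= => /negP[]; apply/forallP => x; apply/implyP => Px.
exact: max.
Qed.

Lemma elim_connect_le x y :
  connect (parent_rel elim_parent) x y -> anc x y.
Proof.
case/connectP => p; elim: p x => [x _ ->|z p IH x] /=; first exact: connect0.
case/andP => /eqP/elim_parentP[_ xz _] /IH{}IH /IH; exact: anc_trans.
Qed.

Lemma elim_acyclic x y :
  elim_parent x = Some y -> ~~ connect (parent_rel elim_parent) y x.
Proof.
case/elim_parentP => yx _ _; apply/negP => /elim_connect_le/anc_le.
by rewrite leqNgt yx.
Qed.

Definition elim_forest : rforest := RForest elim_acyclic.

Lemma anc_below v u : anc v u -> @below elim_forest v u.
Proof.
move En: (rho v) => n; elim/ltn_ind: n v En => n IH v En vu.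
case: (eqVneq u v) => [->|uv]; first exact: connect0.
have [w vw] := elim_parent_exists uv vu; have [wv _ /(_ _ uv vu) wu] := elim_parentP vw.
apply: (@connect_trans _ _ w); first by apply: connect1; apply/eqP.
by apply: (IH (rho w)); rewrite -?En.
Qed.

(** The later end of an edge has the earlier end as an ancestor, so the closure of the elimination
    forest contains G. *)
Lemma td_le_anc h : (forall v, #|[set u | anc v u]| <= h) -> td G <= h.
Proof.
move=> hh; apply: (@leq_trans (height elim_forest)).
  apply: td_le_height; apply/existsP.
  exists [ffun x => (x : elim_forest)]; apply/andP; split.
    by apply/injectiveP => x y; rewrite !ffunE.
  apply/forallP=> x; apply/forallP=> y; apply/implyP=> xy; rewrite !ffunE /=.
  rewrite /closure_adj; apply/andP; split.
    by apply/eqP=> e; rewrite e adj_irrefl in xy.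
  have adj_anc a b : adj a b -> rho b <= rho a -> anc a b.
    by move=> ab ba; apply: connect1; rewrite /above ab ba leqnn.
  case/orP: (leq_total (rho y) (rho x)) => le; first by rewrite anc_below ?adj_anc.
  by rewrite (@anc_below y) ?orbT // adj_anc // adj_sym.
apply/bigmax_leqP => x _; apply: leq_trans (hh x).
apply: subset_leq_card; apply/fintype.subsetP => y.
by rewrite inE => /elim_connect_le xy; rewrite inE.
Qed.
End EliminationForest.

Definition wreach (G : sgraph) (rho : G -> nat) r v u :=
  exists p, [/\ path (above rho u) v p, last v p = u & size p <= r].

Lemma sorted_connecting (T : eqType) (e : rel T) (s : seq T) x y :
  symmetric e -> sorted e s -> x \in s -> y \in s ->
  exists q, [/\ path e x q, last x q = y & size q < size s].
Proof.
move=> e_sym; elim: s => //= a s IH es.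
have from_a z : z \in a :: s ->
    exists q, [/\ path e a q, last a q = z & size q <= size s].
  move=> zs; case/splitPl: zs es => p1 p2 lz; rewrite cat_path => /andP[p1P _].
  by exists p1; split=> //; rewrite size_cat leq_addr.
rewrite !inE => /predU1P[->|xs] ys; first by apply: from_a; rewrite inE.
case/predU1P: ys => [->|ys].
  have [|q [qP lq sq]] := from_a x; first by rewrite inE xs orbT.
  exists (rev (belast a q)); split; last by rewrite size_rev size_belast.
    by rewrite -lq rev_path; apply: sub_path qP => u v; rewrite e_sym.
  by case: q {qP sq} lq => [/= ->|b q _] //=; rewrite rev_cons last_rcons.
have [|q [qP lq sq]] := IH _ xs ys; first exact: path_sorted es.
by exists q; split=> //; apply: ltnW.
Qed.

Section Centered.
Variables (G : sgraph) (rho : G -> nat) (p k : nat) (c : G -> 'I_k).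
Hypothesis rho_inj : injective rho.
Hypothesis wreach_color :
  forall v u, wreach rho (2 ^ p) v u -> u != v -> c u != c v.

(* The least vertex of a path on at most 2^p vertices has a unique colour,
   and one of the two pieces that it leaves has at least half of the others. *)
Lemma path_colors i (s : seq G) : sorted (@adj _) s -> uniq s -> 2 ^ i <= size s <= 2 ^ p ->
  i < #|c @: [set z in s]|.
Proof.
elim: i s => [|i IH] s ss us /andP[les sle].
  case: s les {ss us sle} => // x s _.
  by apply/card_gt0P; exists (c x); apply: imset_f; rewrite !inE eqxx.
have [x xs] : exists x, x \in s.
  case: s les {ss us sle} => [|x s _]; last by exists x; rewrite inE eqxx.
  by rewrite leqn0 expn_eq0.
case: (arg_minnP rho xs) => m ms min.
have ss' : sorted (above rho m) s.
  have sm : all (fun w => rho m <= rho w) s by apply/allP.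
  apply: (sub_in_sorted _ sm ss) => a b ma mb ab.
  by move: ma mb; rewrite !unfold_in /above ab => -> ->.
have cm w : w \in s -> w != m -> c w != c m.
  move=> ws wm; rewrite eq_sym; apply: wreach_color; last by rewrite eq_sym.
  have [q [qP lq sq]] := sorted_connecting (@above_sym _ _ _) ss' ws ms.
  by exists q; split=> //; apply: ltnW; apply: leq_trans sq sle.
have step t : sorted (@adj _) t -> uniq t -> {subset t <= s} -> m \notin t ->
    2 ^ i <= size t -> i.+1 < #|c @: [set z in s]|.
  move=> st ut ts mt it; have := IH t st ut; rewrite it /=.
  rewrite (leq_trans (uniq_leq_size ut ts) sle) => /(_ isT) lt.
  have sub : c @: [set z in t] \subset (c @: [set z in s]) :\ c m.
    apply/fintype.subsetP => _ /imsetP[z zt ->]; rewrite inE in zt.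
    rewrite !inE cm ?ts //=; last by apply: contraNneq mt => <-.
    by apply: imset_f; rewrite inE ts.
  rewrite (cardsD1 (c m)) imset_f ?inE // add1n ltnS.
  exact: leq_trans lt (subset_leq_card sub).
case/splitPr: ms us ss les step => l r; rewrite cat_uniq /= => /and3P[ul].
rewrite negb_or => /andP[ml _] /andP[mr ur] /cat_sorted2[sl /path_sorted sr].
rewrite size_cat /= addnS expnS mul2n -addnn => les step.
case: (leqP (2 ^ i) (size l)) => [le|lt].
  by apply: (step l) => // z zl; rewrite mem_cat zl.
apply: (step r) => // [z zr|]; first by rewrite mem_cat inE zr !orbT.
by move: les lt; move: (2 ^ i) (size l) (size r) => a b d; lia.
Qed.

(** The colours are distinct on the ancestors of each vertex of the induced subgraph, so there are
    at most [#|I|] of them. Of two ancestors, one is an ancestor of the other. If the path between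
    them has length at most [2 ^ p], weak reachability separates their colours; otherwise its first
    [2 ^ p] vertices carry more than p colours, too many for [I]. *)
Lemma td_le_colors (I : {set 'I_k}) : #|I| <= p -> td (induced [set x | c x \in I]) <= #|I|.
Proof.
move=> Ip; set H := induced _; pose rho' (x : H) := rho (val x).
have rho'_inj : injective rho' by move=> x y /rho_inj /val_inj.
apply: (td_le_anc rho'_inj) => v.
have colI (x : H) : c (val x) \in I by have := valP x; rewrite inE.
suff inj : {in [set u | anc rho' v u] &, injective (fun u : H => c (val u))}.
  rewrite -(card_in_imset inj); apply: subset_leq_card.
  by apply/fintype.subsetP => _ /imsetP[u _ ->].
move=> u1 u2; rewrite !inE.
wlog le : u1 u2 / rho' u1 <= rho' u2 => [wl|] a1 a2 e12.
  by case/orP: (leq_total (rho' u1) (rho' u2)) => le; [|symmetry]; apply: wl.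
case/connectP: (anc_chain a1 a2 le) => q0 q0P u1E.
case/shortenP: q0P u1E => q qP uq _ {q0} u1E.
apply/eqP/contraT => neq.
have qP' : path (above rho (val u1)) (val u2) (map val q).
  by rewrite path_map; apply: sub_path qP => x y.
case: (leqP (size q) (2 ^ p)) => szq.
  have : c (val u1) != c (val u2).
    apply: wreach_color; last by apply: contraNneq neq => /val_inj ->.
    by exists (map val q); split; rewrite ?size_map ?last_map -?u1E.
  by rewrite e12 eqxx.
have sz : size (take (2 ^ p) (map val (u2 :: q))) = 2 ^ p.
  by rewrite size_take size_map /= ltnS (ltnW szq).
have := @path_colors p (take (2 ^ p) (map val (u2 :: q))).
rewrite sz !leqnn take_uniq ?(map_inj_uniq val_inj) // take_sorted /=; last first.
  by apply: sub_path qP' => x y /and3P[].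
move=> /(_ isT isT isT); rewrite ltnNge => /negP[]; apply: leq_trans Ip.
apply: subset_leq_card; apply/fintype.subsetP => _ /imsetP[z + ->].
by rewrite inE => /mem_take; rewrite inE => /predU1P[->|/mapP[w _ ->]]; exact: colI.
Qed.
End Centered.

(** In every set of vertices, the one of largest rank is related only to vertices that it weakly
    reaches, so the symmetrized relation is N-degenerate. *)
Lemma chi_p_le_wreach (G : sgraph) (rho : G -> nat) p N : injective rho ->
  (forall v, #|[set u | `[< wreach rho (2 ^ p) v u >]]| <= N) ->
  chi_p p G <= N.+1.
Proof.
move=> rho_inj WN; pose W v u := `[< wreach rho (2 ^ p) v u >].
have W_le v u : W v u -> rho u <= rho v.
  case/asboolP => -[|x q] [] /=; first by move=> _ ->.
  by case/andP => /and3P[].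
pose e v u := W v u || W u v.
have e_sym : symmetric e by move=> x y; rewrite /e orbC.
have [|c cP] := @degenerate_coloring G e N e_sym.
  move=> S /set0Pn[x0 x0S]; case: (arg_maxnP rho x0S) => v vS max.
  exists v => //; apply: leq_trans (WN v); apply: subset_leq_card.
  apply/fintype.subsetP => u; rewrite !inE => /andP[uS /orP[//|/W_le vu]].
  suff -> : u = v by apply/asboolP; exists [::].
  by apply: rho_inj; apply/eqP; rewrite eqn_leq vu andbT; apply: max.
apply: chi_p_le; apply/existsP; exists [ffun x => c x].
apply/forallP => I; apply/implyP => Ip.
have -> : [set x | [ffun x => c x] x \in I] = [set x | c x \in I].
  by apply/setP => x; rewrite !inE ffunE.
apply: (td_le_colors rho_inj _ Ip) => v u vu uv; apply: cP => //.
by apply/orP; right; apply/asboolP.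
Qed.

(** A class of a proper colouring is edgeless, so in its elimination forest every vertex is its only
    ancestor. *)
Lemma chi_1_le_chi (G : sgraph) : chi_p 1 G <= chi G.
Proof.
have /existsP[c /forallP cP] := chiP G.
apply: chi_p_le; apply/existsP; exists c; apply/forallP => I; apply/implyP => I1.
pose rho (x : induced [set x | c x \in I]) := val (enum_rank x).
have rho_inj : injective rho by move=> x y /val_inj /enum_rank_inj.
apply: (td_le_anc rho_inj) => v.
have colI (x : induced [set x | c x \in I]) : c (val x) \in I by have := valP x; rewrite inE.
have I_gt0 : 0 < #|I| by apply/card_gt0P; exists (c (val v)).
apply: leq_trans I_gt0; rewrite -[X in _ <= X](cards1 v); apply: subset_leq_card.
apply/fintype.subsetP => u; rewrite !inE => /connectP[[|w q] /=]; first by move=> _ ->.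
case/andP => /and3P[vw _ _] _ _.
have /forallP/(_ (val w))/implyP/(_ vw)/negP[] := cP (val v).
by apply/eqP; apply: (card_le1_eqP I1).
Qed.

(** * Systems of paths and fans *)

Lemma leq_card_bigcup (I T : finType) (A : {pred I}) (F : I -> {set T}) :
  #|\bigcup_(i in A) F i| <= \sum_(i in A) #|F i|.
Proof.
apply: (big_ind2 (fun (X : {set T}) n => #|X| <= n)) => // [|X m Y n Xm Yn].
  by rewrite cards0.
by rewrite cardsU (leq_trans (leq_subr _ _)) ?leq_add.
Qed.

Lemma card_seq_set (T : finType) (s : seq T) : #|[set z in s]| <= size s.
Proof. by rewrite cardsE; apply: card_size. Qed.

Section Paths.
Variable G : sgraph.
Implicit Types (S A : {set G}) (q : seq G).

Lemma path_rev_rcons (e : rel G) a q b : symmetric e ->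
  path e a (rcons q b) -> path e b (rcons (rev q) a).
Proof.
move=> e_sym h; have := rev_path e a (rcons q b).
rewrite last_rcons belast_rcons rev_cons => ->.
by apply: sub_path h => x y; rewrite e_sym.
Qed.

Lemma shorten_interior (e : rel G) a q b : a != b -> path e a (rcons q b) ->
  exists q', [/\ path e a (rcons q' b), uniq (a :: rcons q' b),
    {subset q' <= q} & size q' <= size q].
Proof.
move=> ab qP; have lq : last a (rcons q b) = b by rewrite last_rcons.
move: lq; case/shortenP: qP => p' pP' up sub.
case/lastP: p' pP' up sub => [_ _ _ /= e0|p' b']; first by rewrite e0 eqxx in ab.
rewrite last_rcons => pP' up sub e0; subst b'.
move: (up); rewrite /= rcons_uniq => /and3P[_ bp up'].
have sub' : {subset p' <= q}.
  move=> z zp; have := sub z; rewrite !mem_rcons !inE zp orbT => /(_ isT).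
  by case/predU1P => // zb; rewrite -zb zp in bp.
by exists p'; split=> //; apply: uniq_leq_size.
Qed.

(* A system of paths (given by their interiors) with at most r interior vertices
   that realizes the graph E on A as a topological minor. *)
Record path_system r A (E : rel G) (P : G -> G -> seq G) : Prop := PathSystem {
  ps_sym : symmetric E;
  ps_irr : irreflexive E;
  ps_mem : forall a b, E a b -> a \in A;
  ps_rev : forall a b, E a b -> P b a = rev (P a b);
  ps_path : forall a b, E a b -> path (@adj G) a (rcons (P a b) b);
  ps_uniq : forall a b, E a b -> uniq (P a b);
  ps_size : forall a b, E a b -> size (P a b) <= r;
  ps_out : forall a b z, E a b -> z \in P a b -> z \notin A;
  ps_disj : forall a b a' b' z, E a b -> E a' b' -> z \in P a b -> z \in P a' b' ->
    a = a' /\ b = b' \/ a = b' /\ b = a' }.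

Lemma path_system_of_directed r A (D : rel G) (P : G -> G -> seq G) :
  (forall a b, D a b -> [/\ a \in A, b \in A & ~~ D b a]) ->
  (forall a b, D a b -> [/\ path (@adj G) a (rcons (P a b) b), uniq (P a b) &
     size (P a b) <= r]) ->
  (forall a b z, D a b -> z \in P a b -> z \notin A) ->
  (forall a b a' b' z, D a b -> D a' b' -> z \in P a b -> z \in P a' b' ->
     a = a' /\ b = b') ->
  path_system r A (fun a b => D a b || D b a)
    (fun a b => if D a b then P a b else rev (P b a)).
Proof.
move=> DA DP Dout Ddisj; pose P' a b := if D a b then P a b else rev (P b a).
have D_asym a b : D a b -> D b a = false by case/DA => _ _ /negbTE.
have memP a b z : z \in P' a b -> D a b || D b a ->
    (D a b /\ z \in P a b) \/ (D b a /\ z \in P b a).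
  rewrite /P'; case: ifP => [ab zab _|ab]; first by left.
  by rewrite mem_rev /= => zba ba; right.
split.
- by move=> a b; rewrite orbC.
- move=> a; rewrite orbb; apply/negP => aa; by have := D_asym _ _ aa; rewrite aa.
- by move=> a b /orP[] /DA[].
- move=> a b /orP[] ab; first by rewrite ab D_asym.
  by rewrite ab D_asym // revK.
- move=> a b /orP[] ab; first by rewrite ab; case: (DP _ _ ab).
  rewrite D_asym //; apply: path_rev_rcons (@adj_sym G) _.
  by case: (DP _ _ ab).
- move=> a b /orP[] ab; first by rewrite ab; case: (DP _ _ ab).
  by rewrite D_asym // rev_uniq; case: (DP _ _ ab).
- move=> a b /orP[] ab; first by rewrite ab; case: (DP _ _ ab).
  by rewrite D_asym // size_rev; case: (DP _ _ ab).
- by move=> a b z ab /memP/(_ ab)[] [ab' zab]; apply: Dout ab' zab.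
- move=> a b a' b' z ab ab' /memP/(_ ab)[] [{}ab zab] /memP/(_ ab')[] [{}ab' zab'].
  + by left; apply: Ddisj zab zab'.
  + by right; apply: Ddisj zab zab'.
  + by right; case: (Ddisj _ _ _ _ _ ab ab' zab zab').
  + by left; case: (Ddisj _ _ _ _ _ ab ab' zab zab').
Qed.

Lemma path_system_extend r A E P a b q : path_system r A E P ->
  a \in A -> b \in A -> a != b -> ~~ E a b ->
  path (@adj G) a (rcons q b) -> size q <= r ->
  (forall z, z \in q -> z \notin A) ->
  (forall z x y, z \in q -> E x y -> z \notin P x y) ->
  exists E' P', path_system r A E' P' /\
    #|[set p | E p.1 p.2]| < #|[set p | E' p.1 p.2]|.
Proof.
move=> [Es Ei Em Er Ep Eu Ez Eo Ed] aA bA ab nE.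
move=> /(shorten_interior ab)[p' [pP' up sub' sp']] sq qA qE.
move: up; rewrite /= rcons_uniq => /and3P[_ _ up].
have nE' : ~~ E b a by rewrite Es.
pose new x y := ((x == a) && (y == b)).
pose E' x y := [|| E x y, new x y | new y x].
pose P' x y := if E x y then P x y else if new x y then p' else rev p'.
have EN x y : E x y -> new x y = false.
  by move=> xy; apply/negP => /andP[/eqP e /eqP e']; rewrite e e' (negbTE nE) in xy.
have EN' x y : E x y -> new y x = false.
  by move=> xy; apply/negP => /andP[/eqP e /eqP e']; rewrite e e' (negbTE nE') in xy.
have Pab : P' a b = p' by rewrite /P' (negbTE nE) /new !eqxx.
have Pba : P' b a = rev p'.
  by rewrite /P' (negbTE nE') /new [b == a]eq_sym (negbTE ab).
have cases x y : E' x y -> [\/ E x y, x = a /\ y = b | x = b /\ y = a].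
  by case/or3P => [->|/andP[/eqP-> /eqP->]|/andP[/eqP-> /eqP->]]; constructor.
exists E', P'; split; last first.
  apply: proper_card; rewrite properE; apply/andP; split.
    by apply/fintype.subsetP => p; rewrite !inE /E' => ->.
  apply/fintype.subsetPn; exists (a, b); rewrite !inE //=.
  by rewrite /E' /new !eqxx orbT.
have PE x y : E x y -> P' x y = P x y by rewrite /P' => ->.
have Es' : symmetric E' by move=> x y; rewrite /E' Es [X in _ || X]orbC.
have Ei' : irreflexive E'.
  move=> x; rewrite /E' Ei orbb; apply/negP => /andP[/eqP xa /eqP xb].
  by rewrite -xa xb eqxx in ab.
move: P' E' Pab Pba cases PE Es' Ei' {EN EN'} => P' E' Pab Pba cases PE Es' Ei'.
split=> //.
- by move=> x y /cases[/Em|[-> _]|[-> _]].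
- move=> x y /cases[xy|[-> ->]|[-> ->]]; rewrite ?Pab ?Pba ?revK //.
  have yx : E y x by rewrite Es.
  by rewrite (PE _ _ xy) (PE _ _ yx); apply: Er.
- move=> x y /cases[xy|[-> ->]|[-> ->]]; rewrite ?Pab ?Pba ?PE //; first exact: Ep.
  exact: path_rev_rcons (@adj_sym G) _.
- by move=> x y /cases[xy|[-> ->]|[-> ->]]; rewrite ?Pab ?Pba ?PE ?rev_uniq //; apply: Eu.
- have sp : size p' <= r by apply: leq_trans sq.
  by move=> x y /cases[xy|[-> ->]|[-> ->]]; rewrite ?Pab ?Pba ?PE ?size_rev //; apply: Ez.
- move=> x y z /cases[xy|[-> ->]|[-> ->]]; rewrite ?Pab ?Pba ?PE ?mem_rev //.
  + exact: Eo.
  + by move/sub'/qA.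
  + by move/sub'/qA.
- have clash x y z : E x y -> z \in P x y -> z \in p' -> False.
    by move=> xy zxy /sub' zq; move: (qE _ _ _ zq xy); rewrite zxy.
  move=> x y x' y' z /cases[xy|[-> ->]|[-> ->]] /cases[xy'|[-> ->]|[-> ->]];
    rewrite ?Pab ?Pba ?PE ?mem_rev //; try by [left | right].
  + exact: Ed.
  + by move=> zP zp; case: (clash _ _ _ xy zP zp).
  + by move=> zP zp; case: (clash _ _ _ xy zP zp).
  + by move=> zp zP; case: (clash _ _ _ xy' zP zp).
  + by move=> zp zP; case: (clash _ _ _ xy' zP zp).
Qed.

Lemma maximal_path_system r A : exists E P, path_system r A E P /\
  forall a b q, a \in A -> b \in A -> a != b -> ~~ E a b ->
    path (@adj G) a (rcons q b) -> size q <= r ->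
    (forall z, z \in q -> z \notin A) ->
    exists z x y, [/\ z \in q, E x y & z \in P x y].
Proof.
pose ok n := `[< exists E P, path_system r A E P /\ #|[set p | E p.1 p.2]| = n >].
have ok0 : ok 0.
  apply/asboolP; exists (fun _ _ => false), (fun _ _ => [::]); split=> //.
  by apply/eqP; rewrite cards_eq0; apply/eqP/setP => p; rewrite !inE.
have okb n : ok n -> n <= #|{: G * G}|.
  by case/asboolP => E [P [_ <-]]; apply: max_card.
case: (ex_maxnP (ex_intro _ 0 ok0) okb) => n /asboolP[E [P [EP En]]] max.
exists E, P; split=> // a b q aA bA ab nE qP sq qA.
apply: contrapT => no.
have [|E' [P' [EP' lt]]] := path_system_extend EP aA bA ab nE qP sq qA.
  move=> z x y zq xy; apply/negP => zxy; apply: no.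
  by exists z, x, y.
have := max #|[set p | E' p.1 p.2]|; rewrite -En leqNgt lt => /(_ _)/negP; apply => //.
by apply/asboolP; exists E', P'.
Qed.

(** The sequence p omits the start v and stops at its first vertex in S. Families of such paths that
    are disjoint apart from v define admissibility, with S the initial segment of the ordering at
    v. *)
Definition fan_path r S v p := exists q w, [/\ p = rcons q w, path (@adj G) v p,
  size p <= r, w \in S & forall z, z \in q -> z \notin S].

Definition fan r S v m (F : 'I_m -> seq G) :=
  (forall i, fan_path r S v (F i) /\ uniq (v :: F i)) /\
  (forall i j z, z \in F i -> z \in F j -> i = j).

Lemma fan_narrow r S v m m' (F : 'I_m -> seq G) : m' <= m -> fan r S v F ->
  exists F' : 'I_m' -> seq G, fan r S v F'.
Proof.
move=> le [FP Fd]; exists (fun i => F (widen_ord le i)); split=> [i|i j z zi zj].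
  exact: FP.
by apply: val_inj; have /(congr1 val) := Fd _ _ _ zi zj.
Qed.

Lemma fan_extend r S v m (F : 'I_m -> seq G) p : fan r S v F ->
  fan_path r S v p -> uniq (v :: p) -> (forall i z, z \in F i -> z \notin p) ->
  exists F' : 'I_m.+1 -> seq G, fan r S v F'.
Proof.
move=> [FP Fd] pP up pF; exists (fun i => if unlift ord_max i is Some j then F j else p).
split=> [i|i j z]; first by case: unliftP.
case: unliftP => [i' ->|->]; case: unliftP => [j' ->|->] //.
- by move=> zi zj; rewrite (Fd _ _ _ zi zj).
- by move=> zi; rewrite (negbTE (pF _ _ zi)).
- by move=> + zj; rewrite (negbTE (pF _ _ zj)).
Qed.

(** The paths of a maximal fan at v cover a set H of at most [m * r] vertices other than v. A path
    witnessing that v weakly reaches u enters the initial segment, at u at the latest; by maximality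
    it has met H by then, and from that vertex u is weakly reached in one step less. Iterating gives
    the geometric sum. *)
Lemma card_wreach (rho : G -> nat) r m : injective rho ->
  (forall v (F : 'I_m -> seq G), ~ fan r [set u | rho u <= rho v] v F) ->
  forall k v, k <= r ->
    #|[set u | `[< wreach rho k v u >]]| <= \sum_(i < k.+1) (m * r) ^ i.
Proof.
move=> rho_inj nofan; elim=> [|k IH] v kr.
  rewrite big_ord_recl big_ord0 -[X in _ <= X](cards1 v); apply: subset_leq_card.
  apply/fintype.subsetP => u; rewrite !inE => /asboolP[[|x p]] [] //= _ ->.
  by rewrite eqxx.
set S := [set u | rho u <= rho v].
pose ok n := `[< exists F : 'I_n -> seq G, fan r S v F >].
have ok0 : ok 0 by apply/asboolP; exists (fun=> [::]); split=> -[].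
have okb n : ok n -> n <= m.
  case/asboolP => F FP; rewrite leqNgt; apply/negP => /ltnW mn.
  by have [F'] := fan_narrow mn FP; apply: nofan.
case: (ex_maxnP (ex_intro _ 0 ok0) okb) => n okn max.
have nm := okb _ okn; case/asboolP: okn => F FP.
pose H := \bigcup_(i in 'I_n) [set z in F i].
have cH : #|H| <= m * r.
  apply: leq_trans (leq_card_bigcup _ _) _.
  apply: (@leq_trans (\sum_(i in 'I_n) r)).
    apply: leq_sum => i _; apply: leq_trans (card_seq_set _) _.
    by have [[q [w []]]] := FP.1 i.
  by rewrite sum_nat_const card_ord leq_mul2r nm orbT.
pose W h := [set u | `[< wreach rho k h u >]].
suff sub : [set u | `[< wreach rho k.+1 v u >]] \subset v |: \bigcup_(h in H) W h.
  apply: leq_trans (subset_leq_card sub) _; rewrite cardsU1.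
  rewrite big_ord_recl expn0; apply: leq_add; first by case: (_ \notin _).
  apply: leq_trans (leq_card_bigcup _ _) _.
  apply: (@leq_trans (\sum_(h in H) \sum_(i < k.+1) (m * r) ^ i)).
    by apply: leq_sum => h _; apply: IH; apply: ltnW.
  have -> : \sum_(i < k.+1) (m * r) ^ lift ord0 i = m * r * \sum_(i < k.+1) (m * r) ^ i.
    by rewrite big_distrr; apply: eq_bigr => i _; rewrite /= -expnS.
  by rewrite sum_nat_const leq_mul2r cH orbT.
apply/fintype.subsetP => u; rewrite inE => /asboolP[p0 [p0P lu sp0]].
rewrite !inE; case: (eqVneq u v) => //= uv.
have [p [pP up lp sp]] : exists p, [/\ path (above rho u) v p, uniq (v :: p),
    last v p = u & size p <= k.+1].
  move: lu; case/shortenP: p0P => p pP up sub lu.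
  exists p; split=> //; apply: leq_trans sp0; apply: uniq_leq_size => //.
  by case/andP: up.
have up' : u \in p.
  by have := mem_last v p; rewrite lp inE (negbTE uv).
have uS : u \in S.
  rewrite inE; case: p pP {up lp sp} up' => //= x p /andP[/and3P[_ uv' _] _] _.
  exact: uv'.
have [h hH hp] : exists2 h, h \in H & h \in p.
  apply: contrapT => no.
  have hasS : has (mem S) p by apply/hasP; exists u.
  move: pP up sp no; case/split_find: hasS => w q p2 wS qS.
  rewrite cat_path -cat_cons cat_uniq => /andP[qP _] /andP[uq _] sp no.
  have [||i z zi|F' F'P] := fan_extend (p := rcons q w) FP.
  - exists q, w; split=> //.
    + by apply: sub_path qP => x y /and3P[].
    + by apply: leq_trans kr; apply: leq_trans sp; rewrite size_cat leq_addr.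
    + by move=> z zq; apply: contraNN qS => zS; apply/hasP; exists z.
  - exact: uq.
  - apply/negP => zq; apply: no; exists z; last by rewrite mem_cat zq.
    by apply/bigcupP; exists i => //; rewrite inE.
  - by have := max n.+1; rewrite ltnn => /(_ _)/negP; apply => //; apply/asboolP; exists F'.
apply/bigcupP; exists h => //; rewrite inE; apply/asboolP.
case/splitPr: hp pP lp sp => p1 p2; rewrite cat_path last_cat /= => /and3P[_ _ p2P] lp.
rewrite size_cat /= => sp; exists p2; split=> //.
by move: sp; rewrite addnS ltnS; apply: leq_trans; apply: leq_addl.
Qed.
End Paths.

(** * Admissibility *)

Lemma low_degree_half (T : finType) (e : rel T) (S : {set T}) l :
  \sum_(x in S) #|[set y | e x y]| <= l * #|S| ->
  #|S| <= 2 * #|[set x in S | #|[set y | e x y]| <= 2 * l]|.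
Proof.
set L := [set x in S | _] => sparse.
have LS : L \subset S by apply/fintype.subsetP => x; rewrite inE => /andP[].
have : (2 * l).+1 * #|S :\: L| <= l * #|S|.
  apply: leq_trans sparse; rewrite mulnC -sum_nat_const.
  rewrite [X in _ <= X](big_setID (S :\: L)) /= (setIidPr (subsetDl S L)).
  apply: leq_trans (leq_addr _ _); apply: leq_sum => x.
  by rewrite !inE => /andP[+ xS]; rewrite xS -ltnNge.
have -> : #|S| = #|L| + #|S :\: L| by rewrite -(cardsID L S) (setIidPr LS).
by move: #|_| #|_| => a b; nia.
Qed.

(** A maximal independent subset of S dominates S, and each of its members accounts for at most
    [d.+1] vertices. *)
Lemma independent_dominating (T : finType) (e : rel T) (S : {set T}) d :
  symmetric e -> irreflexive e ->
  (forall x, x \in S -> #|[set y | e x y]| <= d) ->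
  exists R : {set T}, [/\ R \subset S, {in R &, forall x y, ~~ e x y} &
    #|S| <= d.+1 * #|R|].
Proof.
move=> e_sym e_irr deg.
pose indep (R : {set T}) := (R \subset S) && [forall x in R, forall y in R, ~~ e x y].
have indep0 : indep set0.
  by rewrite /indep sub0set; apply/forall_inP => x; rewrite inE.
case: (arg_maxnP (fun R : {set T} => #|R|) indep0) => R /andP[RS /forall_inP RP] max.
have Rind : {in R &, forall x y, ~~ e x y} by move=> x y /RP/forall_inP; apply.
exists R; split=> //.
apply: (@leq_trans #|\bigcup_(x in R) (x |: [set y | e x y])|).
  apply: subset_leq_card; apply/fintype.subsetP => x xS; apply/bigcupP.
  case: (boolP (x \in R)) => xR; first by exists x; rewrite ?setU11.
  suff [y yR xy] : exists2 y, y \in R & e x y.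
    by exists y => //; rewrite !inE e_sym xy orbT.
  apply: contrapT => no.
  have nx y : y \in R -> ~~ e x y by move=> yR; apply/negP => xy; apply: no; exists y.
  have /max : indep (x |: R).
    apply/andP; split; first by rewrite subUset sub1set xS.
    apply/forall_inP => a /setU1P[->|aR]; apply/forall_inP => b /setU1P[->|bR].
    - by rewrite e_irr.
    - exact: nx.
    - by rewrite e_sym; apply: nx.
    - exact: Rind.
  by rewrite /= cardsU1 xR add1n ltnn.
apply: leq_trans (leq_card_bigcup _ _) _; rewrite mulnC -sum_nat_const.
apply: leq_sum => x xR; rewrite cardsU1 -add1n leq_add //; first by case: (_ \notin _).
by apply: deg; move/fintype.subsetP: RS; apply.
Qed.

(** Suppose that every vertex of S has a fan of m paths. A maximal path system on S has at most
    [l * #|S|] pairs, hence at most [2 * r * l * #|S|] interior vertices M; an independent set R of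
    vertices of low degree in it has at least [#|S| / (2 * (2 * l).+1)] elements. At this value of m
    the inequality [#|R| * (m - 2 * l) <= l * (#|R| + #|M|)] fails. *)
Definition adm_bound r l := 2 * l + 2 * (2 * l).+1 * (l * (1 + 2 * r * l)) + 1.

Section Admissibility.
Variables (G : sgraph) (r l : nat).
Hypothesis density : forall (A : {set G}) E P, path_system (2 * r) A E P ->
  #|[set p | E p.1 p.2]| <= l * #|A|.

Section Fans.
Variables (S : {set G}) (E : rel G) (R M : {set G}).
Variables (m : nat) (F : G -> 'I_m -> seq G).
Hypothesis Emax : forall a b q, a \in S -> b \in S -> a != b -> ~~ E a b ->
  path (@adj G) a (rcons q b) -> size q <= 2 * r ->
  (forall z, z \in q -> z \notin S) ->
  exists2 z, z \in q & z \in M.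
Hypothesis MS : forall z, z \in M -> z \notin S.
Hypothesis RS : R \subset S.
Hypothesis Rind : {in R &, forall x y, ~~ E x y}.
Hypothesis Rdeg : forall x, x \in R -> #|[set y | E x y]| <= 2 * l.
Hypothesis FP : forall v, v \in R -> fan r S v (F v).

Let hits v i := has (mem M) (F v i).
Let hit v i := nth v (F v i) (find (mem M) (F v i)).
Let stub v i := take (find (mem M) (F v i)) (F v i).

Lemma stubP v i : v \in R -> hits v i ->
  [/\ hit v i \in M, path (@adj G) v (rcons (stub v i) (hit v i)), uniq (stub v i),
      (size (stub v i)).+1 <= r & forall z, z \in stub v i -> z \notin S /\ z \notin M].
Proof.
move=> vR hvi; have [[q [w [Fq Fpath Fsize wS qS]]] Funiq] := (FP vR).1 i.
have find_lt : find (mem M) (F v i) < size (F v i) by rewrite -has_find.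
have Fcat : F v i = rcons (stub v i) (hit v i) ++ drop (find (mem M) (F v i)).+1 (F v i).
  by rewrite -take_nth // cat_take_drop.
have hM : hit v i \in M by apply: (nth_find v hvi).
split=> //.
- by move: Fpath; rewrite Fcat cat_path => /andP[].
- by apply: take_uniq; case/andP: Funiq.
- apply: leq_trans Fsize; rewrite [X in _ <= size X]Fcat size_cat size_rcons.
  exact: leq_addr.
- move=> z zs; split; last first.
    apply/negP => zM; have : has (mem M) (stub v i) by apply/hasP; exists z.
    by rewrite has_take ?ltnn // has_find.
  have szq : find (mem M) (F v i) <= size q.
    by move: find_lt; rewrite {2}Fq size_rcons.
  have sq : stub v i = take (find (mem M) (F v i)) q.
    by rewrite /stub [X in take _ X]Fq -cats1 takel_cat.
  by apply: qS; rewrite sq in zs; apply: mem_take zs.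
Qed.

(** A path of the fan that avoids M ends at an E-neighbour of v, as it could otherwise be added to
    the maximal system. The ends are distinct and v has at most [2 * l] E-neighbours. *)
Lemma card_hits v : v \in R -> m <= 2 * l + #|[set i | hits v i]|.
Proof.
move=> vR; rewrite -[X in X <= _](card_ord m) -(cardsC [set i | hits v i]) addnC.
rewrite leq_add2r; apply: leq_trans (Rdeg vR).
pose lst i := last v (F v i).
have inj : {in ~: [set i | hits v i] &, injective lst}.
  have lstF i : lst i \in F v i.
    have [[q [w [Fq _ _ _ _]]] _] := (FP vR).1 i.
    by rewrite /lst Fq last_rcons mem_rcons inE eqxx.
  by move=> i j _ _ e; apply: ((FP vR).2 i j (lst i)); rewrite // e.
rewrite -(card_in_imset inj); apply: subset_leq_card.
apply/fintype.subsetP => _ /imsetP[i + ->]; rewrite !inE => nhit.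
have [[q [w [Fq Fpath Fsize wS qS]]] Funiq] := (FP vR).1 i.
rewrite /lst Fq last_rcons; apply: contraT => nE.
have vw : v != w.
  by apply: contraTneq Funiq => vw; rewrite Fq vw /= mem_rcons inE eqxx.
have [|||z zq zM] := @Emax v w q _ wS vw nE _ _ qS => //.
- by move/fintype.subsetP: RS; apply.
- by rewrite -Fq.
- by move: Fsize; rewrite Fq size_rcons; lia.
case/negP: nhit; apply/hasP; exists z => //.
by rewrite Fq mem_rcons inE zq orbT.
Qed.

(** If stubs of distinct v and v' in R met, they would contain a path from v to v' with at most
    [2 * r] interior vertices, avoiding S and M, although [E v v'] fails. This is why the systems
    allow [2 * r] interior vertices for fans of paths of length r. *)
Lemma stub_disjoint v i v' i' z : v \in R -> v' \in R -> hits v i -> hits v' i' ->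
  z \in stub v i -> z \in stub v' i' -> v = v' /\ hit v i = hit v' i'.
Proof.
move=> vR v'R hi hi' zi zi'; case: (eqVneq v v') => [vv'|vv'].
  subst v'; split=> //; suff -> : i = i' by [].
  by apply: ((FP vR).2 i i' z); [apply: mem_take zi | apply: mem_take zi'].
have inS x : x \in R -> x \in S by move/fintype.subsetP: RS; apply.
have [_ p1 _ s1 n1] := stubP vR hi; have [_ p2 _ s2 n2] := stubP v'R hi'.
case/splitPr: zi p1 s1 n1 => a1 b1 p1 s1 n1.
case/splitPr: zi' p2 s2 n2 => a2 b2 p2 s2 n2.
have [|||||||x xq xM] := @Emax v v' (a1 ++ z :: rev a2) => //.
- exact: inS.
- exact: inS.
- exact: Rind.
- rewrite rcons_cat -cat_rcons cat_path last_rcons; apply/andP; split.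
    by move: p1; rewrite rcons_cat -cat_rcons cat_path => /andP[].
  apply: path_rev_rcons (@adj_sym G) _.
  by move: p2; rewrite rcons_cat -cat_rcons cat_path => /andP[].
- by move: s1 s2; rewrite !size_cat /= size_rev; lia.
- move=> x; rewrite mem_cat inE mem_rev => /or3P[xa|/eqP->|xa].
  + by apply: (n1 x _).1; rewrite mem_cat xa.
  + by apply: (n1 z _).1; rewrite mem_cat inE eqxx orbT.
  + by apply: (n2 x _).1; rewrite mem_cat xa.
exfalso; move: xq; rewrite mem_cat inE mem_rev => /or3P[xa|/eqP xz|xa].
- by have := (n1 x _).2; rewrite mem_cat xa xM => /(_ isT).
- by have := (n1 z _).2; rewrite mem_cat inE eqxx orbT -xz xM => /(_ isT).
- by have := (n2 x _).2; rewrite mem_cat xa xM => /(_ isT).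
Qed.

(** Each stub, completed by its hit, joins a vertex of R to one of M. Being disjoint, the stubs form
    a path system on [R :|: M], to which [density] applies, and every v in R contributes at least
    [m - 2 * l] pairs. *)
Lemma fans_bound : #|R| * (m - 2 * l) <= l * (#|R| + #|M|).
Proof.
have RM x : x \in R -> x \notin M.
  by move=> xR; apply/negP => /MS; move/fintype.subsetP: RS => ->.
pose D v x := (v \in R) && [exists i, hits v i && (hit v i == x)].
have DP v x : D v x -> v \in R /\ exists2 i, hits v i & hit v i = x.
  by case/andP => vR /existsP[i /andP[hi /eqP]]; split=> //; exists i.
pose Q v x := if [pick i | hits v i && (hit v i == x)] is Some i then stub v i else [::].
have QP v x : D v x -> [/\ v \in R, x \in M & exists i, [/\ hits v i, hit v i = x & Q v x = stub v i]].
  move=> /DP[vR [i hi hx]]; have [xM _ _ _ _] := stubP vR hi; rewrite hx in xM.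
  split=> //; rewrite /Q; case: pickP => [j /andP[hj /eqP hjx]|/(_ i)]; first by exists j.
  by rewrite hi hx eqxx.
have : path_system (2 * r) (R :|: M) (fun a b => D a b || D b a)
    (fun a b => if D a b then Q a b else rev (Q b a)).
  apply: path_system_of_directed.
  - move=> a b /QP[aR bM _]; split; rewrite ?inE ?aR ?bM ?orbT //.
    by apply/negP => /QP[bR _ _]; case/negP: (RM _ bR).
  - move=> a b /QP[aR bM [i [hi hb ->]]]; have [_ p u s _] := stubP aR hi.
    by split=> //; [rewrite -hb | move: s; lia].
  - move=> a b z /QP[aR bM [i [hi hb ->]]]; have [_ _ _ _ n] := stubP aR hi.
    move/n => [zS zM]; rewrite inE negb_or zM andbT.
    by apply: contra zS; move/fintype.subsetP: RS; apply.
  - move=> a b a' b' z /QP[aR bM [i [hi hb ->]]] /QP[aR' bM' [i' [hi' hb' ->]]].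
    by rewrite -hb -hb' => zi zi'; have := stub_disjoint aR aR' hi hi' zi zi'.
move/density; rewrite cardsU => h.
apply: (@leq_trans (l * #|R :|: M|)); last first.
  by rewrite leq_mul2l cardsU leq_subr orbT.
apply: leq_trans (_ : _ <= #|[set p | D p.1 p.2]|) _; last first.
  rewrite cardsU; apply: leq_trans h; apply: subset_leq_card.
  by apply/fintype.subsetP => p; rewrite !inE => ->.
rewrite card_set_pairs (bigID (mem R)) /=; apply: leq_trans (leq_addr _ _).
rewrite -sum_nat_const; apply: leq_sum => v vR.
rewrite leq_subLR; apply: leq_trans (card_hits vR) _; rewrite leq_add2l.
have inj : {in [set i | hits v i] &, injective (hit v)}.
  move=> i j; rewrite !inE => hi hj e; apply: ((FP vR).2 i j (hit v i)).
    by apply: mem_nth; rewrite -has_find.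
  by rewrite e; apply: mem_nth; rewrite -has_find.
rewrite -(card_in_imset inj); apply: subset_leq_card.
apply/fintype.subsetP => _ /imsetP[i + ->]; rewrite !inE => hi.
by rewrite /D vR; apply/existsP; exists i; rewrite hi eqxx.
Qed.
End Fans.

Lemma admissible (S : {set G}) : S != set0 ->
  exists2 v, v \in S & forall F : 'I_(adm_bound r l) -> seq G, ~ fan r S v F.
Proof.
move=> S0; apply: contrapT => no.
set m := adm_bound r l in no.
have /choice[F FP] v : exists Fv : 'I_m -> seq G, v \in S -> fan r S v Fv.
  case: (pselect (exists F : 'I_m -> seq G, fan r S v F)) => [[F FP]|nF]; first by exists F.
  by exists (fun=> [::]) => vS; case: no; exists v => // F FP; apply: nF; exists F.
have [E [P [EP Emax]]] := maximal_path_system (2 * r) S.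
pose M := \bigcup_(p in [set p | E p.1 p.2]) [set z in P p.1 p.2].
have cE := density EP.
have cM : #|M| <= 2 * r * (l * #|S|).
  apply: leq_trans (leq_card_bigcup _ _) _; rewrite mulnC.
  apply: (@leq_trans (\sum_(p in [set p | E p.1 p.2]) 2 * r)).
    apply: leq_sum => p; rewrite inE => pE; apply: leq_trans (card_seq_set _) _.
    exact: (ps_size EP pE).
  by rewrite sum_nat_const leq_mul2r cE orbT.
have SE : \sum_(x in S) #|[set y | E x y]| <= l * #|S|.
  apply: leq_trans cE; rewrite card_set_pairs [X in _ <= X](bigID (mem S)) /=.
  exact: leq_addr.
have cS := low_degree_half SE.
have [x|R [RS Rind cR]] := @independent_dominating _ E
  [set x in S | #|[set y | E x y]| <= 2 * l] (2 * l) (ps_sym EP) (ps_irr EP).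
  by rewrite inE => /andP[].
have RS' : R \subset S.
  by apply: fintype.subset_trans RS _; apply/fintype.subsetP => x; rewrite inE => /andP[].
have MP z : z \in M -> exists x y, E x y /\ z \in P x y.
  by case/bigcupP => p; rewrite !inE => pE zp; exists p.1, p.2.
have fb : #|R| * (m - 2 * l) <= l * (#|R| + #|M|).
  apply: (fans_bound (F := F) (E := E) (S := S)) => //.
  - move=> a b q aS bS ab nE qP sq qS.
    have [z [x [y [zq xy zP]]]] := Emax a b q aS bS ab nE qP sq qS.
    by exists z => //; apply/bigcupP; exists (x, y); rewrite inE.
  - by move=> z /MP[x [y [xy zP]]]; apply: (ps_out EP xy zP).
  - by move=> x /(fintype.subsetP RS); rewrite inE => /andP[].
  - by move=> x /(fintype.subsetP RS'); apply: FP.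
have S_gt0 : 0 < #|S| by rewrite card_gt0.
have RleS : #|R| <= #|S| := subset_leq_card RS'.
have cSR : #|S| <= 2 * (2 * l).+1 * #|R|.
  by apply: leq_trans cS _; rewrite -mulnA leq_mul2l.
have : #|R| * (m - 2 * l) <= (l * (1 + 2 * r * l)) * (2 * (2 * l).+1 * #|R|).
  apply: leq_trans fb _; apply: (@leq_trans (l * (1 + 2 * r * l) * #|S|)).
    rewrite -mulnA leq_mul2l mulnDl mul1n; apply/orP; right.
    by apply: leq_add => //; rewrite -mulnA.
  by rewrite leq_mul2l cSR orbT.
have -> : m - 2 * l = 2 * (2 * l).+1 * (l * (1 + 2 * r * l)) + 1.
  by rewrite /m /adm_bound -[_ + 1]addnA addKn.
have R_gt0 : 0 < #|R| by have := leq_trans S_gt0 cSR; rewrite muln_gt0 => /andP[].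
rewrite mulnC [X in _ <= X]mulnA [X in _ <= X * _]mulnC leq_pmul2r //.
by rewrite addn1 ltnn.
Qed.

Lemma wreach_bound : exists2 rho : G -> nat, injective rho &
  forall v, #|[set u | `[< wreach rho r v u >]]| <=
    \sum_(i < r.+1) (adm_bound r l * r) ^ i.
Proof.
have [S S0|rho rho_inj rhoP] := @elimination_order G
  (fun v S => forall F : 'I_(adm_bound r l) -> seq G, ~ fan r S v F).
  exact: admissible.
by exists rho => // v; apply: (card_wreach rho_inj rhoP).
Qed.
End Admissibility.

Lemma chi_p_le_density (G : sgraph) p l :
  (forall (A : {set G}) E P, path_system (2 * 2 ^ p) A E P ->
     #|[set q | E q.1 q.2]| <= l * #|A|) ->
  chi_p p G <= (\sum_(i < (2 ^ p).+1) (adm_bound (2 ^ p) l * 2 ^ p) ^ i).+1.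
Proof. by case/wreach_bound => rho rho_inj; apply: chi_p_le_wreach. Qed.

(** * Induced subdivisions *)

(* An induced copy of the r-subdivision of H: f gives the branch vertices and
   h x y 0, ..., h x y r.-1 the interior of the path from f x to f y. *)
Record subdivision_map r (H G : sgraph) (f : H -> G) (h : H -> H -> nat -> G) : Prop := {
  sm_inj : injective f;
  sm_branch : forall z x y i, adj x y -> i < r -> f z <> h x y i;
  sm_interior : forall x y x' y' i i', adj x y -> adj x' y' -> i < r -> i' < r ->
    h x y i = h x' y' i' -> [/\ x = x', y = y' & i = i'] \/ (x = y' /\ y = x');
  sm_indep : forall x y, ~~ adj (f x) (f y);
  sm_end : forall z x y i, adj x y -> i < r ->
    adj (f z) (h x y i) = (z == x) && (i == 0) || (z == y) && (i.+1 == r);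
  sm_adj : forall x y x' y' i i', adj x y -> adj x' y' -> i < r -> i' < r ->
    adj (h x y i) (h x' y' i') ->
    [/\ x = x', y = y' & (i.+1 == i') || (i'.+1 == i)] \/ (x = y' /\ y = x');
  sm_step : forall x y i, adj x y -> i.+1 < r -> adj (h x y i) (h x y i.+1) }.

Lemma arc_asym (H : sgraph) (p q : Defs.arc H) :
  (val p).1 = (val q).2 -> (val p).2 = (val q).1 -> False.
Proof.
case: p q => [[a b] /= ab] [[c d] /= cd] ad bc; subst.
case/andP: ab => _; case/andP: cd => _ lt gt.
by have := ltn_trans lt gt; rewrite ltnn.
Qed.

(** Each edge is read only in the orientation of its arc, and no two arcs reverse each other; this
    is why [sm_interior] and [sm_adj] leave reversed pairs free. *)
Lemma ITMe_subdivision_map r (H G : sgraph) f h : 0 < r ->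
  @subdivision_map r H G f h -> ITMe r G H.
Proof.
move=> r_gt0 [f_inj fh hh ff fhadj hhadj hstep].
pose g (u : exact_subdivision r H) : G := match u with
  | inl x => f x
  | inr w => h (val (tag w)).1 (val (tag w)).2 (tagged w)
  end.
have arcP (p : Defs.arc H) : adj (val p).1 (val p).2 by case/andP: (valP p).
have arc_eq (p q : Defs.arc H) : (val p).1 = (val q).1 -> (val p).2 = (val q).2 -> p = q.
  case: p q => [[a b] ab] [[c d] cd] /= e e'; apply: val_inj => /=; by rewrite e e'.
have ltr (w : {p : Defs.arc H & 'I_r}) : tagged w < r by case: w => p [].
have g_inj : injective g.
  case=> [x|[p [i ir]]] [y|[q [j jr]]] //=.
  - by move/f_inj=> ->.
  - by move/fh => /(_ (arcP q) jr).
  - by move/esym/fh => /(_ (arcP p) ir).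
  - case/(hh _ _ _ _ _ _ (arcP p) (arcP q) ir jr) => [[e1 e2 e3]|[e1 e2]]; last first.
      by case: (arc_asym e1 e2).
    have pq := arc_eq _ _ e1 e2; subst.
    by rewrite (bool_irrelevance ir jr).
apply/existsP; exists [ffun u => g u]; apply/andP; split.
  by apply/injectiveP => u v; rewrite !ffunE => /g_inj.
apply/forallP => u; apply/forallP => v; rewrite !ffunE; apply/eqP.
case: u v => [x|[p [i ir]]] [y|[q [j jr]]] /=.
- rewrite (negbTE (ff x y)); apply/existsP => -[p]; by rewrite eqn0Ngt r_gt0.
- by rewrite /subdiv_end /= (fhadj _ _ _ _ (arcP q) jr).
- by rewrite /subdiv_end /= adj_sym (fhadj _ _ _ _ (arcP p) ir).
rewrite /subdiv_adj /=; apply/idP/idP.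
  case/andP => /eqP e; move: jr; rewrite -{}e => jr /orP[] /eqP e; subst.
    exact: hstep (arcP _) jr.
  by rewrite adj_sym; apply: hstep (arcP _) ir.
case/(hhadj _ _ _ _ _ _ (arcP p) (arcP q) ir jr) => [[e1 e2 ij]|[e1 e2]]; last first.
  by case: (arc_asym e1 e2).
by rewrite (arc_eq _ _ e1 e2) eqxx.
Qed.

Lemma subdivision_map_ITMe r (H G : sgraph) : ITMe r G H -> 0 < r ->
  exists f h, @subdivision_map r H G f h /\
    forall x y i, adj x y -> i < r -> h y x i = h x y (r - i.+1).
Proof.
case/existsP => g /andP[/injectiveP g_inj /forallP gP] r_gt0.
have g_adj u v : adj u v = adj (g u) (g v) by apply/eqP; move/forallP: (gP u); apply.
pose S := exact_subdivision r H.
pose inner (p : Defs.arc H) (i : 'I_r) : S := inr (existT (fun=> 'I_r) p i).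
have inner_inj p i q j : inner p i = inner q j -> p = q /\ i = j :> nat.
  move=> e; have [] := congr1 (fun u : S =>
    if u is inr w then Some (tag w, nat_of_ord (tagged w)) else None) e.
  by move=> -> ->.
pose v0 (x : H) := g (inl x : S).
pose A (p : H * H) := adj p.1 p.2 && (enum_rank p.1 < enum_rank p.2).
pose o x y : option (Defs.arc H) := insub (x, y).
pose h (x y : H) (i : nat) : G := if insub i is Some j then
    if o x y is Some p then g (inner p j) else
    if o y x is Some p then g (inner p (rev_ord j)) else v0 x
  else v0 x.
have hP x y : adj x y -> exists (p : Defs.arc H) (s : bool), (val p = if s then (x, y) else (y, x)) /\
    forall i (ir : i < r), h x y i = g (inner p (if s then Ordinal ir else rev_ord (Ordinal ir))).
  move=> xy; case: (ltngtP (enum_rank x) (enum_rank y)) => lt.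
  - have pP : A (x, y) by rewrite /A /= xy.
    exists (Sub (x, y) pP), true; split=> // i ir.
    by rewrite /h insubT /o (@insubT _ A _ _ pP).
  - have pP : A (y, x).
      by rewrite /A /= adj_sym xy.
    exists (Sub (y, x) pP), false; split=> // i ir.
    have nP : A (x, y) = false by rewrite /A /= xy /= ltnNge (ltnW lt).
    by rewrite /h insubT /o (@insubF _ A _ _ nP) (@insubT _ A _ _ pP).
  - by move: xy; rewrite (enum_rank_inj (val_inj lt)) adj_irrefl.
exists v0, h; split; last first.
  move=> x y i xy ir; have yx : adj y x by rewrite adj_sym.
  have [p [s [pE hi]]] := hP _ _ xy; have [p' [s' [pE' hi']]] := hP _ _ yx.
  have ir' : r - i.+1 < r by lia.
  rewrite (hi' _ ir) (hi _ ir'); congr (g _).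
  case: s s' pE pE' {hi hi'} => [] [] pE pE'.
  - by case: (@arc_asym _ p p'); rewrite pE pE'.
  - have -> : p' = p by apply: val_inj; rewrite pE pE'.
    by congr (inner p _); apply: val_inj.
  - have -> : p' = p by apply: val_inj; rewrite pE pE'.
    by congr (inner p _); apply: val_inj => /=; lia.
  - by case: (@arc_asym _ p p'); rewrite pE pE'.
split.
- by move=> x y /g_inj [].
- by move=> z x y i /hP[p [s [_ hi]]] ir; rewrite (hi _ ir) => /g_inj.
- move=> x y x' y' i i' /hP[p [s [pE hi]]] /hP[p' [s' [pE' hi']]] ir ir'.
  rewrite (hi _ ir) (hi' _ ir') => /g_inj/inner_inj[e]; subst p'.
  move: pE; rewrite pE'; case: s {hi}; case: s' {hi' pE'} => /= -[-> ->] ii';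
    by [left; split=> //; lia | right].
- move=> x y; rewrite -g_adj /=; apply/existsP => -[p]; by rewrite eqn0Ngt r_gt0.
- move=> z x y i /hP[p [s [pE hi]]] ir; rewrite (hi _ ir) -g_adj /= /subdiv_end /=.
  rewrite pE; case: s {hi pE} => //=.
  rewrite orbC; congr (_ && _ || _ && _); apply/eqP/eqP; lia.
- move=> x y x' y' i i' /hP[p [s [pE hi]]] /hP[p' [s' [pE' hi']]] ir ir'.
  rewrite (hi _ ir) (hi' _ ir') -g_adj /= => /andP[/eqP e]; subst p'.
  move: pE; rewrite pE'; case: s {hi}; case: s' {hi' pE'} => /= -[-> ->] ii';
    try by right.
  - by left.
  - by left; split=> //; move: ii' => /orP[] /eqP; lia.
- move=> x y i /hP[p [s [pE hi]]] ir; rewrite (hi _ ir) (hi _ (ltnW ir)) -g_adj /= eqxx /=.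
  case: s {hi pE} => /=; first by rewrite eqxx.
  by apply/orP; right; apply/eqP; lia.
Qed.

(** * Density of shallow topological minors *)

Definition degree_sum (G : sgraph) := \sum_(x : G) #|[set y | adj x y]|.

Lemma card_induced (G : sgraph) (A : {set G}) : #|induced A| = #|A|.
Proof. by rewrite /= card_sig; apply: eq_card => x; rewrite !inE. Qed.

Lemma degree_induced (G : sgraph) (A : {set G}) (x : induced A) :
  #|[set y | adj x y]| = #|[set y in A | adj (val x) y]|.
Proof.
rewrite -(card_imset _ val_inj); apply: eq_card => y; apply/imsetP/idP.
  by case=> z; rewrite !inE => xz ->; rewrite (valP z).
by rewrite inE => /andP[yA xy]; exists (Sub y yA); rewrite ?inE.
Qed.

Lemma degree_sum_induced (G : sgraph) (A : {set G}) :
  degree_sum (induced A) = \sum_(x in A) #|[set y in A | adj x y]|.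
Proof.
rewrite (big_sub A (fun x => #|[set y in A | adj x y]|)) /degree_sum.
by apply: eq_bigr => x _; apply: degree_induced.
Qed.

Lemma degree_sum_induced_support (G : sgraph) (A : {set G}) :
  (forall x y, adj x y -> x \in A) ->
  degree_sum (induced A) = #|[set p : G * G | adj p.1 p.2]|.
Proof.
move=> AP; rewrite degree_sum_induced card_set_pairs [RHS](bigID (mem A)) /=.
rewrite [X in _ = _ + X]big1 ?addn0 => [|x xA]; last first.
  apply: eq_card0 => y; rewrite inE; apply: contraNF xA; exact: AP.
apply: eq_bigr => x xA; apply: eq_card => y; rewrite !inE.
by case xy: (adj x y); rewrite ?andbF // andbT (AP y x) // adj_sym.
Qed.

Section PathDensity.
Variable G : sgraph.

(** Minimality is relative to the vertices of q: it excludes chords, and replacing a path by such a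
    q stays inside the old interior, so a path system remains disjoint. *)
Definition shortest_in a (q : seq G) b :=
  forall q', path (@adj G) a (rcons q' b) -> {subset q' <= q} -> size q <= size q'.

Lemma shortest_inP a q b : path (@adj G) a (rcons q b) -> uniq (a :: rcons q b) ->
  shortest_in a q b -> forall i j, i < j <= (size q).+1 ->
  adj (nth a (a :: rcons q b) i) (nth a (a :: rcons q b) j) = (i.+1 == j).
Proof.
move=> qP uq short i j /andP[ij js].
case: eqVneq => [<-|ne]; first by have /(pathP a)/(_ i) := qP; rewrite size_rcons => -> //; lia.
apply/negP => chord; case: j ij js ne chord => // j ij js ne chord.
have ltij : i < j by lia.
set w := rcons q b in qP uq chord *.
have sw : size w = (size q).+1 by rewrite size_rcons.
pose w' := take i w ++ drop j w.
have lastw' : last a w' = b.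
  rewrite /w' last_cat -[RHS](last_rcons a q b) -/w -{3}(cat_take_drop j w) last_cat.
  case E: (drop j w) => [|x s] //=; have := congr1 size E; rewrite size_drop sw /=; lia.
have lastt : last a (take i w) = nth a (a :: w) i.
  case: i ij ltij ne chord {w' lastw'} => [|i] ij ltij ne chord; first by rewrite take0.
  rewrite (last_nth a) size_take sw ifT; last by lia.
  by rewrite /= nth_take.
have pw' : path (@adj G) a w'.
  rewrite /w' cat_path lastt.
  have := qP; rewrite -{1}(cat_take_drop i w) cat_path => /andP[-> _] /=.
  have := qP; rewrite -{1}(cat_take_drop j w) cat_path => /andP[_].
  have -> : drop j w = nth a w j :: drop j.+1 w by rewrite (drop_nth a) // sw.
  by rewrite /= => /andP[_ ->]; rewrite andbT; move: chord; rewrite /=.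
have subw' : subseq w' w.
  rewrite /w' -{3}(cat_take_drop i w); apply: cat_subseq => //.
  have -> : drop j w = drop (j - i) (drop i w) by rewrite drop_drop subnK // ltnW.
  exact: drop_subseq.
have sw' : size w' = i + ((size q).+1 - j).
  by rewrite /w' size_cat size_drop sw size_take sw ifT //; lia.
have uw : uniq w by case/andP: uq.
have uw' := subseq_uniq subw' uw.
case/lastP: w' lastw' pw' subw' sw' uw' => [|q' b']; first by move=> _ _ _ /= sz _; move: js sz; clear; lia.
rewrite last_rcons => ->; rewrite size_rcons rcons_uniq => pw' sub sq' /andP[bq' _].
have := short q' pw'; suff sub' : {subset q' <= q} by move/(_ sub'); lia.
move=> z zq; have := mem_subseq sub; move/(_ z); rewrite !mem_rcons !inE zq orbT.
by move/(_ isT)/predU1P => -[zb|//]; rewrite -zb zq in bq'.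
Qed.

Lemma shortest_in_exists a q b : a != b -> path (@adj G) a (rcons q b) ->
  exists q', [/\ path (@adj G) a (rcons q' b), uniq (a :: rcons q' b),
    {subset q' <= q} & size q' <= size q /\ shortest_in a q' b].
Proof.
move=> ab qP.
pose ok n := `[< exists q', [/\ path (@adj G) a (rcons q' b), {subset q' <= q} & size q' = n] >].
have okq : exists n, ok n by exists (size q); apply/asboolP; exists q; split.
case: (ex_minnP okq) => n /asboolP[q0 [q0P sub0 sq0]] min.
have [q1 [q1P uq1 sub1 sq1]] := shorten_interior ab q0P.
have short q' : path (@adj G) a (rcons q' b) -> {subset q' <= q} -> size q1 <= size q'.
  move=> q'P sub'; apply: leq_trans sq1 _; rewrite sq0; apply: min.
  by apply/asboolP; exists q'.
exists q1; split=> // [z|]; first by move/sub1/sub0.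
split; first exact: short.
by move=> q' q'P sub'; apply: short => // z /sub'/sub1/sub0.
Qed.

Lemma shortest_path_system r (A : {set G}) E P : path_system r A E P ->
  exists P', path_system r A E P' /\ forall a b, E a b -> shortest_in a (P' a b) b.
Proof.
move=> EP.
have /choice[Q QP] (p : G * G) : exists q', E p.1 p.2 ->
    [/\ path (@adj G) p.1 (rcons q' p.2), uniq (p.1 :: rcons q' p.2),
    {subset q' <= P p.1 p.2} & size q' <= size (P p.1 p.2) /\ shortest_in p.1 q' p.2].
  case: (boolP (E p.1 p.2)) => [pE|_]; last by exists [::].
  have [|q' q'P] := @shortest_in_exists p.1 (P p.1 p.2) p.2 _ (ps_path EP pE).
    by apply: contraTneq pE => ->; rewrite (ps_irr EP).
  by exists q'.
(* Only one orientation of each pair selects a shortest path; the other must receive its reverse. *)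
pose D a b := E a b && (enum_rank a < enum_rank b).
have DE : (fun a b => D a b || D b a) = E.
  apply/funext => a; apply/funext => b; rewrite /D (ps_sym EP b a).
  case ab: (E a b) => //=; case: ltngtP => // /val_inj/enum_rank_inj eab.
  by rewrite eab (ps_irr EP) in ab.
have := @path_system_of_directed G r A D (fun a b => Q (a, b)).
rewrite DE => h; exists (fun a b => if D a b then Q (a, b) else rev (Q (b, a))); split.
  apply: h.
  - move=> a b /andP[ab lt]; rewrite (ps_mem EP ab) (ps_mem EP (b := a)) ?(ps_sym EP b) //.
    by split=> //; rewrite /D ltnNge (ltnW lt) andbF.
  - move=> a b /andP[ab lt]; have [p u s [sz _]] := QP (a, b) ab; split=> //.
      by move: u; rewrite /= rcons_uniq => /and3P[].
    exact: leq_trans sz (ps_size EP ab).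
  - move=> a b z /andP[ab lt]; have [_ _ s _] := QP (a, b) ab.
    by move/s; apply: (ps_out EP ab).
  - move=> a b a' b' z /andP[ab lt] /andP[ab' lt'] zq zq'.
    have [_ _ /(_ _ zq) zP _] := QP (a, b) ab; have [_ _ /(_ _ zq') zP' _] := QP (a', b') ab'.
    case: (ps_disj EP ab ab' zP zP') => // -[e1 e2].
    by rewrite e1 e2 in lt; have := ltn_trans lt lt'; rewrite ltnn.
move=> a b; rewrite -{1}DE => ab; case: ifP => Dab.
  by have [_ _ _ []] := QP (a, b) (proj1 (andP Dab)).
have /andP[ba _] : D b a by move: ab; rewrite Dab.
have [_ _ _ [_ s]] := QP (b, a) ba.
move=> q' q'P sub'; rewrite size_rev -(size_rev q'); apply: s.
  exact: path_rev_rcons (@adj_sym G) q'P.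
by move=> z; rewrite mem_rev => /sub'; rewrite mem_rev.
Qed.
End PathDensity.

Section ShortestInterior.
Variables (G : sgraph) (a b : G) (p : seq G) (t : nat).
Hypotheses (pP : path (@adj G) a (rcons p b)) (up : uniq (a :: rcons p b)).
Hypotheses (short : shortest_in a p b) (sp : size p = t).

Let interior_nth i : i < t -> nth a (a :: rcons p b) i.+1 = nth a p i.
Proof. by move=> it; rewrite /= nth_rcons sp it. Qed.

Let last_nth' : nth a (a :: rcons p b) t.+1 = b.
Proof. by rewrite /= nth_rcons sp ltnn eqxx. Qed.

Lemma shortest_interior_adj i j : i < t -> j < t ->
  adj (nth a p i) (nth a p j) = (i.+1 == j) || (j.+1 == i).
Proof.
move=> it jt; rewrite -!interior_nth //; case: (ltngtP i j) => [ij|ji|->].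
- rewrite (shortest_inP pP up short); last by rewrite ltnS ij sp ltnS ltnW.
  by rewrite eqSS [j.+1 == i](_ : _ = false) ?orbF //; lia.
- rewrite adj_sym (shortest_inP pP up short); last by rewrite ltnS ji sp ltnS ltnW.
  by rewrite eqSS [i.+1 == j](_ : _ = false) //; lia.
- by rewrite adj_irrefl; lia.
Qed.

Lemma shortest_interior_first i : i < t -> adj a (nth a p i) = (i == 0).
Proof.
move=> it; have h : 0 < i.+1 <= (size p).+1 by rewrite sp; lia.
by have /= := shortest_inP pP up short h; rewrite -[nth a (rcons p b) i]/(nth a (a :: rcons p b) i.+1) interior_nth // => ->; rewrite eqSS eq_sym.
Qed.

Lemma shortest_interior_last i : i < t -> adj b (nth a p i) = (i.+1 == t).
Proof.
move=> it; have h : i.+1 < t.+1 <= (size p).+1 by rewrite sp; lia.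
have := shortest_inP pP up short h.
by rewrite interior_nth // last_nth' adj_sym eqSS.
Qed.

Lemma shortest_ends : 0 < t -> ~~ adj a b.
Proof.
move=> t0; have h : 0 < t.+1 <= (size p).+1 by rewrite sp; lia.
by have := shortest_inP pP up short h; rewrite last_nth' => ->; lia.
Qed.
End ShortestInterior.

Section InducedSampling.
Variables (G : sgraph) (rho : G -> nat) (D t : nat).
Variables (A : {set G}) (E : rel G) (P : G -> G -> seq G).
Hypothesis rhoD : forall v, #|[set u | adj v u & rho u <= rho v]| <= D.
Hypothesis t_gt0 : 0 < t.
Hypothesis EP : path_system t A E P.
Hypothesis sizeP : forall a b, E a b -> size (P a b) = t.
Hypothesis shortP : forall a b, E a b -> shortest_in a (P a b) b.

Let out v := [set u | adj v u & rho u <= rho v].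
Let Q a b := [set z in a :: rcons (P a b) b].
Let O a b := (\bigcup_(v in Q a b) out v) :\: Q a b.

Let memQ a b z : z \in Q a b = [|| z == a, z == b | z \in P a b].
Proof. by rewrite !inE mem_rcons inE. Qed.

Let Q_sym a b : E a b -> Q b a = Q a b.
Proof.
by move=> ab; apply/setP => z; rewrite !memQ (ps_rev EP ab) mem_rev orbCA.
Qed.

Let edge_neq a b : E a b -> a != b.
Proof. by apply: contraTneq => ->; rewrite (ps_irr EP). Qed.

Let E_memr a b : E a b -> b \in A.
Proof. by rewrite (ps_sym EP) => /(ps_mem EP). Qed.

Let uniqQ a b : E a b -> uniq (a :: rcons (P a b) b).
Proof.
move=> ab; rewrite /= mem_rcons inE negb_or edge_neq // rcons_uniq (ps_uniq EP ab) andbT.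
apply/andP; split; apply/negP => /(ps_out EP ab).
  by rewrite (ps_mem EP ab).
by rewrite (E_memr ab).
Qed.

Let Q_A a b z : E a b -> z \in Q a b -> z \in A -> z = a \/ z = b.
Proof.
move=> ab; rewrite memQ => /or3P[/eqP->|/eqP->|]; [by left | by right |].
by move/(ps_out EP ab)/negP.
Qed.

Let Q_interior a b z : E a b -> z \in Q a b -> z \notin A -> z \in P a b.
Proof.
move=> ab; rewrite memQ => /or3P[/eqP->|/eqP->|//].
  by rewrite (ps_mem EP ab).
by rewrite (E_memr ab).
Qed.

Let P_Q a b z : z \in P a b -> z \in Q a b.
Proof. by rewrite memQ => ->; rewrite !orbT. Qed.

Section Kept.
Variable X : {set G}.
Let K a b := [&& E a b, Q a b \subset X & [disjoint O a b & X]].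

Let K_sym : symmetric K.
Proof.
move=> a b; rewrite /K (ps_sym EP b a); case ab: (E a b) => //=.
by rewrite /O (Q_sym ab).
Qed.

Let K_irr : irreflexive K.
Proof. by move=> a; rewrite /K (ps_irr EP). Qed.

(* An edge of G is oriented towards its smaller end, which lies in the kept set X
   only if it is on the same path. *)
Let kept_edge a b a' b' u v : K a b -> K a' b' -> u \in Q a b -> v \in Q a' b' ->
  adj u v -> v \in Q a b \/ u \in Q a' b'.
Proof.
wlog le : a b a' b' u v / rho v <= rho u => [wl|].
  case/orP: (leq_total (rho v) (rho u)) => le ab ab' uQ vQ uv; first exact: wl.
  by rewrite adj_sym in uv; have [] := wl _ _ _ _ _ _ le ab' ab vQ uQ uv; [right | left].
case/and3P => ab QX OX /and3P[ab' QX' OX'] uQ vQ uv; left; apply: contraT => nvQ.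
have vO : v \in O a b.
  by apply/setDP; split=> //; apply/bigcupP; exists u => //; rewrite inE uv.
by move: (disjointFr OX vO); rewrite (fintype.subsetP QX').
Qed.

Definition kept_graph : sgraph := SGraph K_sym K_irr.
Definition kept_vertices : {set kept_graph} := [set a | [exists b, K a b]].

(** By [kept_edge] an edge of G between kept paths lies within the vertex set of one of them, and a
    shortest path has no chord. Since [t > 0], its ends are not adjacent either. *)
Lemma kept_ITMe : ITMe t G (induced kept_vertices).
Proof.
have KE a b : K a b -> E a b by case/and3P.
pose f (x : induced kept_vertices) : G := val x.
pose h x y i := nth (f x) (P (f x) (f y)) i.
apply: (@ITMe_subdivision_map t (induced kept_vertices) G f h) => //.
have f_inj : injective f by exact: val_inj.
have kept (x : induced kept_vertices) : exists b, K (f x) b.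
  by have := valP x; rewrite inE => /existsP.
have keptA x : f x \in A by have [b /KE/(ps_mem EP)] := kept x.
have adjK x y : adj x y -> K (f x) (f y) by [].
have adjE x y : adj x y -> E (f x) (f y) by move/adjK/KE.
have hP x y i : adj x y -> i < t -> h x y i \in P (f x) (f y).
  by move=> /adjE xy it; rewrite mem_nth // sizeP.
have hA x y i : adj x y -> i < t -> h x y i \notin A.
  by move=> xy it; apply: (ps_out EP (adjE _ _ xy) (hP _ _ _ xy it)).
have h_adj x y i j : adj x y -> i < t -> j < t ->
    adj (h x y i) (h x y j) = (i.+1 == j) || (j.+1 == i).
  move=> /adjE xy.
  exact: shortest_interior_adj (ps_path EP xy) (uniqQ xy) (shortP xy) (sizeP xy) _ _.
have h_first x y i : adj x y -> i < t -> adj (f x) (h x y i) = (i == 0).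
  move=> /adjE xy.
  exact: shortest_interior_first (ps_path EP xy) (uniqQ xy) (shortP xy) (sizeP xy) _.
have h_last x y i : adj x y -> i < t -> adj (f y) (h x y i) = (i.+1 == t).
  move=> /adjE xy.
  exact: shortest_interior_last (ps_path EP xy) (uniqQ xy) (shortP xy) (sizeP xy) _.
have ends a b : E a b -> ~~ adj a b.
  by move=> ab; apply: shortest_ends (ps_path EP ab) (uniqQ ab) (shortP ab) (sizeP ab) t_gt0.
have Qa a b : a \in Q a b by rewrite memQ eqxx.
split.
- exact: f_inj.
- by move=> z x y i xy it zE; move: (hA _ _ _ xy it); rewrite -zE keptA.
- move=> x y x' y' i i' xy xy' it it' e.
  have m := hP _ _ _ xy it; have m' := hP _ _ _ xy' it'; rewrite -e in m'.
  case: (ps_disj EP (adjE _ _ xy) (adjE _ _ xy') m m') => -[/f_inj e1 /f_inj e2]; last by right.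
  left; split=> //; subst; apply/eqP; have xyE := adjE _ _ xy.
  by rewrite -(nth_uniq (f x') _ _ (ps_uniq EP xyE)) ?sizeP //; apply/eqP.
- move=> x y; apply/negP => xy.
  have [b xb] := kept x; have [b' yb'] := kept y.
  case: (kept_edge xb yb' (Qa _ _) (Qa _ _) xy) => [/(Q_A (KE _ _ xb) )|/(Q_A (KE _ _ yb'))].
  + case=> // [e|e]; first by rewrite e adj_irrefl in xy.
    by have := ends _ _ (KE _ _ xb); rewrite -e xy.
  + case=> // [e|e]; first by rewrite e adj_irrefl in xy.
    by have := ends _ _ (KE _ _ yb'); rewrite adj_sym -e xy.
- move=> z x y i xy it; have m := hP _ _ _ xy it.
  case: (eqVneq z x) => [->|zx] /=.
    rewrite h_first //; case: (eqVneq x y) => [exy|_]; last by rewrite orbF.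
    by move: xy; rewrite exy adj_irrefl.
  case: (eqVneq z y) => [->|zy] /=; first by rewrite h_last.
  apply/negP => zadj; have [b zb] := kept z.
  have := kept_edge zb (adjK _ _ xy) (Qa _ _) (P_Q m) zadj.
  case=> [mz|/(Q_A (adjE _ _ xy))]; last first.
    by case=> [//|/f_inj e|/f_inj e]; [rewrite e eqxx in zx | rewrite e eqxx in zy].
  have := ps_disj EP (KE _ _ zb) (adjE _ _ xy) (Q_interior (KE _ _ zb) mz (hA _ _ _ xy it)) m.
  by case=> -[/f_inj e _]; [rewrite e eqxx in zx | rewrite e eqxx in zy].
- move=> x y x' y' i i' xy xy' it it' uv; have xyE := adjE _ _ xy; have xyE' := adjE _ _ xy'.
  have m := hP _ _ _ xy it; have m' := hP _ _ _ xy' it'.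
  have nm := hA _ _ _ xy it; have nm' := hA _ _ _ xy' it'.
  have [e|e] : (f x = f x' /\ f y = f y') \/ (f x = f y' /\ f y = f x').
    case: (kept_edge (adjK _ _ xy) (adjK _ _ xy') (P_Q m) (P_Q m') uv) => mm.
      exact: (ps_disj EP xyE xyE' (Q_interior xyE mm nm') m').
    exact: (ps_disj EP xyE xyE' m (Q_interior xyE' mm nm)).
  + case: e => /f_inj e1 /f_inj e2; subst; left; split=> //.
    by move: uv; rewrite h_adj.
  + by right; case: e => /f_inj -> /f_inj ->.
- by move=> x y i xy it; rewrite h_adj ?eqxx // ltnW.
Qed.

Lemma kept_degree_sum : degree_sum (induced kept_vertices) = #|[set p | K p.1 p.2]|.
Proof.
rewrite degree_sum_induced_support // => x y xy.
by rewrite inE; apply/existsP; exists y.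
Qed.

Lemma card_kept_vertices : #|induced kept_vertices| <= #|A|.
Proof.
rewrite card_induced; apply: subset_leq_card; apply/fintype.subsetP => a.
by rewrite inE => /existsP[b /and3P[ab _ _]]; exact: (ps_mem EP ab).
Qed.
End Kept.

(** A path has [t + 2] vertices, which must be kept, and each has at most D earlier neighbours,
    which must be dropped unless on the path. A random set does so with probability at least 2^-((t
    + 2)(D + 1)). *)
Lemma exact_path_system_density l :
  (forall H, ITMe t G H -> degree_sum H <= l * #|H|) ->
  #|[set p | E p.1 p.2]| <= 2 ^ ((t + 2) * D.+1) * (l * #|A|).
Proof.
move=> hl.
have [p|X] := @half_sampling G _ [set p | E p.1 p.2] (fun p => Q p.1 p.2)
  (fun p => O p.1 p.2) ((t + 2) * D.+1).
  rewrite inE => pE; split.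
    by rewrite disjoint_sym disjoints_subset; apply/fintype.subsetP => z; rewrite !inE => /andP[].
  have cQ : #|Q p.1 p.2| <= t + 2.
    by apply: leq_trans (card_seq_set _) _; rewrite /= size_rcons sizeP // addn2.
  rewrite mulnS leq_add //; apply: leq_trans (subset_leq_card (subsetDl _ _)) _.
  apply: leq_trans (leq_card_bigcup _ _) _.
  apply: (@leq_trans (\sum_(v in Q p.1 p.2) D)); first by apply: leq_sum => v _; apply: rhoD.
  by rewrite sum_nat_const leq_mul2r cQ orbT.
move=> h; apply: leq_trans h _; rewrite leq_mul2l; apply/orP; right.
apply: leq_trans (_ : _ <= degree_sum (induced (kept_vertices X))) _.
  rewrite kept_degree_sum; apply: subset_leq_card; apply/fintype.subsetP => p.
  by rewrite !inE.
apply: leq_trans (hl _ (kept_ITMe X)) _.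
by rewrite leq_mul2l card_kept_vertices orbT.
Qed.
End InducedSampling.

Lemma card_fibers (T J : finType) (A : {set T}) (f : T -> J) :
  #|A| = \sum_j #|[set x in A | f x == j]|.
Proof.
rewrite -sum1_card (partition_big f xpredT) //=; apply: eq_bigr => j _.
by rewrite -sum1_card; apply: eq_bigl => x; rewrite inE.
Qed.

(** Paths are grouped by their number of interior vertices, since [ITMe] requires an exact number.
    The term [2 * D] counts the pairs joined by an edge of G, in both directions, by degeneracy. *)
Definition density_bound (L : nat -> nat) D r :=
  2 * D + \sum_(t < r) 2 ^ ((t.+1 + 2) * D.+1) * L t.+1.

Lemma path_system_density (G : sgraph) D (L : nat -> nat) r A E P :
  (forall S : {set G}, S != set0 -> exists2 v, v \in S & #|[set u in S | adj v u]| <= D) ->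
  (forall t H, 0 < t -> ITMe t G H -> degree_sum H <= L t * #|H|) ->
  @path_system G r A E P ->
  #|[set p | E p.1 p.2]| <= density_bound L D r * #|A|.
Proof.
move=> degen LP /shortest_path_system[{}P [EP short]].
have [rho _ rhoD'] := elimination_order degen.
have rhoD v : #|[set u | adj v u & rho u <= rho v]| <= D.
  by apply: leq_trans (rhoD' v); apply: subset_leq_card; apply/fintype.subsetP => u;
    rewrite !inE andbC.
pose Et t a b := E a b && (size (P a b) == t).
have EtP t : path_system t A (Et t) P.
  split.
  - move=> a b; rewrite /Et (ps_sym EP b a); case ab: (E a b) => //=.
    by rewrite (ps_rev EP ab) size_rev.
  - by move=> a; rewrite /Et (ps_irr EP).
  - by move=> a b /andP[/(ps_mem EP)].
  - by move=> a b /andP[/(ps_rev EP)].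
  - by move=> a b /andP[/(ps_path EP)].
  - by move=> a b /andP[/(ps_uniq EP)].
  - by move=> a b /andP[_ /eqP ->].
  - by move=> a b z /andP[ab _]; apply: (ps_out EP ab).
  - by move=> a b a' b' z /andP[ab _] /andP[ab' _]; apply: (ps_disj EP).
have sz (p : G * G) : p \in [set p | E p.1 p.2] -> size (P p.1 p.2) < r.+1.
  by rewrite inE => pE; rewrite ltnS (ps_size EP pE).
rewrite (card_fibers _ (fun p => inord (size (P p.1 p.2)) : 'I_r.+1)).
have -> : \sum_(j < r.+1) #|[set x in [set p | E p.1 p.2] | inord (size (P x.1 x.2)) == j]|
    = \sum_(j < r.+1) #|[set p | Et j p.1 p.2]|.
  apply: eq_bigr => j _; apply: eq_card => p; rewrite !inE /Et.
  case pE: (E p.1 p.2) => //=; rewrite -(inj_eq val_inj) /= inordK //.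
  by apply: sz; rewrite inE.
rewrite big_ord_recl /density_bound mulnDl; apply: leq_add; last first.
  rewrite big_distrl /=; apply: leq_sum => t _; rewrite -mulnA.
  apply: (exact_path_system_density rhoD _ (EtP _)) => //.
  - by move=> a b /andP[_ /eqP].
  - by move=> a b /andP[/short].
  - by move=> H; apply: LP.
have adj0 a b : Et 0 a b -> adj a b.
  by case/andP => ab /nilP e; have := ps_path EP ab; rewrite e /= andbT.
pose F := [set p : G * G | (p.1 \in A) && (adj p.1 p.2 && (rho p.2 <= rho p.1))].
have cF : #|F| <= D * #|A|.
  rewrite (card_set_pairs (fun a b => (a \in A) && (adj a b && (rho b <= rho a)))).
  rewrite (bigID (mem A)) /= [X in _ + X]big1 ?addn0 => [|a aA]; last first.
    by apply: eq_card0 => b; rewrite inE (negbTE aA).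
  rewrite mulnC -sum_nat_const; apply: leq_sum => a aA.
  by apply: leq_trans (rhoD a); apply: subset_leq_card; apply/fintype.subsetP => b;
    rewrite !inE aA.
have sub : [set p | Et 0 p.1 p.2] \subset F :|: (fun p => (p.2, p.1)) @: F.
  apply/fintype.subsetP => -[a b]; rewrite !inE /= => ab.
  have abA := ps_mem (EtP 0) ab.
  have ba : Et 0 b a by rewrite (ps_sym (EtP 0)).
  case/orP: (leq_total (rho b) (rho a)) => le; first by rewrite abA (adj0 _ _ ab) le.
  apply/orP; right; apply/imsetP; exists (b, a) => //.
  by rewrite inE /= (ps_mem (EtP 0) ba) (adj0 _ _ ba) le.
apply: leq_trans (subset_leq_card sub) _; rewrite cardsU mulSn mul1n mulnDl.
apply: leq_trans (leq_subr _ _) _; apply: leq_add => //.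
exact: leq_trans (leq_imset_card _ _) cF.
Qed.

Lemma chi_p_le_ITMe (G : sgraph) D (L : nat -> nat) p :
  (forall S : {set G}, S != set0 -> exists2 v, v \in S & #|[set u in S | adj v u]| <= D) ->
  (forall t H, 0 < t -> ITMe t G H -> degree_sum H <= L t * #|H|) ->
  let l := density_bound L D (2 * 2 ^ p) in
  chi_p p G <= (\sum_(i < (2 ^ p).+1) (adm_bound (2 ^ p) l * 2 ^ p) ^ i).+1.
Proof.
move=> degen LP /=; apply: chi_p_le_density => A E P; exact: path_system_density.
Qed.

(** * Degeneracy of graphs without large bicliques *)

(** Mean value bound for the power [k.+1] on the interval from m to [m.+1]. *)
Lemma expn_succ_le m k : m.+1 ^ k.+1 <= m ^ k.+1 + k.+1 * m.+1 ^ k.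
Proof.
elim: k => [|k IH]; first by rewrite !expn1 expn0; lia.
move: IH; rewrite (expnS m.+1 k.+1) (expnS m k.+1) (expnS m.+1 k).
by move: (m.+1 ^ k) (m ^ k.+1) => a b; nia.
Qed.

(* (1 - 1/m)^k >= 1/16 for m = 2h and k <= 2m. *)
Lemma expn_pred_ge h k : 0 < h -> k <= 4 * h -> (2 * h) ^ k <= 16 * (2 * h).-1 ^ k.
Proof.
move=> h_gt0 k4; have [m mE] : exists m, 2 * h = m.+1 by exists (2 * h).-1; lia.
have m_gt0 : 0 < m by lia.
rewrite mE /=.
(* As [m.+1 = 2 * h], the error term [h * m.+1 ^ h.-1] of the mean value bound is half of
   [m.+1 ^ h]. *)
have half : m.+1 ^ h <= 2 * m ^ h.
  case: h h_gt0 mE {k4} => // h _ mE; have := expn_succ_le m h.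
  have : 2 * (h.+1 * m.+1 ^ h) = m.+1 ^ h.+1 by rewrite mulnA mE -expnS.
  by move: (m.+1 ^ h.+1) (m ^ h.+1) (h.+1 * _) => a b c; lia.
have full : m.+1 ^ (4 * h) <= 16 * m ^ (4 * h).
  rewrite ![4 * h]mulnC !expnM.
  have -> : 16 * (m ^ h) ^ 4 = (2 * m ^ h) ^ 4 by rewrite expnMn.
  by rewrite leq_exp2r.
have pos : 0 < m ^ (4 * h - k) by rewrite expn_gt0 m_gt0.
rewrite -(leq_pmul2r pos) -mulnA -expnD subnKC //; apply: leq_trans full.
rewrite -[X in _ <= _ ^ X](subnKC k4) expnD leq_mul2l.
by apply/orP; right; case: (4 * h - k) => [|e]; rewrite ?expn0 ?leq_exp2r ?leqnSn.
Qed.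

(** Each of the s factors of the falling factorial is at least m / 2. *)
Lemma ffact_ge n s m : m <= n -> 2 * s <= m -> m ^ s <= 2 ^ s * n ^_ s.
Proof.
move=> mn; elim: s => [|s IH] sm; first by rewrite !expn0 ffactn0.
rewrite !expnSr ffactnSr -mulnA [2 * _]mulnCA mulnA.
apply: leq_mul; [apply: IH | idtac]; lia.
Qed.

Section ExactHits.
Variables (T : finType) (m : nat) (z0 : 'I_m) (N : {set T}).

(** The fibre over [z0] of a uniformly chosen function to ['I_m] plays the role of a random set that
    contains each element with probability 1/m. *)
Lemma card_exact_fiber (S : {set T}) : S \subset N ->
  #|[set phi : {ffun T -> 'I_m} | [set x in N | phi x == z0] == S]| =
  m.-1 ^ (#|N| - #|S|) * m ^ (#|T| - #|N|).
Proof.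
move=> SN.
pose F x : pred 'I_m := if x \in S then pred1 z0 else if x \in N then predC1 z0 else predT.
transitivity #|(family F : simpl_pred {ffun T -> 'I_m})|.
  apply: eq_card => phi; rewrite inE; apply/eqP/familyP => [E x|h].
    rewrite /F -E inE; case: (boolP (x \in N)) => xN //=.
      by case: ifP => h; rewrite !inE h.
  apply/setP => x; have := h x; rewrite inE /F.
  case: (boolP (x \in S)) => xS; first by rewrite (fintype.subsetP SN) // inE => ->.
  by case: (x \in N) => //=; rewrite !inE => /negbTE.
rewrite card_family foldrE big_image /= (bigID (mem N)) /=; congr (_ * _).
  rewrite (bigID (mem S)) /= big1 => [|x /andP[_ xS]]; last by rewrite /F xS card1.
  rewrite mul1n (eq_bigr (fun=> m.-1)) => [|x /andP[xN xS]]; last first.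
    by rewrite /F (negbTE xS) xN cardC1 card_ord.
  rewrite prod_nat_const; congr (_ ^ _); rewrite -[in RHS](setIidPr SN) -cardsD.
  by apply: eq_card => x; rewrite !inE andbC.
rewrite (eq_bigr (fun=> m)) => [|x xN]; last first.
  rewrite /F (negbTE xN) ifF ?card_ord //; apply: contraNF xN.
  by move/fintype.subsetP: SN; apply.
rewrite prod_nat_const; congr (_ ^ _); rewrite -[in RHS](cardC N) addKn.
by apply: eq_card => x; rewrite !inE.
Qed.

Lemma card_exact_hits s : #|[set phi : {ffun T -> 'I_m} | #|[set x in N | phi x == z0]| == s]| =
  'C(#|N|, s) * (m.-1 ^ (#|N| - s) * m ^ (#|T| - #|N|)).
Proof.
rewrite (card_fibers _ (fun phi : {ffun T -> 'I_m} => [set x in N | phi x == z0])).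
rewrite (bigID (mem [set B : {set T} | (B \subset N) && (#|B| == s)])) /=.
rewrite [X in _ + X]big1 ?addn0 => [|S]; last first.
  rewrite inE => nS; apply: eq_card0 => phi; rewrite !inE.
  apply/negP => /andP[h /eqP E]; case/negP: nS; rewrite -E h andbT.
  by apply/fintype.subsetP => x; rewrite inE => /andP[].
rewrite -cards_draws -sum_nat_const; apply: eq_bigr => S; rewrite inE => /andP[SN /eqP cS].
rewrite -cS -card_exact_fiber //; apply: eq_card => phi; rewrite !inE.
by apply: andb_idl => /eqP ->; rewrite cS.
Qed.

(** With n the size of N, the binomial probability C(n, s) m^-s (1 - 1/m)^(n - s) is bounded below
    by two estimates: C(n, s) is at least m^s / (2^s s!), and the last factor is at least 1/16
    because n is at most 2m. *)
Lemma card_exact_hits_ge h s : m = 2 * h -> m <= #|N| <= 2 * m -> 2 * s <= m ->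
  m ^ #|T| <= 16 * 2 ^ s * s`! * #|[set phi : {ffun T -> 'I_m} | #|[set x in N | phi x == z0]| == s]|.
Proof.
move=> mh /andP[mN Nm] sm; rewrite card_exact_hits.
have NT := max_card N; have sN : s <= #|N| by lia.
have m_gt0 : 0 < m := leq_ltn_trans (leq0n _) (ltn_ord z0).
have C_ge : m ^ s <= 2 ^ s * (s`! * 'C(#|N|, s)).
  by rewrite [s`! * _]mulnC bin_ffact ffact_ge.
have pred_ge : m ^ (#|N| - s) <= 16 * m.-1 ^ (#|N| - s).
  by rewrite mh; apply: expn_pred_ge; lia.
have := leq_mul (leq_mul C_ge pred_ge) (leqnn (m ^ (#|T| - #|N|))).
rewrite -!expnD subnKC // subnKC //; congr (_ <= _).
move: (m.-1 ^ _) (m ^ _) ('C(_, _)) (2 ^ s) (s`!) => a b c d e.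
by lia.
Qed.
End ExactHits.

(* A random set A obtained by keeping each vertex with probability 1/m. *)
Lemma exact_sampling (T I : finType) (m h s B : nat) (P : {set T}) (Q : {set I})
    (N : I -> {set T}) :
  m = 2 * h -> 0 < m -> 2 * s <= m ->
  (forall b, b \in Q -> N b \subset P /\ m <= #|N b| <= 2 * m) ->
  B * #|P| < #|Q| * m ->
  exists A : {set T}, A \subset P /\
    B * #|A| < 16 * 2 ^ s * s`! * #|[set b in Q | #|N b :&: A| == s]|.
Proof.
move=> mh m_gt0 sm NP dense; set c := 16 * 2 ^ s * s`!.
pose z0 : 'I_m := Ordinal m_gt0.
pose Z (phi : {ffun T -> 'I_m}) := [set x in P | phi x == z0].
apply: contrapT => no.
have le phi : c * #|[set b in Q | #|N b :&: Z phi| == s]| <= B * #|Z phi|.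
  rewrite leqNgt; apply/negP => lt; apply: no; exists (Z phi); split=> //.
  by apply/fintype.subsetP => x; rewrite inE => /andP[].
(* In expectation [Z phi] has [#|P| / m] elements and meets at least [#|Q| / c] of the sets [N b] in
   exactly s elements, which contradicts the density hypothesis. *)
have : \sum_phi c * #|[set b in Q | #|N b :&: Z phi| == s]| <= \sum_phi B * #|Z phi|.
  exact: leq_sum.
rewrite -!big_distrr /= (sum_card_exchange predT Q (fun (phi : {ffun T -> 'I_m}) b => #|N b :&: Z phi| == s)).
rewrite (sum_card_exchange predT P (fun (phi : {ffun T -> 'I_m}) x => phi x == z0)).
have one x : m * #|[set phi : {ffun T -> 'I_m} | phi x == z0]| = m ^ #|T|.
  have := @card_exact_hits T m z0 [set x] 1; rewrite cards1 binn subnn expn0 !mul1n => E.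
  have T_gt0 : 0 < #|T| by apply/card_gt0P; exists x.
  rewrite -[in RHS](prednK T_gt0) expnS -subn1 -E; congr (_ * _).
  apply: eq_card => phi; rewrite !inE.
  have -> : [set x0 in [set x] | phi x0 == z0] = if phi x == z0 then [set x] else set0.
    apply/setP => y; rewrite !inE; case: eqVneq => [->|yx] /=.
      by case: ifP; rewrite !inE ?eqxx.
    by case: ifP; rewrite !inE ?(negbTE yx).
  by case: ifP; rewrite ?cards1 ?cards0.
move/(leq_mul (leqnn m)); rewrite [X in _ <= X]mulnCA [m * \sum_(_ in _) _]big_distrr /=.
have -> : \sum_(x in P) m * #|[set phi : {ffun T -> 'I_m} | phi x == z0]| = #|P| * m ^ #|T|.
  by rewrite -sum_nat_const; apply: eq_bigr.
rewrite leqNgt => /negP; apply.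
apply: (@leq_trans (m * (#|Q| * m ^ #|T|))).
  by rewrite mulnA mulnCA mulnA ltn_pmul2r // expn_gt0 m_gt0.
rewrite leq_mul2l -sum_nat_const big_distrr /=; apply/orP; right.
apply: leq_sum => b bQ; have [NbP mN] := NP _ bQ.
apply: leq_trans (card_exact_hits_ge z0 mh mN sm) _.
rewrite leq_mul2l; apply/orP; right; apply: subset_leq_card.
apply/fintype.subsetP => phi; rewrite !inE => /eqP <-; apply/eqP; apply: eq_card => x.
rewrite !inE; case xN: (x \in N b) => //=.
by rewrite (fintype.subsetP NbP).
Qed.

Lemma biclique_embedding (G : sgraph) (A B : {set G}) s :
  s <= #|A| -> s <= #|B| -> (forall a b, a \in A -> b \in B -> adj a b) ->
  exists f : {ffun Kmn s s -> G}, [/\ injective f,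
    forall i, f (inl i) \in A & forall i, f (inr i) \in B].
Proof.
move=> sA sB AB.
pose f : {ffun Kmn s s -> G} := [ffun u => match u with
  | inl i => enum_val (widen_ord sA i)
  | inr i => enum_val (widen_ord sB i)
  end].
have neq a b : a \in A -> b \in B -> a <> b.
  by move=> aA bB ab; move: (AB _ _ aA bB); rewrite ab adj_irrefl.
have fA i : f (inl i) \in A by rewrite ffunE; apply: enum_valP.
have fB i : f (inr i) \in B by rewrite ffunE; apply: enum_valP.
exists f; split=> //; case=> [i|i] [j|j].
- by rewrite !ffunE => /enum_val_inj/(congr1 val) /= e; congr inl; apply: val_inj.
- by move=> e; case: (neq _ _ (fA i) (fB j)).
- by move=> e; case: (neq _ _ (fA j) (fB i)).
- by rewrite !ffunE => /enum_val_inj/(congr1 val) /= e; congr inr; apply: val_inj.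
Qed.

Lemma biclique_subgraph (G : sgraph) (A B : {set G}) s :
  s <= #|A| -> s <= #|B| -> (forall a b, a \in A -> b \in B -> adj a b) ->
  subgraph (Kmn s s) G.
Proof.
move=> sA sB AB; have [f [f_inj fA fB]] := biclique_embedding sA sB AB.
apply/existsP; exists f; apply/andP; split; first exact/injectiveP.
apply/forallP => u; apply/forallP => v; apply/implyP.
by case: u v => [i|i] [j|j] // _; [exact: AB | rewrite adj_sym; exact: AB].
Qed.

(** Exact sampling needs sets [N b] of sizes within a factor two of each other. If every dyadic
    scale from [j0] on failed, the geometric series would give [#|Q| * 2 ^ j0 <= 2 * (B * p)],
    against [p <= #|Q|] and [2 * B < 2 ^ j0]. *)
Lemma scale_selection (I T : finType) (Q : {set I}) (N : I -> {set T}) B p j0 :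
  2 * B < 2 ^ j0 -> p <= #|Q| -> 0 < #|Q| ->
  (forall b, b \in Q -> 2 ^ j0 <= #|N b|) ->
  exists2 j, j0 <= j &
    B * p < #|[set b in Q | 2 ^ j <= #|N b| < 2 ^ j.+1]| * 2 ^ j.
Proof.
move=> Bj0 pQ Q_gt0 NQ; apply: contrapT => no.
have le j : j0 <= j -> #|[set b in Q | 2 ^ j <= #|N b| < 2 ^ j.+1]| * 2 ^ j <= B * p.
  by move=> j0j; rewrite leqNgt; apply/negP => lt; apply: no; exists j.
have claim k j : j0 <= j -> #|T| < 2 ^ (j + k) ->
    #|[set b in Q | 2 ^ j <= #|N b|]| * 2 ^ j <= 2 * (B * p).
  elim: k j => [|k IH] j j0j jk.
    have -> : [set b in Q | 2 ^ j <= #|N b|] = set0; last by rewrite cards0.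
    apply/setP => b; rewrite !inE; rewrite addn0 in jk; apply/negP => /andP[_ h].
    by have := leq_trans h (max_card _); rewrite leqNgt jk.
  have := IH j.+1 (leqW j0j); rewrite addSnnS => /(_ jk); have := le j j0j.
  have : #|[set b in Q | 2 ^ j <= #|N b|]| <=
      #|[set b in Q | 2 ^ j <= #|N b| < 2 ^ j.+1]| + #|[set b in Q | 2 ^ j.+1 <= #|N b|]|.
    rewrite -cardsUI; apply: leq_trans (leq_addr _ _); apply: subset_leq_card.
    apply/fintype.subsetP => b; rewrite !inE => /andP[-> ->] /=.
    by rewrite ltnNge; case: (_ <= _).
  have arith x y z t w u : x <= y + z -> y * t <= w -> z * u <= 2 * w -> u = 2 * t ->
    x * t <= 2 * w by nia.
  by move=> h1 h2 h3; apply: (arith _ _ _ _ _ _ h1 h2 h3); rewrite expnS.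
have := claim #|T| j0 (leqnn _); have -> : [set b in Q | 2 ^ j0 <= #|N b|] = Q.
  by apply/setP => b; rewrite !inE; case bQ: (b \in Q) => //=; apply: NQ.
have hT : #|T| < 2 ^ (j0 + #|T|).
  by apply: leq_trans (ltn_expl _ (isT : 1 < 2)) _; rewrite leq_exp2l // leq_addl.
move=> /(_ hT); move: pQ Q_gt0 Bj0; move: #|Q| (2 ^ j0) => x y; nia.
Qed.

Section OneSubdivision.
Variables (G : sgraph) (X Q : {set G}).
Hypothesis Xind : {in X &, forall x y, ~~ adj x y}.
Hypothesis Qind : {in Q &, forall x y, ~~ adj x y}.
Hypothesis XQ : [disjoint X & Q].

Let N b := [set a in X | adj b a].
Let E (x y : G) := (x != y) && [exists b in Q, N b == [set x; y]].

Let E_sym : symmetric E.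
Proof. by move=> x y; rewrite /E eq_sym setUC. Qed.

Let E_irr : irreflexive E.
Proof. by move=> x; rewrite /E eqxx. Qed.

Definition link_graph : sgraph := SGraph E_sym E_irr.

(** Since X and Q are independent, a vertex of Q whose neighbours in X are exactly x and y
    subdivides the edge x y without creating further edges. *)
Lemma link_graph_ITMe : ITMe 1 G (induced (X : {set link_graph})).
Proof.
pose f (x : induced (X : {set link_graph})) : G := val x.
pose h x y (i : nat) := odflt (f x) [pick b | (b \in Q) && (N b == [set f x; f y])].
have f_inj : injective f by exact: val_inj.
have fX x : f x \in X by exact: (valP x).
have hP x y i : adj x y -> h x y i \in Q /\ N (h x y i) = [set f x; f y].
  case/andP => _ /existsP[b bP]; rewrite /h; case: pickP => [c /andP[cQ /eqP cN] //|/(_ b)].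
  by rewrite bP.
apply: (@ITMe_subdivision_map 1 _ _ f h) => //; split => //.
- move=> z x y i /hP xy _ zE; have [hQ _] := xy i; rewrite -zE in hQ.
  by move: (disjointFr XQ (fX z)); rewrite hQ.
- move=> x y x' y' i i' xy xy'; rewrite !ltnS !leqn0 => /eqP -> /eqP -> e.
  have [_ NE] := hP _ _ 0 xy; have [_ NE'] := hP _ _ 0 xy'.
  rewrite e NE' in NE; have xx' : x' != y'.
    by apply: contraTneq xy' => ->; rewrite adj_irrefl.
  have : f x' \in [set f x; f y] by rewrite -NE !inE eqxx.
  have : f y' \in [set f x; f y] by rewrite -NE !inE eqxx orbT.
  rewrite !inE !(inj_eq f_inj) => /orP[] /eqP ey /orP[] /eqP ex; subst.
  + by rewrite eqxx in xx'.
  + by right.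
  + by left.
  + by rewrite eqxx in xx'.
- by move=> x y; apply: Xind.
- move=> z x y i /hP xy; rewrite ltnS leqn0 => /eqP ->; have [_ NE] := xy 0.
  have : (f z \in N (h x y 0)) = (f z \in [set f x; f y]) by rewrite NE.
  by rewrite !inE fX !(inj_eq f_inj) adj_sym !andbT.
- move=> x y x' y' i i' /hP xy /hP xy' _ _; have [hQ _] := xy i; have [hQ' _] := xy' i'.
  by rewrite (negbTE (Qind hQ hQ')).
Qed.

Lemma link_graph_degree_sum :
  degree_sum (induced (X : {set link_graph})) =
  #|[set p | (p.1 != p.2) && [exists b in Q, N b == [set p.1; p.2]]]|.
Proof.
rewrite degree_sum_induced_support // => x y /andP[_ /existsP[b /andP[_ /eqP NE]]].
have : x \in N b by rewrite NE !inE eqxx.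
by rewrite inE => /andP[].
Qed.
End OneSubdivision.

(** The hypergraph analogue of [min_degree_subset]. If x has fewer than d shadow neighbours, the
    sets through x lie in a set of at most d elements: at most [2 ^ d] distinct sets, each repeated
    at most s times, are lost with x. *)
Lemma dense_shadow (T J : finType) (B : {set J}) (U : J -> {set T}) s d (X : {set T}) :
  0 < s -> (forall b, b \in B -> #|U b| = s) ->
  (forall S, #|[set b in B | U b == S]| <= s) ->
  s * 2 ^ d * #|X| < #|[set b in B | U b \subset X]| ->
  exists Y : {set T}, [/\ Y \subset X, Y != set0 &
    forall x, x \in Y -> d <= #|[set y in Y | (x != y) &&
      [exists b in B, [&& U b \subset Y, x \in U b & y \in U b]]]|].
Proof.
move=> s_gt0 Us mult; move En: #|X| => n; elim: n X En => [|n IH] X En dense.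
  move: dense; rewrite muln0 => /card_gt0P[b]; rewrite inE => /andP[/Us Ub].
  by rewrite (cards0_eq En) subset0 => /eqP U0; rewrite -Ub U0 cards0 in s_gt0.
pose W x := [set y in X | (x != y) &&
      [exists b in B, [&& U b \subset X, x \in U b & y \in U b]]].
case: (boolP [forall x in X, d <= #|W x|]) => [/forall_inP h|].
  by exists X; split=> //; rewrite -card_gt0 En.
case/forall_inPn => x xX; rewrite -ltnNge => Wx.
have En' : #|X :\ x| = n by move: (cardsD1 x X); rewrite xX En => -[].
have few : #|[set b in B | (U b \subset X) && (x \in U b)]| <= s * 2 ^ d.
  rewrite (card_fibers _ U) (bigID (mem (powerset (x |: W x)))) /=.
  rewrite [X in _ + X]big1 ?addn0 => [|S]; last first.
    rewrite inE => nS; apply: eq_card0 => b; rewrite !inE; apply/negP.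
    case/andP=> /and3P[bB UX xU] /eqP US; case/negP: nS; apply/fintype.subsetP => y.
    rewrite -US => yU; rewrite !inE; case: (eqVneq y x) => //= yx.
    rewrite (fintype.subsetP UX) //; apply/existsP; exists b.
    by rewrite bB UX xU.
  apply: (@leq_trans (\sum_(S in powerset (x |: W x)) s)).
    apply: leq_sum => S _; apply: leq_trans (mult S); apply: subset_leq_card.
    by apply/fintype.subsetP => b; rewrite !inE => /andP[/andP[-> _] ->].
  rewrite sum_nat_const card_powerset mulnC leq_mul2l leq_exp2l //.
  apply/orP; right; rewrite cardsU1; apply: leq_trans Wx; rewrite -[X in _ <= X]add1n leq_add2r.
  by case: (_ \notin _).
have : s * 2 ^ d * n < #|[set b in B | U b \subset X :\ x]|.
  rewrite -(ltn_add2l (s * 2 ^ d)) -mulnS; apply: leq_trans dense _.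
  apply: leq_trans (leq_add few (leqnn _)).
  rewrite -cardsUI; apply: leq_trans (leq_addr _ _); apply: subset_leq_card.
  apply/fintype.subsetP => b; rewrite !inE => /andP[-> UX] /=; rewrite UX subsetD1 UX /=.
  by case: (x \in U b).
case/(IH _ En') => Y [YX Y0 Yd]; exists Y; split=> //.
exact: fintype.subset_trans YX (subsetDl _ _).
Qed.

(** This exceeds [l * 2 ^ s] since the final sampling keeps a shadow pair with probability at least
    2^-s. The ratio below multiplies the density required by [dense_shadow] by the loss 16 2^s s! of
    exact sampling. From [degree_scale] on, powers of two are even and exceed [2 * s] and
    [2 * sampling_ratio s l]. *)
Definition shadow_degree s l := (l * 2 ^ s).+1.
Definition sampling_ratio s l := 16 * 2 ^ s * s`! * (s * 2 ^ shadow_degree s l).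
Definition degree_scale s l := 2 * sampling_ratio s l + 2 * s + 1.

Section Degeneracy.
Variables (G : sgraph) (s l : nat).
Hypothesis noKss : ~~ subgraph (Kmn s s) G.
Hypothesis hl : forall H, ITMe 1 G H -> degree_sum H <= l * #|H|.

(** Otherwise, at a suitable dyadic scale, sampling P leaves many b in Q with exactly s neighbours
    in A. More than s of them sharing one s-set would give K_(s,s), so the shadow of these s-sets is
    dense on some Y. For each shadow pair one s-set through it is fixed; half-sampling keeps the
    pair and drops the rest of that s-set, which turns the pair into an edge of a link graph that is
    too dense. *)
Lemma bipartite_low_degree (P Q : {set G}) :
  {in P &, forall x y, ~~ adj x y} -> {in Q &, forall x y, ~~ adj x y} ->
  [disjoint P & Q] -> #|P| <= #|Q| -> 0 < #|Q| ->
  exists2 b, b \in Q & #|[set a in P | adj b a]| < 2 ^ degree_scale s l.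
Proof.
move=> Pind Qind PQ cPQ Q_gt0; apply: contrapT => no.
pose N b := [set a in P | adj b a].
have NQ b : b \in Q -> 2 ^ degree_scale s l <= #|N b|.
  by move=> bQ; rewrite leqNgt; apply/negP => lt; apply: no; exists b.
have s_gt0 : 0 < s.
  rewrite lt0n; apply: contraNneq noKss => ->.
  by apply: (@biclique_subgraph G set0 set0) => // a b; rewrite inE.
have scale_gt : degree_scale s l < 2 ^ degree_scale s l by exact: ltn_expl.
have [|j le_j dense] := scale_selection (B := sampling_ratio s l) _ cPQ Q_gt0 NQ.
  by apply: leq_ltn_trans scale_gt; rewrite /degree_scale -addnA leq_addr.
set Qj := [set b in Q | _] in dense.
have j_ge : degree_scale s l < 2 ^ j.
  by apply: leq_trans scale_gt _; rewrite leq_exp2l.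
have j_gt0 : 0 < j by apply: leq_trans le_j; rewrite /degree_scale addn1.
have [|||b|A [AP many]] := @exact_sampling _ _ (2 ^ j) (2 ^ j.-1) s
    (sampling_ratio s l) P Qj N _ _ _ _ dense.
- by rewrite -expnS prednK.
- by rewrite expn_gt0.
- by apply: leq_trans (ltnW j_ge); rewrite /degree_scale; lia.
- rewrite inE => /and3P[_ lo hi]; split; first by apply/fintype.subsetP => a; rewrite inE => /andP[].
  by rewrite lo -expnS ltnW.
set Gd := [set b in Qj | _] in many.
pose U b := N b :&: A.
have UA b : U b \subset A by apply: subsetIr.
have Us b : b \in Gd -> #|U b| = s by rewrite inE => /andP[_ /eqP].
have GdQ b : b \in Gd -> b \in Q by rewrite !inE => /andP[/andP[]].
have mult S : #|[set b in Gd | U b == S]| <= s.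
  rewrite leqNgt; apply/negP => lt; case/negP: noKss.
  have [b0] : exists b, b \in [set b in Gd | U b == S].
    by apply/set0Pn; rewrite -card_gt0; apply: leq_ltn_trans lt.
  rewrite inE => /andP[b0G /eqP US].
  apply: (@biclique_subgraph G S [set b in Gd | U b == S]); first by rewrite -US Us.
    exact: ltnW.
  move=> a b aS; rewrite inE => /andP[_ /eqP Ub]; move: aS; rewrite -Ub !inE adj_sym.
  by case/andP => /andP[].
have [|Y [YA Y0 Yd]] := @dense_shadow _ _ Gd U s (shadow_degree s l) A s_gt0 Us mult.
  have -> : [set b in Gd | U b \subset A] = Gd.
    by apply/setP => b; rewrite inE UA andbT.
  move: many; rewrite /sampling_ratio -mulnA; move: (16 * 2 ^ s * s`!) => c.
  by case: c => // c; rewrite ltn_pmul2l.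
pose sh b x y := [&& U b \subset Y, x \in U b & y \in U b].
pose J := [set p : G * G | (p.1 \in Y) && ((p.2 \in Y) && ((p.1 != p.2) &&
  [exists b in Gd, sh b p.1 p.2]))].
have cJ : #|Y| * shadow_degree s l <= #|J|.
  rewrite (card_set_pairs (fun x y => (x \in Y) && ((y \in Y) && ((x != y) &&
    [exists b in Gd, sh b x y])))).
  rewrite (bigID (mem Y)) /=; apply: leq_trans (leq_addr _ _).
  rewrite -sum_nat_const; apply: leq_sum => x xY; apply: leq_trans (Yd x xY) _.
  by apply: subset_leq_card; apply/fintype.subsetP => y; rewrite !inE xY.
have /choice[bb bbP] (p : G * G) : exists b, p \in J -> b \in Gd /\ sh b p.1 p.2.
  case: (boolP (p \in J)) => [|_]; last by exists p.1.
  by rewrite inE => /and4P[_ _ _ /existsP[b /andP[bG bp]]]; exists b.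
have [p pJ|Z] := @half_sampling G _ J (fun p => [set p.1; p.2])
  (fun p => U (bb p) :\: [set p.1; p.2]) s.
  split; first by rewrite disjoint_sym disjoints_subset subsetDr.
  have [/Us Ub /and3P[_ p1 p2]] := bbP _ pJ.
  rewrite -[X in _ <= X]Ub -[X in _ <= X](cardsID [set p.1; p.2]) leq_add2r.
  by apply: subset_leq_card; rewrite subsetI subxx andbT subUset !sub1set p1.
set K := [set p in J | _] => JK.
pose X := Y :&: Z.
have XP x : x \in X -> x \in P.
  by rewrite inE => /andP[xY _]; rewrite (fintype.subsetP AP) // (fintype.subsetP YA).
have cK : #|K| <= l * #|X|.
  rewrite -[#|X|](@card_induced (link_graph X Q)).
  have Xind : {in X &, forall x y, ~~ adj x y} by move=> x y /XP xP /XP yP; apply: Pind.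
  have XQ : [disjoint X & Q].
    rewrite disjoints_subset; apply/fintype.subsetP => x /XP xP; rewrite inE.
    by rewrite (disjointFr PQ xP).
  apply: leq_trans (hl (link_graph_ITMe Xind Qind XQ)).
  rewrite link_graph_degree_sum; apply: subset_leq_card; apply/fintype.subsetP => p.
  case/setIdP => pJ /andP[pZ OZ]; have [bG /and3P[UY p1 p2]] := bbP _ pJ.
  rewrite inE; move: (pJ); rewrite inE => /and4P[p1Y p2Y neq _]; rewrite neq /=.
  apply/existsP; exists (bb p); rewrite GdQ //=; apply/eqP/setP => x.
  move: pZ; rewrite subUset !sub1set => /andP[p1Z p2Z].
  apply/idP/idP; rewrite !inE.
    case/andP => /andP[xY xZ] bx; apply: contraT => xp.
    have xU : x \in U (bb p) by rewrite !inE bx (fintype.subsetP YA) // XP // inE xY.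
    have xO : x \in U (bb p) :\: [set p.1; p.2] by rewrite in_setD xU !inE xp.
    by rewrite (disjointFr OZ xO) in xZ.
  have Ubx y : y \in U (bb p) -> adj (bb p) y by rewrite !inE => /andP[/andP[]].
  by case/orP => /eqP ->; rewrite ?p1Y ?p2Y ?p1Z ?p2Z Ubx.
have Y_gt0 : 0 < #|Y| by rewrite card_gt0.
have XY : #|X| <= #|Y| by apply: subset_leq_card; apply: subsetIl.
have : #|Y| * shadow_degree s l <= #|Y| * (2 ^ s * l).
  apply: leq_trans cJ _; apply: leq_trans JK _; rewrite mulnCA leq_mul2l.
  by apply/orP; right; apply: leq_trans cK _; rewrite mulnC leq_mul2r XY orbT.
by rewrite leq_pmul2l // /shadow_degree mulnC ltnn.
Qed.

Definition degeneracy_bound K := 4 * K * 2 ^ degree_scale s l.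

(** Write d for [2 ^ degree_scale s l]. Over all ordered pairs of colours, the sizes of the two
    classes add up to [2 * K * #|S|]; so if all degrees exceed [4 * K * d], some two classes span
    more than 2d edges per vertex. A subgraph of minimum degree above d between them contradicts
    [bipartite_low_degree] on its larger side. *)
Lemma colorable_degenerate K (S : {set G}) : colorable G K -> S != set0 ->
  exists2 v, v \in S & #|[set u in S | adj v u]| <= degeneracy_bound K.
Proof.
case/existsP => c /forallP cP S0; apply: contrapT => no.
have proper x y : adj x y -> c x != c y.
  by move=> xy; have /forallP/(_ y)/implyP := cP x; apply.
set d := 2 ^ degree_scale s l.
have deg v : v \in S -> degeneracy_bound K < #|[set u in S | adj v u]|.
  by move=> vS; rewrite ltnNge; apply/negP => le; apply: no; exists v.
have K_gt0 : 0 < K.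
  by case/set0Pn: S0 => v _; apply: leq_trans (ltn_ord (c v)).
pose F := [set p : G * G | (p.1 \in S) && ((p.2 \in S) && adj p.1 p.2)].
pose e q := #|[set p in F | (c p.1, c p.2) == q]|.
pose Sc i := [set x in S | c x == i].
have [[i j] /= eij] : exists q, 2 * d * (#|Sc q.1| + #|Sc q.2|) < e q.
  apply: contrapT => none.
  have le q : e q <= 2 * d * (#|Sc q.1| + #|Sc q.2|).
    by rewrite leqNgt; apply/negP => lt; apply: none; exists q.
  have cF : #|S| * (degeneracy_bound K).+1 <= #|F|.
    rewrite (card_set_pairs (fun x y => (x \in S) && ((y \in S) && adj x y))).
    rewrite (bigID (mem S)) /=; apply: leq_trans (leq_addr _ _).
    rewrite -sum_nat_const; apply: leq_sum => x xS; apply: leq_trans (deg x xS) _.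
    by apply: subset_leq_card; apply/fintype.subsetP => y; rewrite !inE xS.
  have : #|F| <= 4 * K * d * #|S|.
    rewrite (card_fibers F (fun p => (c p.1, c p.2))); apply: leq_trans (leq_sum _ (fun q _ => le q)) _.
    rewrite -big_distrr /= big_split /=.
    rewrite -(pair_bigA _ (fun i j => #|Sc i|)) -(pair_bigA _ (fun i j => #|Sc j|)) /=.
    have -> : \sum_i \sum_(j < K) #|Sc i| = K * #|S|.
      rewrite (card_fibers S c) big_distrr /=; apply: eq_bigr => i _.
      by rewrite sum_nat_const card_ord.
    by rewrite sum_nat_const card_ord -(card_fibers S c); lia.
  move/(leq_trans cF); rewrite mulnC leq_pmul2r ?card_gt0 //.
  by rewrite /degeneracy_bound ltnn.
have ij : i != j.
  have /card_gt0P[p] : 0 < e (i, j) by apply: leq_ltn_trans eij.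
  rewrite !inE => /andP[/and3P[_ _ /proper h] /eqP[<- <-]].
  exact: h.
pose r x y := adj x y && (((c x == i) && (c y == j)) || ((c x == j) && (c y == i))).
have r_sym : symmetric r.
  by move=> x y; rewrite /r adj_sym orbC; congr (_ && (_ || _)); rewrite andbC.
have r_irr : irreflexive r by move=> x; rewrite /r adj_irrefl.
pose X := Sc i :|: Sc j.
have [|Y [YX Y0 Yd]] := @min_degree_subset _ r d X r_sym r_irr.
  apply: (@leq_ltn_trans (2 * d * (#|Sc i| + #|Sc j|))).
    by rewrite leq_mul2l cardsU leq_subr orbT.
  apply: leq_trans eij _.
  apply: (@leq_trans #|[set p : G * G | (p.1 \in X) && ((p.2 \in X) && r p.1 p.2)]|).
    apply: subset_leq_card; apply/fintype.subsetP => p; rewrite !inE.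
    case/andP => /and3P[p1 p2 p12] /eqP[c1 c2].
    by rewrite p1 p2 c1 c2 !eqxx /r p12 c1 c2 !eqxx /= !orbT.
  rewrite (card_set_pairs (fun x y => (x \in X) && ((y \in X) && r x y))).
  rewrite (bigID (mem X)) /= [X in _ + X]big1 ?addn0 => [|x xX]; last first.
    by apply: eq_card0 => y; rewrite inE (negbTE xX).
  apply: leq_sum => x xX; apply: subset_leq_card; apply/fintype.subsetP => y.
  by rewrite !inE => /andP[].
pose Yc k := [set x in Y | c x == k].
have Ycol k k' : k != k' -> [disjoint Yc k & Yc k'].
  move=> kk'; rewrite disjoints_subset; apply/fintype.subsetP => x; rewrite !inE.
  by case/andP => _ /eqP ->; rewrite (negbTE kk') andbF.
have Yind k : {in Yc k &, forall x y, ~~ adj x y}.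
  move=> x y; rewrite !inE => /andP[_ /eqP cx] /andP[_ /eqP cy].
  by apply/negP => /proper; rewrite cx cy eqxx.
have YE : Y \subset Yc i :|: Yc j.
  apply/fintype.subsetP => x xY; have := fintype.subsetP YX x xY; rewrite !inE xY.
  by case/orP => /andP[_ ->]; rewrite ?orbT.
have final k k' : k != k' -> (k == i) && (k' == j) || (k == j) && (k' == i) ->
    #|Yc k| <= #|Yc k'| -> 0 < #|Yc k'| -> False.
  move=> kk' kij le gt0.
  have [b bY] := bipartite_low_degree (Yind k) (Yind k') (Ycol _ _ kk') le gt0.
  move: bY; rewrite inE => /andP[bY /eqP cb]; apply/negP; rewrite -leqNgt.
  apply: leq_trans (ltnW (Yd b bY)) _; apply: subset_leq_card.
  apply/fintype.subsetP => y; rewrite !inE => /andP[yY /andP[by_ col]]; rewrite yY by_ andbT /=.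
  move: col kij; rewrite cb => /orP[] /andP[/eqP e1 /eqP e2] /orP[] /andP[/eqP e3 /eqP e4];
    subst; rewrite ?eqxx // in ij kk' *; by rewrite e2 ?eqxx // in kk'.
have Y_gt0 : 0 < #|Yc i| + #|Yc j|.
  apply: (@leq_trans #|Y|); first by rewrite card_gt0.
  by apply: leq_trans (subset_leq_card YE) _; rewrite cardsU leq_subr.
case/orP: (leq_total #|Yc i| #|Yc j|) => le.
  by apply: (final i j) => //; rewrite ?eqxx //; move: le Y_gt0; clear; lia.
apply: (final j i) => //; first by rewrite eq_sym.
  by rewrite !eqxx orbT.
by move: le Y_gt0; clear; lia.
Qed.
End Degeneracy.

Definition chi_p_bound p K s (L : nat -> nat) :=
  let l := density_bound L (degeneracy_bound s (L 1) K) (2 * 2 ^ p) in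
  (\sum_(i < (2 ^ p).+1) (adm_bound (2 ^ p) l * 2 ^ p) ^ i).+1.

Lemma chi_p_le_bound (G : sgraph) p K s L : colorable G K -> ~~ subgraph (Kmn s s) G ->
  (forall t H, 0 < t -> ITMe t G H -> degree_sum H <= L t * #|H|) ->
  chi_p p G <= chi_p_bound p K s L.
Proof.
move=> GK noKss LP; apply: chi_p_le_ITMe => // S; apply: colorable_degenerate => // H.
exact: LP.
Qed.

(** * Chromatic number and average degree of induced topological minors *)

(** For [r > 0], deleting an edge of H amounts to deleting the interior of its path, so the class is
    closed under all subgraphs and not only induced ones. *)
Lemma ITMe_subgraph r (G H H' : sgraph) : 0 < r -> subgraph H' H -> ITMe r G H ->
  ITMe r G H'.
Proof.
move=> r_gt0 /existsP[phi /andP[/injectiveP phi_inj /forallP phi_adj]].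
have padj x y : adj x y -> adj (phi x) (phi y).
  by move=> xy; have /forallP/(_ y)/implyP := phi_adj x; apply.
move=> /subdivision_map_ITMe/(_ r_gt0)[f [h [[s1 s2 s3 s4 s5 s6 s7] _]]].
apply: (@ITMe_subdivision_map r _ _ (fun x => f (phi x)) (fun x y => h (phi x) (phi y))) => //.
split.
- by move=> x y /s1/phi_inj.
- by move=> z x y i /padj; apply: s2.
- move=> x y x' y' i i' /padj xy /padj xy' ir ir' /(s3 _ _ _ _ _ _ xy xy' ir ir').
  by case=> [[/phi_inj -> /phi_inj -> ->]|[/phi_inj -> /phi_inj ->]]; [left | right].
- by move=> x y; apply: s4.
- by move=> z x y i /padj xy ir; rewrite s5 // !(inj_eq phi_inj).
- move=> x y x' y' i i' /padj xy /padj xy' ir ir' /(s6 _ _ _ _ _ _ xy xy' ir ir').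
  by case=> [[/phi_inj -> /phi_inj -> ->]|[/phi_inj -> /phi_inj ->]]; [left | right].
- by move=> x y i /padj; apply: s7.
Qed.

Lemma induced_sub (G : sgraph) (A : {set G}) : subgraph (induced A) G.
Proof.
apply/existsP; exists [ffun x => val x]; apply/andP; split.
  by apply/injectiveP => x y; rewrite !ffunE => /val_inj.
by apply/forallP => x; apply/forallP => y; rewrite !ffunE; apply/implyP.
Qed.

Section PairGraph.
Variables (r : nat) (G H : sgraph) (A B : {set H}) (pr : H -> H * H).
Hypothesis r_gt0 : 0 < r.
Hypothesis AB : [disjoint A & B].
Hypothesis prP : forall b, b \in B ->
  [/\ (pr b).1 \in A, (pr b).2 \in A, adj b (pr b).1 & adj b (pr b).2].

Let E x y := (x != y) && [exists b in B, (pr b == (x, y)) || (pr b == (y, x))].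

Let E_sym : symmetric E.
Proof. by move=> x y; rewrite /E eq_sym; congr (_ && _); apply: eq_existsb => b; rewrite orbC. Qed.

Let E_irr : irreflexive E.
Proof. by move=> x; rewrite /E eqxx. Qed.

Definition pair_graph : sgraph := SGraph E_sym E_irr.
Let A' : {set pair_graph} := A.

(* Two consecutive r-subdivided edges a b, b a' of H form a path with 2r+1
   interior vertices. *)
Lemma pair_graph_ITMe : ITMe r G H -> ITMe (2 * r + 1) G (induced A').
Proof.
move=> /subdivision_map_ITMe/(_ r_gt0)[f [h [[s1 s2 s3 s4 s5 s6 s7] _]]].
pose v (x : induced A') : H := val x.
have v_inj : injective v by exact: val_inj.
have vA x : v x \in A by exact: (valP x).
pose bs x y := odflt (v x) [pick b in B | (pr b == (v x, v y)) || (pr b == (v y, v x))].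
have bsP x y : adj x y -> [/\ bs x y \in B, adj (v x) (bs x y), adj (bs x y) (v y) &
    pr (bs x y) = (v x, v y) \/ pr (bs x y) = (v y, v x)].
  case/andP => _ /existsP[b bP]; rewrite /bs; case: pickP => [c /andP[cB]|/(_ b)]; last by rewrite bP.
  have [_ _ a1 a2] := prP cB.
  case/orP => /eqP e; move: a1 a2; rewrite e /= => a1 a2; split=> //; rewrite 1?adj_sym //;
    by [left | right].
have vB z b : b \in B -> v z <> b.
  by move=> bB e; move: (disjointFr AB (vA z)); rewrite e bB.
have bsI x y x' y' : adj x y -> adj x' y' -> bs x y = bs x' y' ->
    (x = x' /\ y = y') \/ (x = y' /\ y = x').
  move=> /bsP[_ _ _ p] /bsP[_ _ _ p'] e; rewrite -e in p'.
  by case: p p' => -> [] [/v_inj -> /v_inj ->]; [left | right | right | left].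
(* Indices below r run along the edge from x to [bs x y], index r is that branch vertex, and the r
   indices from [r.+1] on run along the second edge. *)
pose h' x y i := if i < r then h (v x) (bs x y) i else
  if i == r then f (bs x y) else h (bs x y) (v y) (i - r.+1).
have h'P x y i : i < 2 * r + 1 -> [\/ i < r /\ h' x y i = h (v x) (bs x y) i,
    i = r /\ h' x y i = f (bs x y) |
    exists k, [/\ k < r, i = r.+1 + k & h' x y i = h (bs x y) (v y) k]].
  move=> ir; rewrite /h'; case: ltngtP => [lt|gt|eq]; [by constructor 1 | | by constructor 2].
  by constructor 3; exists (i - r.+1); split=> //; lia.
apply: (@ITMe_subdivision_map _ _ _ (fun x => f (v x)) h'); first by lia.
have neqxy (x y : induced A') : adj x y -> x <> y by move=> xy e; rewrite e adj_irrefl in xy.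
split.
- by move=> x y /s1/v_inj.
- move=> z x y i /bsP[bB xb yb _] /(h'P x y)[[ir ->]|[_ ->]|[k [kr _ ->]]].
  + exact: s2.
  + by move/s1/(vB _ _ bB).
  + exact: s2.
- move=> x y x' y' i i' xy xy'; have [bB xb yb _] := bsP _ _ xy; have [bB' xb' yb' _] := bsP _ _ xy'.
  move=> /(h'P x y)[[ir ->]|[-> ->]|[k [kr -> ->]]] /(h'P x' y')[[ir' ->]|[-> ->]|[k' [kr' -> ->]]].
  + case/s3 => // [[/v_inj e1 /(bsI _ _ _ _ xy xy') e2 ->]|[/(vB _ _ bB')]] //.
    by case: e2 => -[e3 e4]; [left | right].
  + by move/esym/s2 => /(_ xb ir).
  + case/s3 => // [[/(vB _ _ bB')]|[/v_inj e1 /(bsI _ _ _ _ xy xy') e2]] //.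
    by case: e2 => -[e3 e4]; [case: (neqxy _ _ xy'); rewrite -e3 | right].
  + by move/s2 => /(_ xb' ir').
  + by move/s1/(bsI _ _ _ _ xy xy') => [] [-> ->]; [left | right].
  + by move/s2 => /(_ yb' kr').
  + case/s3 => // [[/esym/(vB _ _ bB)]|[/(bsI _ _ _ _ xy xy') e2 /v_inj e1]] //.
    by case: e2 => -[e3 e4]; [case: (neqxy _ _ xy'); rewrite -e1 e4 | right].
  + by move/esym/s2 => /(_ yb kr).
  + case/s3 => // [[/(bsI _ _ _ _ xy xy') e2 /v_inj e1 ->]|[/esym/(vB _ _ bB)]] //.
    by case: e2 => -[e3 e4]; [left | right].
- by move=> x y; apply: s4.
- move=> z x y i xy; have [bB xb yb _] := bsP _ _ xy.
  have zb : (v z == bs x y) = false by apply/eqP/vB.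
  case/(h'P x y) => [[ir ->]|[-> ->]|[k [kr -> ->]]].
  + rewrite s5 // zb (inj_eq v_inj) orbF [_ == 2 * r + 1](_ : _ = false) ?andbF ?orbF //; lia.
  + rewrite (negbTE (s4 _ _)); lia.
  + rewrite s5 // zb (inj_eq v_inj) /= addSn /= andbF; congr (_ && _); lia.
- move=> x y x' y' i i' xy xy'; have [bB xb yb _] := bsP _ _ xy; have [bB' xb' yb' _] := bsP _ _ xy'.
  move=> /(h'P x y)[[ir ->]|[-> ->]|[k [kr -> ->]]] /(h'P x' y')[[ir' ->]|[-> ->]|[k' [kr' -> ->]]].
  + case/s6 => // [[/v_inj e1 /(bsI _ _ _ _ xy xy') e2 ii]|[/(vB _ _ bB')]] //.
    by case: e2 => -[e3 e4]; [left | right].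
  + rewrite adj_sym s5 // => /orP[] /andP[/eqP e].
      by case: (vB x _ bB').
    by move/esym/(bsI _ _ _ _ xy xy'): e => [] [-> ->] ?; [left; split=> //; apply/orP; left | right].
  + case/s6 => // [[/(vB _ _ bB')]|[/v_inj e1 /(bsI _ _ _ _ xy xy') e2]] //.
    by case: e2 => -[e3 e4]; [case: (neqxy _ _ xy'); rewrite -e3 | right].
  + rewrite s5 // => /orP[] /andP[/eqP e].
      by case: (vB x' _ bB).
    by move/(bsI _ _ _ _ xy xy'): e => [] [-> ->] ?; [left; split=> //; apply/orP; right | right].
  + by rewrite (negbTE (s4 _ _)).
  + rewrite s5 // => /orP[] /andP[/eqP e]; last by case: (vB y' _ bB).
    by move/(bsI _ _ _ _ xy xy'): e => [] [-> ->] /eqP ->; [left; split=> //; rewrite addn0 eqxx | right].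
  + case/s6 => // [[/esym/(vB _ _ bB)]|[/(bsI _ _ _ _ xy xy') e2 /v_inj e1]] //.
    by case: e2 => -[e3 e4]; [case: (neqxy _ _ xy'); rewrite -e1 e4 | right].
  + rewrite adj_sym s5 // => /orP[] /andP[/eqP e]; last by case: (vB y _ bB').
    by move/esym/(bsI _ _ _ _ xy xy'): e => [] [-> ->] /eqP ->; [left; split=> //; rewrite addn0 eqxx orbT | right].
  + case/s6 => // [[/(bsI _ _ _ _ xy xy') e2 /v_inj e1 ii]|[/esym/(vB _ _ bB)]] //.
    by case: e2 => -[e3 e4]; [left; split=> //; move: ii; lia | right].
- move=> x y i xy ir; have [bB xb yb _] := bsP _ _ xy.
  have ir0 := ltnW ir.
  case/(h'P x y): (ir0) => [[ir1 ->]|[e ->]|[k [kr e ->]]];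
    case/(h'P x y): ir => [[ir2 ->]|[e' ->]|[k' [kr' e' ->]]]; try by exfalso; lia.
  + exact: s7.
  + by rewrite adj_sym s5 // eqxx e' eqxx orbT.
  + have -> : k' = 0 by lia.
    by rewrite s5 // eqxx.
  + have -> : k' = k.+1 by lia.
    by apply: s7 => //; lia.
Qed.
End PairGraph.

Lemma omega_clique (G : sgraph) : exists2 A : {set G}, clique A & #|A| = omega G.
Proof.
have clique0 : clique (set0 : {set G}) by apply/forall_inP => x; rewrite inE.
have : 0 < #|[pred A : {set G} | clique A]| by apply/card_gt0P; exists set0.
by case/(eq_bigmax_cond (fun A : {set G} => #|A|)) => A cA e; exists A.
Qed.

Lemma clique_adj (G : sgraph) (A : {set G}) x y :
  clique A -> x \in A -> y \in A -> x != y -> adj x y.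
Proof. by move=> /forall_inP cA /cA/forall_inP h /h/implyP. Qed.

Lemma leq_omega (G : sgraph) (A : {set G}) : clique A -> #|A| <= omega G.
Proof. by move=> cA; apply: (bigmax_sup A). Qed.

Lemma subgraph_of_clique (H G : sgraph) : #|H| <= omega G -> subgraph H G.
Proof.
have [A cA <-] := omega_clique G => le.
pose f (x : H) : G := enum_val (widen_ord le (enum_rank x)).
have f_inj : injective f.
  by move=> x y /enum_val_inj/(congr1 val)/= /val_inj/enum_rank_inj.
apply/existsP; exists [ffun x => f x]; apply/andP; split.
  by apply/injectiveP => x y; rewrite !ffunE => /f_inj.
apply/forallP => x; apply/forallP => y; rewrite !ffunE; apply/implyP => xy.
apply: (clique_adj cA); rewrite ?enum_valP // (inj_eq f_inj).
by apply: contraTneq xy => ->; rewrite adj_irrefl.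
Qed.

Section ShiftGraph.
Variable n : nat.
Implicit Types x y z : 'I_n * 'I_n.

(** Pairs that are not increasing remain as isolated vertices, which makes the number of vertices
    exactly n^2. *)
Definition shift_adj x y := [&& x.1 < x.2, y.1 < y.2 & (x.2 == y.1) || (y.2 == x.1)].

Lemma shift_adj_sym : symmetric shift_adj.
Proof. by move=> x y; rewrite /shift_adj andbCA orbC. Qed.

Lemma shift_adj_irrefl : irreflexive shift_adj.
Proof.
move=> x; rewrite /shift_adj orbb; apply/negP => /and3P[lt _ /eqP e].
by rewrite e ltnn in lt.
Qed.

Definition shift_graph : sgraph := SGraph shift_adj_sym shift_adj_irrefl.

Lemma shift_graph_omega : omega shift_graph <= 2.
Proof.
have [A cA <-] := omega_clique shift_graph; rewrite leqNgt.
apply/negP => /card_gt2P[x [y [z [[xA yA zA] [xy yz zx]]]]].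
have := clique_adj cA xA yA xy; have := clique_adj cA yA zA yz; have := clique_adj cA zA xA zx.
rewrite /= /shift_adj -!(inj_eq val_inj) /=.
case: x y z {xA yA zA xy yz zx} => [[a ?] [b ?]] [[c ?] [d ?]] [[e ?] [f ?]] /=; lia.
Qed.

(* The sets of colours of the pairs (i, k) with i < k are distinct. *)
Lemma shift_graph_colorable k : colorable shift_graph k -> n <= 2 ^ k.
Proof.
case/existsP => c /forallP cP.
have proper (x y : shift_graph) : adj x y -> c x != c y.
  by move=> xy; have /forallP/(_ y)/implyP := cP x; apply.
pose S (i : 'I_n) := [set c (i, j) | j in [set j : 'I_n | i < j]].
have S_neq (i j : 'I_n) : i < j -> S i <> S j.
  move=> ij e; have : c (i, j) \in S j.
    by rewrite -e; apply/imsetP; exists j => //; rewrite inE.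
  case/imsetP => l; rewrite inE => jl; apply/eqP/proper.
  by rewrite /= /shift_adj /= ij jl eqxx.
have S_inj : injective S.
  move=> i j e; apply/val_inj; case: (ltngtP i j) => // lt; first by case: (S_neq _ _ lt).
  by case: (S_neq _ _ lt).
have <- : #|powerset [set: 'I_k]| = 2 ^ k by rewrite card_powerset cardsT card_ord.
rewrite -[X in X <= _]card_ord.
rewrite -(card_imset _ S_inj); apply: subset_leq_card.
by apply/fintype.subsetP => X _; rewrite inE subsetT.
Qed.
End ShiftGraph.

(** A clique of n^2 vertices in H contains the shift graph as a subgraph, which is then in the class
    too. Its clique number is at most 2, so [f] bounds its chromatic number; n is chosen too large
    for that. *)
Lemma chi_bound_of_shift r (C : graph_class) : 0 < r -> chi_bounded (class_ITMe r C) ->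
  exists c, forall H, class_ITMe r C H -> chi H <= c.
Proof.
move=> r_gt0 [f fP].
pose n := (2 ^ (\max_(k < 3) f k)).+1.
exists (\max_(k < n * n) f k) => H CH; apply: leq_trans (fP _ CH) _.
have [G CG GH] := CH.
have lt : omega H < n * n.
  rewrite ltnNge; apply/negP => le.
  have sub : subgraph (shift_graph n) H.
    by apply: subgraph_of_clique; rewrite /= card_prod card_ord.
  have Cshift : class_ITMe r C (shift_graph n).
    by exists G => //; apply: ITMe_subgraph GH.
  have om : omega (shift_graph n) < 3 by rewrite ltnS shift_graph_omega.
  have := shift_graph_colorable (chiP (shift_graph n)); apply/negP; rewrite -ltnNge.
  rewrite /n ltnS leq_exp2l //; apply: leq_trans (fP _ Cshift) _.
  by apply: (bigmax_sup (Ordinal om)).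
by apply: (bigmax_sup (Ordinal lt)).
Qed.

(* A maximizes the total demand (at most q per vertex) that it serves, with a
   penalty w per element: then few vertices remain with unserved demand. *)
Lemma balanced_subsets (G : sgraph) q L d : 0 < q -> 0 < L -> 0 < #|G| ->
  q + 16 * q * L <= d -> (forall v : G, d <= #|[set u | adj v u]|) ->
  exists A B : {set G}, [/\ [disjoint A & B],
    forall b, b \in B -> q <= #|[set a in A | adj b a]|, L * #|A| <= #|B| & 0 < #|B|].
Proof.
move=> q_gt0 L_gt0 G_gt0 dq deg.
(* Comparing A with the empty set gives [w * #|A| <= q * #|G|], that is [4 * L * #|A| <= #|G|].
   Adding a vertex outside A gains nothing, so it has at most w neighbours in U; as
   [d >= q + 4 * w], this gives [4 * #|U| <= #|G|]. What remains is at least half of G. *)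
pose w := 4 * q * L.
pose dg (A : {set G}) v := #|[set a in A | adj v a]|.
pose Psi A := \sum_v minn (dg A v) q + w * (#|G| - #|A|).
case: (@arg_maxnP _ set0 xpredT Psi isT) => A _ max.
pose U := [set v | dg A v < q].
have cA : w * #|A| <= q * #|G|.
  have := max set0 isT; rewrite /Psi cards0 subn0 => h.
  have h2 : \sum_v minn (dg A v) q <= #|G| * q.
    by rewrite -sum_nat_const; apply: leq_sum => v _; apply: geq_minr.
  have AG := max_card A; rewrite mulnBr in h.
  have := leq_mul (leqnn w) AG; lia.
have cU a : a \notin A -> #|[set u in U | adj a u]| <= w.
  move=> aA; have := max (a |: A) isT; rewrite /Psi cardsU1 aA /=.
  have -> : \sum_v minn (dg (a |: A) v) q =
      \sum_v minn (dg A v) q + #|[set u in U | adj a u]|.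
    have E v : minn (dg (a |: A) v) q = minn (dg A v) q + ((v \in U) && adj a v).
      have -> : dg (a |: A) v = dg A v + adj a v.
        rewrite /dg [adj a v]adj_sym.
        have -> : [set x in a |: A | adj v x] =
           (if adj v a then [set a] else set0) :|: [set x in A | adj v x].
          apply/setP => x; rewrite !inE; case: (eqVneq x a) => [->|xa] /=.
            by case: (adj v a); rewrite ?inE ?eqxx ?(negbTE aA).
          by case: (adj v a); rewrite !inE ?(negbTE xa).
        case: (adj v a); last by rewrite set0U addn0.
        by rewrite cardsU1 inE (negbTE aA) addnC.
      by rewrite inE; case: (adj a v); case: (ltnP (dg A v) q) => h /=; lia.
    rewrite (eq_bigr _ (fun v _ => E v)) big_split /=; congr (_ + _).
    rewrite -sum1_card [RHS]big_mkcond /=; apply: eq_bigr => v _.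
    by rewrite inE; case: (_ && _).
  have AG : #|A| < #|G|.
    rewrite -cardsT; apply: proper_card; rewrite properT.
    by apply: contraNneq aA => ->; rewrite inE.
  rewrite -addnA leq_add2l; have -> : #|G| - #|A| = (#|G| - (1 + #|A|)).+1 by lia.
  by rewrite mulnS leq_add2r.
have cdU : d * #|U| <= q * #|U| + w * #|G|.
  apply: (@leq_trans (\sum_(u in U) #|[set x | adj u x]|)).
    by rewrite mulnC -sum_nat_const; apply: leq_sum.
  apply: (@leq_trans (\sum_(u in U) (q + #|[set x in ~: A | adj u x]|))).
    apply: leq_sum => u; rewrite inE => /ltnW le.
    apply: leq_trans (_ : _ <= dg A u + #|[set x in ~: A | adj u x]|) _; last by rewrite leq_add2r.
    rewrite -cardsUI; apply: leq_trans (leq_addr _ _); apply: subset_leq_card.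
    by apply/fintype.subsetP => x; rewrite !inE => ->; rewrite !andbT; case: (x \in A).
  rewrite big_split /= sum_nat_const mulnC leq_add2l.
  rewrite (sum_card_exchange U (~: A) (fun u x => adj u x)).
  apply: (@leq_trans (\sum_(x in ~: A) w)).
    apply: leq_sum => x; rewrite inE => /cU; congr (_ <= _).
    by apply: eq_card => u; rewrite !inE adj_sym.
  by rewrite sum_nat_const mulnC leq_mul2l max_card orbT.
pose B := ~: (A :|: U).
have cB : #|G| <= #|A| + #|U| + #|B|.
  by rewrite -(cardsC (A :|: U)) leq_add2r cardsU leq_subr.
have w_gt0 : 0 < w by rewrite /w !muln_gt0 q_gt0 L_gt0.
have U4 : 4 * #|U| <= #|G|.
  have : w * (4 * #|U|) <= w * #|G|.
    have : (q + 16 * q * L) * #|U| <= d * #|U| by rewrite leq_mul2r dq orbT.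
    by move: cdU; rewrite /w; lia.
  by rewrite leq_pmul2l.
have A4 : 4 * (L * #|A|) <= #|G|.
  have : q * (4 * (L * #|A|)) <= q * #|G| by move: cA; rewrite /w; lia.
  by rewrite leq_pmul2l.
have AL : #|A| <= L * #|A| by rewrite leq_pmull.
exists A, B; split.
- by rewrite disjoint_sym disjoints_subset /B setCU subsetIl.
- by move=> b; rewrite !inE negb_or -leqNgt => /andP[].
- by move: cB U4 A4 AL; move: #|A| #|B| #|U| #|G| (L * _); lia.
- by move: cB U4 A4 AL G_gt0; move: #|A| #|B| #|U| #|G| (L * _); lia.
Qed.

(** Bernoulli's inequality for (1 + 1/m)^k, cleared of denominators. *)
Lemma expn_succ_ge m k : (m + k) * m ^ k <= m * m.+1 ^ k.
Proof.
elim: k => [|k IH]; first by rewrite !expn0; lia.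
rewrite !expnS; move: IH; move: (m ^ k) (m.+1 ^ k) => a b; nia.
Qed.

Lemma expn_succ_doubles m n k : 0 < m -> m * k <= n -> 2 ^ k * m ^ n <= m.+1 ^ n.
Proof.
move=> m_gt0 mkn.
have base : 2 * m ^ m <= m.+1 ^ m.
  have := expn_succ_ge m m; rewrite addnn -mul2n [2 * m]mulnC -mulnA.
  by rewrite leq_pmul2l.
rewrite -(subnKC mkn) !expnD !expnM mulnA -expnMn.
apply: leq_mul; first by case: k {mkn} => [|k]; rewrite ?expn0 ?leq_exp2r.
by case: (n - m * k) => [|e]; rewrite ?expn0 ?leq_exp2r.
Qed.

Lemma colorable_leq (G : sgraph) k k' : k <= k' -> colorable G k -> colorable G k'.
Proof.
move=> le /existsP[c /forallP cP]; apply/existsP; exists [ffun x => widen_ord le (c x)].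
apply/forallP => x; apply/forallP => y; apply/implyP => xy; rewrite !ffunE.
have /forallP/(_ y)/implyP/(_ xy) := cP x.
by apply: contraNneq => /(congr1 val) /= e; apply/eqP/val_inj.
Qed.

(* Union bound: a given c-colouring is proper for a random choice with probability
   at most (1 - 1/q^2)^#|B| since some pair of the q > c values is monochromatic. *)
Lemma random_pairs (T S : finType) (B : {set T}) c q (nb : T -> 'I_q -> S) :
  c < q -> 1 < q -> (forall b, b \in B -> injective (nb b)) -> 0 < #|S| ->
  (q * q).-1 * (c * #|S|) <= #|B| ->
  exists phi : {ffun T -> 'I_q * 'I_q}, forall kappa : {ffun S -> 'I_c},
    exists b, [/\ b \in B, nb b (phi b).1 != nb b (phi b).2 &
      kappa (nb b (phi b).1) = kappa (nb b (phi b).2)].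
Proof.
move=> cq q_gt1 nb_inj S_gt0 cB; apply: contrapT => no.
have mono (kappa : {ffun S -> 'I_c}) b : exists ij : 'I_q * 'I_q,
    ij.1 != ij.2 /\ kappa (nb b ij.1) = kappa (nb b ij.2).
  apply: contrapT => none.
  have : injective (fun i => kappa (nb b i)).
    move=> i j e; apply/eqP; apply: contrapT => /negP ij; apply: none.
    by exists (i, j).
  by move/leq_card; rewrite !card_ord leqNgt cq.
(* As [c < q], the pigeonhole principle yields for every colouring and every b a monochromatic pair
   of indices; one is fixed, and [W kappa] collects the choices that never take it. *)
have /choice[bad badP] (kb : {ffun S -> 'I_c} * T) : exists ij : 'I_q * 'I_q,
    ij.1 != ij.2 /\ kb.1 (nb kb.2 ij.1) = kb.1 (nb kb.2 ij.2) by apply: mono.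
pose W kappa := [set phi : {ffun T -> 'I_q * 'I_q} |
  [forall b in B, phi b != bad (kappa, b)]].
have cover : [set: {ffun T -> 'I_q * 'I_q}] \subset \bigcup_(kappa in [set: {ffun S -> 'I_c}]) W kappa.
  apply/fintype.subsetP => phi _; apply: contrapT => nphi; apply: no.
  exists phi => kappa; apply: contrapT => nk; apply: nphi.
  apply/bigcupP; exists kappa; rewrite ?inE //; apply/forall_inP => b bB.
  apply/negP => /eqP e; have [ij k] := badP (kappa, b); apply: nk.
  by exists b; rewrite e (inj_eq (nb_inj _ bB)).
have cW kappa : #|W kappa| = (q * q).-1 ^ #|B| * (q * q) ^ (#|T| - #|B|).
  pose F b : pred ('I_q * 'I_q) := if b \in B then predC1 (bad (kappa, b)) else predT.
  transitivity #|(family F : simpl_pred {ffun T -> 'I_q * 'I_q})|.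
    apply: eq_card => phi; rewrite inE; apply/forall_inP/familyP => h b.
      by rewrite /F; case: ifP => bB //; rewrite inE h.
    by move=> bB; have := h b; rewrite /F bB inE.
  rewrite card_family foldrE big_image /= (bigID (mem B)) /=; congr (_ * _).
    rewrite -prod_nat_const; apply: eq_bigr => b bB.
    by rewrite /F bB cardC1 card_prod !card_ord.
  rewrite (eq_bigr (fun=> q * q)) => [|b bB]; last by rewrite /F (negbTE bB) card_prod !card_ord.
  rewrite prod_nat_const; congr (_ ^ _); rewrite -[in RHS](cardC B) addKn.
  by apply: eq_card => b; rewrite !inE.
have := leq_trans (subset_leq_card cover) (leq_card_bigcup _ _).
rewrite (eq_bigr _ (fun kappa _ => cW kappa)) sum_nat_const !cardsT !card_ffun card_prod !card_ord.
have qq_gt1 : 0 < (q * q).-1 by move: q_gt1; clear; nia.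
have qq : (q * q).-1.+1 = q * q by apply: prednK; lia.
rewrite mulnA -{1}(subnKC (max_card B)) expnD leq_pmul2r; last first.
  by rewrite expn_gt0 -qq.
(* The number [c ^ #|S|] of colourings is below [2 ^ (c * #|S|)], a factor that B is large enough to
   absorb. *)
apply/negP; rewrite -ltnNge; apply: (@leq_trans (2 ^ (c * #|S|) * (q * q).-1 ^ #|B|)).
  rewrite ltn_pmul2r ?expn_gt0 ?qq_gt1 // expnM ltn_exp2r //; exact: ltn_expl.
by rewrite -[X in _ <= X ^ _]qq; apply: expn_succ_doubles.
Qed.

Lemma bounded_degree_of_bounded_chi r c (C : graph_class) : 0 < r ->
  (forall H, class_ITMe (2 * r + 1) C H -> chi H <= c) ->
  exists l, forall H, class_ITMe r C H -> degree_sum H <= l * #|H|.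
Proof.
(* With [q > c] neighbours in A, each b sees a repeated colour under any c-colouring; [c.+2] also
   ensures [q > 1]. L is the size ratio that [random_pairs] needs, made positive, and d is the
   degree required by [balanced_subsets]. *)
move=> r_gt0 chiC; pose q := c.+2; pose L := ((q * q).-1 * c).+1.
pose d := q + 16 * q * L.
exists (2 * d) => H [G CG GH]; rewrite leqNgt; apply/negP => dense.
have [|Y [_ Y0 Yd]] := @min_degree_subset H (@adj H) d setT (@adj_sym H) (@adj_irrefl H).
  rewrite cardsT; apply: leq_trans dense _; rewrite /degree_sum.
  rewrite [X in _ <= X](eq_bigl predT) => [|x]; last by rewrite inE.
  by apply: leq_sum => x _; apply: subset_leq_card; apply/fintype.subsetP => y; rewrite !inE.
pose K := induced Y.
have GK : ITMe r G K by apply: ITMe_subgraph GH; rewrite // induced_sub.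
have degK (v : K) : d <= #|[set u | adj v u]|.
  by rewrite degree_induced ltnW // Yd // (valP v).
have K_gt0 : 0 < #|K| by rewrite card_induced card_gt0.
have [|||A [B [AB Bq cAB B_gt0]]] := @balanced_subsets K q L d _ _ K_gt0 _ degK => //.
have [a0 a0A] : exists a, a \in A.
  case/card_gt0P: B_gt0 => b /Bq; case/(leq_trans (isT : 0 < q))/card_gt0P => a.
  by rewrite inE => /andP[aA _]; exists a.
pose S : finType := {x : K | x \in A}.
have cS : #|S| = #|A| by rewrite card_sig; apply: eq_card => x; rewrite !inE.
have /choice[nb nbP] (b : K) : exists nb : 'I_q -> S, b \in B ->
    injective nb /\ forall i, adj b (val (nb i)).
  case: (boolP (b \in B)) => [/Bq le|_]; last by exists (fun=> Sub a0 a0A).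
  have mem i : enum_val (widen_ord le i) \in [set a in A | adj b a] by apply: enum_valP.
  have memA i : enum_val (widen_ord le i) \in A by have := mem i; rewrite inE => /andP[].
  exists (fun i => Sub (enum_val (widen_ord le i)) (memA i)) => _; split=> [i j|i].
    move/(congr1 val); rewrite !SubK => /enum_val_inj/(congr1 val) /= e.
    exact: val_inj.
  by rewrite SubK; have := mem i; rewrite inE => /andP[].
have [|||||phi phiP] := @random_pairs K S B c q nb => //.
- by move=> b /nbP[].
- by apply/card_gt0P; exists (Sub a0 a0A).
- by apply: leq_trans cAB; rewrite cS mulnA leq_mul2r leqnSn orbT.
pose pr b := (val (nb b (phi b).1), val (nb b (phi b).2)).
have prP b : b \in B -> [/\ (pr b).1 \in A, (pr b).2 \in A, adj b (pr b).1 & adj b (pr b).2].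
  by case/nbP => _ nbb; split; rewrite ?nbb // (valP (nb _ _)).
have := chiC _ (ex_intro2 _ _ G CG (pair_graph_ITMe r_gt0 AB prP GK)).
move/colorable_leq/(_ (chiP _))/existsP => [kappa /forallP kP].
have [b [bB neq]] := phiP [ffun x : S => kappa x]; rewrite !ffunE => /eqP; apply/negP.
have /forallP/(_ (nb b (phi b).2))/implyP := kP (nb b (phi b).1); apply.
rewrite /= /induced_adj /=; apply/andP; split; first by rewrite (inj_eq val_inj).
by apply/existsP; exists b; rewrite bB /pr eqxx.
Qed.

(** * Tree-depth colourings of subdivisions *)

Section SubdivisionPaths.
Variables (H : sgraph) (k : Defs.arc H -> nat).
Let S := subdivision k.

(* The vertices of the path that replaces the arc p, from (val p).1 (index 0)
   to (val p).2 (index (k p).+1). *)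
Definition path_vertex (p : Defs.arc H) (i : nat) : S :=
  if i is j.+1 then
    if insub j is Some o then inr (existT (fun q => 'I_(k q)) p o) else inl (val p).2
  else inl (val p).1.

Lemma path_vertex_first p : path_vertex p 0 = inl (val p).1.
Proof. by []. Qed.

Lemma path_vertex_inner p i (ik : i < k p) :
  path_vertex p i.+1 = inr (existT (fun q => 'I_(k q)) p (Ordinal ik)).
Proof. by rewrite /path_vertex insubT. Qed.

Lemma path_vertex_last p : path_vertex p (k p).+1 = inl (val p).2.
Proof. by rewrite /path_vertex insubF // ltnn. Qed.

Lemma path_vertex_adj p i : i <= k p -> adj (path_vertex p i) (path_vertex p i.+1).
Proof.
rewrite leq_eqVlt => /orP[/eqP ->|ik].
  rewrite path_vertex_last; case E: (k p) => [|n].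
    by rewrite /=; apply/existsP; exists p; rewrite E eqxx /= -surjective_pairing eqxx.
  have nk : n < k p by rewrite E.
  by rewrite (path_vertex_inner nk) /= /subdiv_end /= !eqxx E eqxx orbT.
rewrite (path_vertex_inner ik); case: i ik => [|i] ik.
  by rewrite path_vertex_first /= /subdiv_end /= !eqxx.
by rewrite (path_vertex_inner (ltnW ik)) /= !eqxx.
Qed.
End SubdivisionPaths.

Lemma arc_of_edge (H : sgraph) (x y : H) : adj x y ->
  exists p : Defs.arc H, val p = (x, y) \/ val p = (y, x).
Proof.
pose A (p : H * H) := adj p.1 p.2 && (enum_rank p.1 < enum_rank p.2).
move=> xy; case: (ltngtP (enum_rank x) (enum_rank y)) => lt.
- have pP : A (x, y) by rewrite /A /= xy.
  by exists (Sub (x, y) pP); left.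
- have pP : A (y, x) by rewrite /A /= adj_sym xy.
  by exists (Sub (y, x) pP); right.
- by move: xy; rewrite (enum_rank_inj (val_inj lt)) adj_irrefl.
Qed.

Section SubdivisionClique.
Variables (r : nat) (H : sgraph).
Let S := exact_subdivision r H.

Lemma subdivision_degree2 (w : {p : Defs.arc H & 'I_r}) :
  #|[set v : S | adj (inr w : S) v]| <= 2.
Proof.
case: w => p i.
pose q i := path_vertex (fun=> r) p i.
have q_first : q 0 = inl (val p).1 by [].
have q_last : q r.+1 = inl (val p).2 := path_vertex_last (fun=> r) p.
have q_inner j (jr : j < r) : q j.+1 = inr (existT _ p (Ordinal jr)) :=
  @path_vertex_inner H (fun=> r) p j jr.
move: q q_first q_last q_inner => q q_first q_last q_inner.
apply: (@leq_trans #|[set q i; q i.+2]|); last by rewrite cards2; case: (_ != _).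
apply: subset_leq_card; apply/fintype.subsetP => v; rewrite in_set => vP.
apply/set2P; move: v vP => [y|[p' j]].
  rewrite /= /subdiv_end /= => /orP[] /andP[/eqP -> /eqP e]; [left | right].
    by rewrite e q_first.
  by rewrite e q_last.
case/andP => /eqP /= pp'; subst p'; case/orP => /eqP /= e; [right | left].
  have jr : i.+1 < r by rewrite e.
  by rewrite (q_inner _ jr); congr (inr (existT _ _ _)); apply: val_inj; rewrite /= e.
by rewrite -e (q_inner _ (ltn_ord j)); congr (inr (existT _ _ _)); apply: val_inj.
Qed.

(** The distance from the branch vertex x in the r-subdivision, truncated at [r.+2]. *)
Let dist (x : H) (v : S) : nat := match v with
  | inl y => if y == x then 0 else if adj x y then r.+1 else r.+2
  | inr w => if (val (tag w)).1 == x then (tagged w).+1 else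
             if (val (tag w)).2 == x then r - tagged w else r.+2
  end.

Lemma dist_lipschitz x u v : adj u v -> dist x v <= (dist x u).+1.
Proof.
have arcP (p : Defs.arc H) : adj (val p).1 (val p).2 by case/andP: (valP p).
have arcE (p : Defs.arc H) a b : val p = (a, b) -> adj a b.
  by move=> e; have := arcP p; rewrite e.
have arcN (p : Defs.arc H) : (val p).1 != (val p).2.
  by apply: contraTneq (arcP p) => ->; rewrite adj_irrefl.
have half (y : H) (w : {p : Defs.arc H & 'I_r}) : subdiv_end (k := fun=> r) y w ->
    dist x (inl y) <= (dist x (inr w)).+1 /\ dist x (inr w) <= (dist x (inl y)).+1.
  case: w => p i; have ir := ltn_ord i; have pP := arcP p; have pN := arcN p.
  rewrite /subdiv_end /= => /orP[] /andP[/eqP -> /eqP e]; rewrite ?e.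
    case: (eqVneq (val p).1 x) => [_|p1]; first by lia.
    case: (eqVneq (val p).2 x) => [p2|p2]; last by case: ifP; lia.
    by rewrite adj_sym -p2 pP; lia.
  case: (eqVneq (val p).1 x) => [p1|p1].
    by rewrite -p1 eq_sym (negbTE pN) pP; lia.
  by case: (eqVneq (val p).2 x) => [p2|p2]; [lia | case: ifP; lia].
case: u v => [y|w] [z|w'] //=; try by case/half.
- case/existsP => p /andP[/eqP r0 /orP[] /eqP/arcE yz].
    case: (eqVneq z x) => // zx; case: (eqVneq y x) => [<-|yx]; last by do 2 case: ifP; lia.
    by rewrite yz; lia.
  case: (eqVneq z x) => // zx; case: (eqVneq y x) => [<-|yx]; last by do 2 case: ifP; lia.
  by rewrite adj_sym yz; lia.
- case: w w' => p i [p' j] /= /andP[/eqP pp']; subst p'.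
  have ir := ltn_ord i; have jr := ltn_ord j.
  by case/orP => /eqP e; case: ifP => _; [lia | case: ifP; lia | lia | case: ifP; lia].
Qed.

Section Model.
Variables (K : sgraph) (kk : Defs.arc K -> nat) (f : {ffun subdivision kk -> S}).
Hypothesis kk_le : forall p, kk p <= r.
Hypothesis f_inj : injective f.
Hypothesis f_adj : forall u v, adj u v -> adj (f u) (f v).

(** The vertex u has at least three neighbours in the subdivision of K, one towards each other
    clique vertex, whereas a subdividing vertex of S has degree at most two. The label [lab]
    recovers the clique vertex from the neighbour of u, so these neighbours are distinct. *)
Lemma clique_branch (A : {set K}) u : clique A -> 3 < #|A| -> u \in A ->
  exists x, f (inl u) = inl x.
Proof.
move=> cA A4 uA; case E: (f (inl u)) => [x|w]; first by exists x.
pose lab (s : subdivision kk) : K := match s with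
  | inl v => v
  | inr w => if (val (tag w)).1 == u then (val (tag w)).2 else (val (tag w)).1
  end.
have /choice[n nP] v : exists s : subdivision kk, v \in A -> v != u ->
    adj (inl u : subdivision kk) s /\ lab s = v.
  case: (boolP ((v \in A) && (v != u))) => [/andP[vA vu]|nv]; last first.
    by exists (inl u) => vA vu; rewrite vA vu in nv.
  have [|p [pE|pE]] := @arc_of_edge K u v; first by apply: clique_adj cA _ _ _; rewrite // eq_sym.
  - exists (path_vertex kk p 1) => _ _; split.
      by have := path_vertex_adj (leq0n (kk p)); rewrite path_vertex_first pE.
    case k0: (kk p) => [|m].
      by have := path_vertex_last kk p; rewrite k0 => ->; rewrite /= pE.
    have k1 : 0 < kk p by rewrite k0.
    by rewrite (path_vertex_inner k1) /= pE eqxx.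
  - exists (path_vertex kk p (kk p)) => _ _; split.
      by have := path_vertex_adj (leqnn (kk p)); rewrite path_vertex_last pE adj_sym.
    case k0: (kk p) => [|m]; first by rewrite path_vertex_first pE.
    have k1 : m < kk p by rewrite k0.
    by rewrite (path_vertex_inner k1) /= pE /= (negbTE vu).
have n_inj : {in A :\ u &, injective (fun v => f (n v))}.
  move=> v v'; rewrite !inE => /andP[vu vA] /andP[vu' vA'] /f_inj e.
  by have [_ <-] := nP v vA vu; rewrite e; have [_] := nP v' vA' vu'.
have : #|A :\ u| <= 2.
  rewrite -(card_in_imset n_inj); apply: leq_trans (subdivision_degree2 w).
  apply: subset_leq_card; apply/fintype.subsetP => _ /imsetP[v + ->].
  by rewrite !inE -E => /andP[vu vA]; apply: f_adj; case: (nP v vA vu).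
by move=> le; move: A4; rewrite (cardsD1 u) uA add1n ltnS ltnNge le.
Qed.

(** The path replacing the edge u v has at most [r.+1] edges, while distinct nonadjacent vertices of
    H are farther apart than that in S. *)
Lemma branch_adj u v x y : adj u v -> f (inl u) = inl x -> f (inl v) = inl y -> adj x y.
Proof.
have along (p : Defs.arc K) z i : i <= (kk p).+1 -> f (inl (val p).1) = inl z ->
    dist z (f (path_vertex kk p i)) <= i.
  move=> + fz; elim: i => [|i IH] ik; first by rewrite path_vertex_first fz /= eqxx.
  apply: leq_trans (dist_lipschitz z (f_adj (path_vertex_adj _))) _ => //.
  by rewrite ltnS IH // ltnW.
have ends (p : Defs.arc K) a b : (val p).1 != (val p).2 ->
    f (inl (val p).1) = inl a -> f (inl (val p).2) = inl b -> adj a b.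
  move=> neq fa fb; have := along p a _ (leqnn _) fa; rewrite path_vertex_last fb /=.
  have ba : b != a.
    apply: contraNneq neq => ba; apply/eqP.
    have : f (inl (val p).1) = f (inl (val p).2) by rewrite fa fb ba.
    by move/f_inj => [->].
  rewrite (negbTE ba); case: ifP => // _; have := kk_le p; lia.
move=> uv fx fy; have [p [pE|pE]] := arc_of_edge uv.
  apply: (ends p); rewrite pE //=; apply: contraTneq uv => ->; by rewrite adj_irrefl.
rewrite adj_sym; apply: (ends p); rewrite pE //=.
by apply: contraTneq uv => ->; rewrite adj_irrefl.
Qed.
End Model.

(** The 3 is there because the vertices of a triangle have degree two and may be mapped to
    subdividing vertices. *)
Lemma omega_TM_subdivision (K : sgraph) : TM r S K -> omega K <= maxn 3 (omega H).
Proof.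
case=> kk kk_le /existsP[f /andP[/injectiveP f_inj /forallP fP]].
have f_adj u v : adj u v -> adj (f u) (f v).
  by move=> uv; have /forallP/(_ v)/implyP := fP u; apply.
have [A cA <-] := omega_clique K; rewrite leq_max.
case: (leqP #|A| 3) => //= A4.
have /choice[x xP] u : exists x, u \in A -> f (inl u) = inl x.
  case: (boolP (u \in A)) => [uA|_].
    by have [x fx] := clique_branch f_inj f_adj cA A4 uA; exists x.
  have [a aA] : exists a, a \in A by apply/card_gt0P; apply: leq_trans A4.
  by have [x _] := clique_branch f_inj f_adj cA A4 aA; exists x.
have x_inj : {in A &, injective x}.
  by move=> u v uA vA e; have := xP _ uA; rewrite e -(xP _ vA) => /f_inj [].
rewrite -(card_in_imset x_inj); apply: leq_omega.
apply/forall_inP => _ /imsetP[u uA ->]; apply/forall_inP => _ /imsetP[v vA ->].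
apply/implyP => neq; apply: (branch_adj kk_le f_inj f_adj _ (xP _ uA) (xP _ vA)).
by apply: clique_adj cA uA vA _; apply: contraNneq neq => ->.
Qed.
End SubdivisionClique.

Lemma sup_omega_TM_subdivision r H :
  sup_inv omega (TM r (exact_subdivision r H)) <= maxn 3 (omega H).
Proof.
have [_ lub] := sup_omega_TM r (exact_subdivision r H).
apply: (lub (maxn 3 (omega H))) => _ [K TK <-].
exact: omega_TM_subdivision TK.
Qed.

(** In every set S the degree sum is at most [2 * h * #|S|], so the relation is
    [2 * h]-degenerate. *)
Lemma oriented_coloring (T : finType) (e o : rel T) h : symmetric e ->
  (forall x y, e x y -> o x y || o y x) -> (forall x, #|[set y | o x y]| <= h) ->
  exists c : T -> 'I_(2 * h).+1, forall x y, e x y -> x != y -> c x != c y.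
Proof.
move=> e_sym eo oh; apply: degenerate_coloring => // S S0; apply: contrapT => no.
have deg v : v \in S -> 2 * h < #|[set u in S | e v u]|.
  by move=> vS; rewrite ltnNge; apply/negP => le; apply: no; exists v.
have ho v : #|[set u in S | o v u]| <= h.
  by apply: leq_trans (oh v); apply: subset_leq_card; apply/fintype.subsetP => u;
    rewrite !inE => /andP[].
have sum_o : \sum_(v in S) #|[set u in S | o v u]| <= #|S| * h.
  by rewrite -sum_nat_const; apply: leq_sum.
have : \sum_(v in S) #|[set u in S | e v u]| <=
    \sum_(v in S) (#|[set u in S | o v u]| + #|[set u in S | o u v]|).
  apply: leq_sum => v _; rewrite -cardsUI; apply: leq_trans (leq_addr _ _).
  by apply: subset_leq_card; apply/fintype.subsetP => u; rewrite !inE => /andP[-> /eo].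
rewrite big_split /= -(sum_card_exchange S S o) => le.
have : #|S| * (2 * h).+1 <= #|S| * (2 * h).
  rewrite -[X in X <= _]sum_nat_const; apply: leq_trans (leq_sum _ deg) _.
  by apply: leq_trans le _; move: sum_o; lia.
by rewrite leq_pmul2l ?card_gt0 // ltnn.
Qed.

Lemma chi_le_card (G : sgraph) (D : finType) (c : G -> D) :
  (forall x y, adj x y -> c x != c y) -> chi G <= #|D|.
Proof.
move=> cP; apply: chi_le; apply/existsP; exists [ffun x => enum_rank (c x)].
apply/forallP => x; apply/forallP => y; apply/implyP => /cP; rewrite !ffunE.
by rewrite (inj_eq enum_rank_inj).
Qed.

Section Forest.
Variable Y : rforest.

Lemma below_chain (x a b : Y) : below x a -> below x b -> below a b \/ below b a.
Proof.
case/connectP => p pP ->; elim: p x pP => [|z p IH] x /=; first by left.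
case/andP => /eqP xz pP /connectP[[|z' q] /= qP E].
  by right; rewrite E; apply/connectP; exists (z :: p); rewrite //= pP andbT; apply/eqP.
case/andP: qP => /eqP; rewrite xz => -[zz'] qP; rewrite -zz' in qP E.
by apply: IH => //; apply/connectP; exists q.
Qed.

(** If the next vertex lies below the last one, the old top still dominates it. If it lies above, it
    is comparable with the old top, because the ancestors of one vertex form a chain. *)
Lemma top_vertex (u : nat -> Y) n :
  (forall i, i < n -> below (u i) (u i.+1) \/ below (u i.+1) (u i)) ->
  exists2 j, j <= n & forall i, i <= n -> below (u i) (u j).
Proof.
elim: n => [|n IH] step.
  by exists 0 => // i; rewrite leqn0 => /eqP ->; apply: connect0.
have [i ilt|j jn jtop] := IH; first by apply: step; apply: ltnW.
have ind t : t <= n.+1 -> below (u j) (u t) -> below (u n.+1) (u t) ->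
    exists2 j, j <= n.+1 & forall i, i <= n.+1 -> below (u i) (u j).
  move=> tn jt nt; exists t => // i; rewrite leq_eqVlt => /orP[/eqP -> //|ilt].
  exact: connect_trans (jtop i ilt) jt.
have jn1 : j <= n.+1 by apply: leqW.
case: (step n (leqnn _)) => nn; last first.
  by apply: (ind j) => //; [exact: connect0 | exact: connect_trans nn (jtop n (leqnn _))].
case: (below_chain nn (jtop n (leqnn _))) => h.
  by apply: (ind j) => //; exact: connect0.
by apply: (ind n.+1) => //; exact: connect0.
Qed.
End Forest.

Section SubdivisionColoring.
Variables (r k : nat) (H : sgraph).
Let S := exact_subdivision r H.
Variable c : S -> 'I_k.
Hypothesis cP : forall I : {set 'I_k}, #|I| <= r.+1 -> td (induced [set x | c x \in I]) <= #|I|.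

Let edge_path (x y : H) : {set S} := [set z : S | match z with
  | inl w => (w == x) || (w == y)
  | inr t => (val (tag t) == (x, y)) || (val (tag t) == (y, x))
  end].

Let edge_path_sym x y : edge_path x y = edge_path y x.
Proof. by apply/setP => -[w|t]; rewrite !inE orbC. Qed.

Let path_vertex_mem p x y i : val p = (x, y) \/ val p = (y, x) ->
  path_vertex (fun=> r) p i \in edge_path x y.
Proof.
move=> pE; rewrite inE /path_vertex; case: i => [|i].
  by case: pE => ->; rewrite /= eqxx ?orbT.
case: insubP => [o _ _|_] /=; first by case: pE => ->; rewrite eqxx ?orbT.
by case: pE => ->; rewrite /= eqxx ?orbT.
Qed.

Let edge_path_vertex p x y z : val p = (x, y) \/ val p = (y, x) ->
  z \in edge_path x y -> exists2 i, i <= r.+1 & z = path_vertex (fun=> r) p i.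
Proof.
move=> pE; rewrite inE; case: z => [w|[q [j jr]]] wP.
  have [->|->] : w = (val p).1 \/ w = (val p).2.
    by case: pE wP => -> /= /orP[] /eqP ->; [left | right | right | left].
  - by exists 0.
  - by exists r.+1 => //; have := path_vertex_last (fun=> r) p.
have -> : q = p.
  have qE : val q = (x, y) \/ val q = (y, x) by case/orP: wP => /eqP; [left | right].
  case: pE qE => pE [] qE; try (by apply: val_inj; rewrite pE qE);
    by case: (@arc_asym H p q); rewrite pE qE.
by exists j.+1; rewrite ?ltnS 1?ltnW // (path_vertex_inner (k := fun=> r) jr).
Qed.

Let e I (x y : H) := [&& adj x y, c (inl x) == c (inl y) & c @: edge_path x y == I].

Let e_sym I : symmetric (e I).
Proof. by move=> x y; rewrite /e adj_sym eq_sym edge_path_sym. Qed.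

(** The path has [r.+2] vertices, but its ends share a colour; this is why p = r + 1 suffices. *)
Let e_card I x y : e I x y -> #|I| <= r.+1.
Proof.
case/and3P => xy /eqP cxy /eqP <-; have [p pE] := arc_of_edge xy.
have c_ends : c (path_vertex (fun=> r) p r.+1) = c (path_vertex (fun=> r) p 0).
  have -> : path_vertex (fun=> r) p r.+1 = inl (val p).2 := path_vertex_last _ p.
  by rewrite path_vertex_first; case: pE => -> /=.
apply: leq_trans (_ : _ <= #|[set c (path_vertex (fun=> r) p i) | i : 'I_r.+1]|) _.
  apply: subset_leq_card; apply/fintype.subsetP => _ /imsetP[z zP ->].
  have [i] := edge_path_vertex pE zP; rewrite leq_eqVlt => /orP[/eqP -> ->|ir ->].
    by rewrite c_ends; apply/imsetP; exists ord0.
  by apply/imsetP; exists (Ordinal ir).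
by apply: leq_trans (leq_imset_card _ _) _; rewrite card_ord.
Qed.

(* The path of a monochromatic edge has at most r+1 colours; its topmost vertex in
   the corresponding forest is an ancestor of both ends, and orienting the edge
   away from an end distinct from it gives out-degree at most r+1. *)
Lemma color_class_coloring I : exists col : H -> 'I_(2 * r.+1).+1,
  forall x y, e I x y -> x != y -> col x != col y.
Proof.
case: (pselect (exists x y, e I x y)) => [[x0 [y0 exy0]]|none]; last first.
  by exists (fun=> ord0) => x y exy; case: none; exists x, y.
have Ir := e_card exy0.
have [Y hY /existsP[phi /andP[/injectiveP phi_inj /forallP phi_adj]]] := tdP (induced [set x | c x \in I]).
have memI x y z : e I x y -> z \in edge_path x y -> z \in [set x | c x \in I].
  by case/and3P => _ _ /eqP <- zP; rewrite inE; apply: imset_f.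
have x0I : (inl x0 : S) \in [set x | c x \in I] by apply: (memI _ _ _ exy0); rewrite !inE eqxx.
pose d0 : induced [set x | c x \in I] := Sub (inl x0 : S) x0I.
pose g (z : S) : Y := phi (insubd d0 z).
have g_inj z z' : z \in [set x | c x \in I] -> z' \in [set x | c x \in I] -> g z = g z' -> z = z'.
  by move=> zI zI' /phi_inj/(congr1 val); rewrite !insubdK.
have g_adj z z' : z \in [set x | c x \in I] -> z' \in [set x | c x \in I] -> adj z z' ->
    below (g z) (g z') \/ below (g z') (g z).
  move=> zI zI' zz'; have /forallP/(_ (insubd d0 z'))/implyP := phi_adj (insubd d0 z).
  rewrite /= /induced_adj !insubdK // => /(_ zz') /andP[_ /orP].
  by case; [left | right].
pose o x y := e I x y && [exists z in edge_path x y, (z != inl x) && below (g (inl x)) (g z)].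
have inl_mem x y : (inl x : S) \in edge_path x y by rewrite inE eqxx.
apply: (@oriented_coloring _ (e I) o r.+1 (@e_sym I)) => [x y exy|x].
  have eyx : e I y x by rewrite e_sym.
  have /and3P[xy _ _] := exy; have [p pE] := arc_of_edge xy.
  pose pv i := path_vertex (fun=> r) p i.
  have pvP i : pv i \in edge_path x y by apply: path_vertex_mem.
  have pvI i : pv i \in [set x | c x \in I] := memI _ _ _ exy (pvP i).
  have [i ir|j jr top] := @top_vertex Y (fun i => g (pv i)) r.+1.
    by apply: g_adj => //; apply: (@path_vertex_adj H (fun=> r)).
  have all z : z \in edge_path x y -> below (g z) (g (pv j)).
    by case/(edge_path_vertex pE) => i ir ->; apply: top.
  have ny : (inl x : S) != inl y.
    by apply: contraTneq xy => -[->]; rewrite adj_irrefl.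
  case: (eqVneq (pv j) (inl x)) => [jx|jx]; apply/orP; [right | left].
    rewrite /o eyx; apply/existsP; exists (pv j); rewrite edge_path_sym pvP jx ny -jx.
    by apply: all; rewrite edge_path_sym.
  by rewrite /o exy; apply/existsP; exists (pv j); rewrite pvP jx; apply: all.
apply: leq_trans (_ : _ <= #|[set t | below (g (inl x)) t]|) _; last first.
  apply: leq_trans (_ : _ <= height Y) _; first exact: (bigmax_sup (g (inl x))).
  by rewrite hY; apply: leq_trans (cP Ir) Ir.
have /choice[zf zP] y : exists z : S, o x y ->
    [/\ z \in edge_path x y, z != inl x & below (g (inl x)) (g z)].
  case: (boolP (o x y)) => [/andP[_ /existsP[z /and3P[z1 z2 z3]]]|_]; first by exists z.
  by exists (inl x).
(* A vertex other than x on the path of an edge at x determines the other end of that edge. *)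
have zf_inj : {in [set y | o x y] &, injective (fun y => g (zf y))}.
  move=> y y'; rewrite !inE => oy oy' /g_inj.
  have [z1 zx _] := zP _ oy; have [z1' _ _] := zP _ oy'.
  have [/andP[ey _] /andP[ey' _]] := (oy, oy').
  move=> /(_ (memI _ _ _ ey z1) (memI _ _ _ ey' z1')) E; rewrite -E in z1'.
  have neq u : e I x u -> x != u.
    by case/and3P => xu _ _; apply: contraTneq xu => ->; rewrite adj_irrefl.
  move: z1 z1' zx; rewrite !inE; case: (zf y) => [w|t] z1 z1' zx.
    have wx : (w == x) = false by apply: contraNF zx => /eqP ->.
    by move: z1 z1'; rewrite wx /= => /eqP <- /eqP.
  have nx : x != y := neq _ ey; have nx' : x != y' := neq _ ey'.
  case/orP: z1 => /eqP E1; case/orP: z1' => /eqP; rewrite E1 => -[].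
  - by [].
  - by move=> e1 e2; rewrite e1 eqxx in nx'.
  - by move=> e1 e2; rewrite e1 eqxx in nx.
  - by [].
rewrite -(card_in_imset zf_inj); apply: subset_leq_card.
apply/fintype.subsetP => _ /imsetP[y + ->]; rewrite !inE => oy.
by have [_ _] := zP _ oy.
Qed.

(** A vertex is coloured by its colour under [c] together with its colours in all the relations
    [e I]: an edge of H with ends of equal colour belongs to the relation of the colour set of its
    path. *)
Lemma chi_le_of_subdivision_coloring :
  chi H <= k * (2 * r.+1).+1 ^ (2 ^ k).
Proof.
have /choice[col colP] := color_class_coloring.
pose D := ('I_k * {ffun {set 'I_k} -> 'I_(2 * r.+1).+1})%type.
have -> : k * (2 * r.+1).+1 ^ (2 ^ k) = #|{: D}|.
  rewrite card_prod card_ffun !card_ord; congr (_ * _ ^ _).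
  have -> : #|{: {set 'I_k}}| = #|powerset [set: 'I_k]|.
    by apply: eq_card => X; rewrite !inE subsetT.
  by rewrite card_powerset cardsT card_ord.
apply: (@chi_le_card H _ (fun x => (c (inl x), [ffun I => col I x]))) => x y xy.
apply/eqP => -[cxy /ffunP/(_ (c @: edge_path x y))]; rewrite !ffunE => colxy.
have exy : e (c @: edge_path x y) x y by rewrite /e xy cxy !eqxx.
have nxy : x != y by apply: contraTneq xy => ->; rewrite adj_irrefl.
by have := colP _ _ _ exy nxy; rewrite colxy eqxx.
Qed.
End SubdivisionColoring.

Lemma chi_le_chi_p_subdivision r (H : sgraph) k :
  chi_p r.+1 (exact_subdivision r H) <= k -> chi H <= k * (2 * r.+1).+1 ^ (2 ^ k).
Proof.
move=> le; have /existsP[c /forallP cP] := chi_pP r.+1 (exact_subdivision r H).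
apply: leq_trans (chi_le_of_subdivision_coloring (c := c) _) _ => [I Ir|].
  by have /implyP := cP I; apply.
apply: leq_mul => //; rewrite leq_exp2l //.
by rewrite leq_exp2l.
Qed.

(** * The equivalences *)

Lemma leq_max_below (f : nat -> nat) n k : k < n -> f k <= \max_(i < n) f i.
Proof. by move=> kn; apply: (bigmax_sup (Ordinal kn)). Qed.

(** With it, the chi-boundedness of C becomes the case r = 0 of that of the classes of induced
    topological minors. *)
Lemma ITMe0 (G : sgraph) : ITMe 0 G G.
Proof.
apply/existsP.
have f0 (u : exact_subdivision 0 G) : {x : G | u = inl x}.
  by case: u => [x|[p []//]]; exists x.
pose g u := sval (f0 u); have gK u : u = inl (g u) by exact: svalP (f0 u).
exists [ffun u => g u]; apply/andP; split.
  by apply/injectiveP => u v; rewrite !ffunE => guv; rewrite (gK u) guv -gK.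
apply/forallP => u; apply/forallP=> v; rewrite !ffunE; apply/eqP.
rewrite {1}(gK u) {1}(gK v) /=; apply/existsP/idP.
  case=> -[[a b] /= /andP[ab _]] /orP[] /eqP[<- <-] //; by rewrite adj_sym.
move=> /arc_of_edge[p [pE|pE]]; exists p; apply/orP;
  [left | right]; apply/eqP; exact: pE.
Qed.

Lemma omega_subgraph (H G : sgraph) : subgraph H G -> omega H <= omega G.
Proof.
case/existsP => f /andP[/injectiveP f_inj /forallP fP].
have [A cA <-] := omega_clique H; rewrite -(card_imset _ f_inj); apply: leq_omega.
apply/forall_inP => _ /imsetP[u uA ->]; apply/forall_inP => _ /imsetP[v vA ->].
apply/implyP => neq; have /forallP/(_ v)/implyP := fP u; apply.
by apply: clique_adj cA uA vA _; apply: contraNneq neq => ->.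
Qed.

Lemma omega_le_sup_TM r (G : sgraph) : omega G <= sup_inv omega (TM r G).
Proof.
have [ub _] := sup_omega_TM r G; apply: ub.
by exists G => //; apply: TM_refl.
Qed.

Lemma subgraph_trans (G1 G2 G3 : sgraph) : subgraph G1 G2 -> subgraph G2 G3 -> subgraph G1 G3.
Proof.
move=> /existsP[f /andP[/injectiveP f_inj /forallP fP]].
move=> /existsP[g /andP[/injectiveP g_inj /forallP gP]].
apply/existsP; exists [ffun x => g (f x)]; apply/andP; split.
  by apply/injectiveP => x y; rewrite !ffunE => /g_inj/f_inj.
apply/forallP => x; apply/forallP => y; apply/implyP => xy; rewrite !ffunE.
have /forallP/(_ (f y))/implyP := gP (f x); apply.
by have /forallP/(_ y)/implyP := fP x; apply.
Qed.

Lemma Kmn_subgraph m n : m <= n -> subgraph (Kmn m m) (Kmn n n).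
Proof.
move=> mn; pose A : {set Kmn n n} := [set inl i | i : 'I_n].
pose B : {set Kmn n n} := [set inr i | i : 'I_n].
apply: (@biclique_subgraph _ A B).
- by rewrite card_imset ?card_ord // => i j [].
- by rewrite card_imset ?card_ord // => i j [].
- by move=> _ _ /imsetP[i _ ->] /imsetP[j _ ->].
Qed.

Lemma bomega_lt (G : sgraph) s : ~~ subgraph (Kmn s s) G -> bomega G < s.
Proof.
move=> no; rewrite /bomega; case: ex_maxnP => b bG _; rewrite ltnNge.
by apply: contra no => sb; apply: subgraph_trans bG; apply: Kmn_subgraph.
Qed.

Lemma no_biclique_above_bomega (G : sgraph) : ~~ subgraph (Kmn (bomega G).+1 (bomega G).+1) G.
Proof.
rewrite /bomega; case: ex_maxnP => b _ max; apply/negP => /max.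
by rewrite ltnn.
Qed.

(** Through this bound the biclique number controls the clique number, and hence the number of
    colours needed for degeneracy. *)
Lemma omega_lt_no_biclique (G : sgraph) s : ~~ subgraph (Kmn s s) G -> omega G < 2 * s.
Proof.
move=> no; rewrite ltnNge; apply: contra no => le; apply: subgraph_of_clique.
by rewrite card_sum !card_ord addnn -mul2n.
Qed.

Section CompleteGraph.
Variable n : nat.
Definition complete_adj : rel 'I_n := fun x y => x != y.
Lemma complete_adj_sym : symmetric complete_adj.
Proof. by move=> x y; rewrite /complete_adj eq_sym. Qed.
Lemma complete_adj_irrefl : irreflexive complete_adj.
Proof. by move=> x; rewrite /complete_adj eqxx. Qed.
Definition complete_graph : sgraph := SGraph complete_adj_sym complete_adj_irrefl.

Lemma omega_complete_graph : omega complete_graph = n.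
Proof.
apply/eqP; rewrite eqn_leq; apply/andP; split.
  by have := omega_le_card complete_graph; rewrite card_ord.
rewrite -[X in X <= _]card_ord -cardsT; apply: leq_omega.
by apply/forall_inP => x _; apply/forall_inP => y _; apply/implyP.
Qed.

Lemma subdivided_complete_graph_biclique :
  subgraph (exact_subdivision 1 complete_graph) (Kmn (n ^ 2) (n ^ 2)).
Proof.
pose S := exact_subdivision 1 complete_graph.
have nn (i : 'I_n) : i < n ^ 2.
  by rewrite -mulnn; apply: leq_trans (ltn_ord i) _; rewrite leq_pmulr // (leq_ltn_trans _ (ltn_ord i)).
have aa : #|{: Defs.arc complete_graph}| <= n ^ 2.
  have <- : #|{: complete_graph * complete_graph}| = n ^ 2 by rewrite card_prod card_ord mulnn.
  exact: leq_card val_inj.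
pose f (s : S) : Kmn (n ^ 2) (n ^ 2) := match s with
  | inl i => inl (Ordinal (nn i))
  | inr w => inr (widen_ord aa (enum_rank (tag w)))
  end.
apply/existsP; exists [ffun s => f s]; apply/andP; split.
  apply/injectiveP => -[i|[p a]] [j|[q b]]; rewrite !ffunE //.
    by case=> e; congr inl; apply: val_inj.
  case=> /val_inj/enum_rank_inj /= e; subst q; congr (inr (existT _ p _)).
  by rewrite (ord1 a) (ord1 b).
apply/forallP => -[i|[p a]]; apply/forallP => -[j|[q b]]; rewrite !ffunE; apply/implyP => //=.
  by case/existsP.
by case/andP => _; rewrite (ord1 a) (ord1 b).
Qed.
End CompleteGraph.

Lemma no_biclique_of_TM r (G : sgraph) : 0 < r ->
  ~~ subgraph (Kmn ((sup_inv omega (TM r G)).+1 ^ 2) ((sup_inv omega (TM r G)).+1 ^ 2)) G.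
Proof.
move=> r_gt0; set t := sup_inv _ _; apply/negP => sub.
have K : TM r G (complete_graph t.+1).
  exists (fun=> 1) => //; apply: subgraph_trans sub.
  exact: subdivided_complete_graph_biclique.
have [ub _] := sup_omega_TM r G.
have : omega (complete_graph t.+1) <= t by apply: ub; exists (complete_graph t.+1).
by rewrite omega_complete_graph ltnn.
Qed.

Lemma induced_subgraph_sub (H G : sgraph) : induced_subgraph H G -> subgraph H G.
Proof.
case/existsP => f /andP[f_inj /forallP fP]; apply/existsP; exists f; rewrite f_inj /=.
apply/forallP => x; apply/forallP => y; apply/implyP => xy.
by have /forallP/(_ y)/eqP := fP x; rewrite xy => <-.
Qed.

Lemma induced_induced_subgraph (G : sgraph) (A : {set G}) : induced_subgraph (induced A) G.
Proof.
apply/existsP; exists [ffun x => val x]; apply/andP; split.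
  by apply/injectiveP => x y; rewrite !ffunE => /val_inj.
by apply/forallP => x; apply/forallP => y; rewrite !ffunE.
Qed.

Lemma large_independent_subset (G : sgraph) (X : {set G}) k s :
  colorable (induced X) k -> 0 < s -> k * s < #|X| ->
  exists Y : {set G}, [/\ Y \subset X, {in Y &, forall x y, ~~ adj x y} & s <= #|Y|].
Proof.
case/existsP => c /forallP cP s_gt0 big.
have [i si] : exists i, s <= #|[set x | c x == i]|.
  apply: contrapT => no; move: big; rewrite ltnNge => /negP; apply.
  rewrite -(card_induced X) -cardsT (card_fibers _ c).
  have <- : \sum_(j < k) s = k * s by rewrite sum_nat_const card_ord.
  apply: leq_sum => i _; apply: leq_trans (_ : #|[set x | c x == i]| <= s).
    by apply: subset_leq_card; apply/fintype.subsetP => x; rewrite !inE.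
  by rewrite leqNgt; apply/negP => lt; apply: no; exists i; apply: ltnW.
exists [set val x | x in [set x | c x == i]]; split.
- by apply/fintype.subsetP => _ /imsetP[x _ ->]; apply: valP.
- move=> _ _ /imsetP[x + ->] /imsetP[y + ->]; rewrite !inE => /eqP cx /eqP cy.
  apply/negP => xy; have /forallP/(_ y)/implyP/(_ xy) := cP x.
  by rewrite cx cy eqxx.
- by rewrite card_imset //; apply: val_inj.
Qed.

Lemma induced_biclique (G : sgraph) (A B : {set G}) s :
  s <= #|A| -> s <= #|B| -> (forall a b, a \in A -> b \in B -> adj a b) ->
  {in A &, forall x y, ~~ adj x y} -> {in B &, forall x y, ~~ adj x y} ->
  induced_subgraph (Kmn s s) G.
Proof.
move=> sA sB AB Aind Bind; have [f [f_inj fA fB]] := biclique_embedding sA sB AB.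
apply/existsP; exists f; apply/andP; split; first exact/injectiveP.
apply/forallP => u; apply/forallP => v; apply/eqP; case: u v => [i|i] [j|j].
- by rewrite (negbTE (Aind _ _ (fA i) (fA j))).
- by rewrite AB.
- by rewrite adj_sym [RHS]adj_sym AB.
- by rewrite (negbTE (Bind _ _ (fB i) (fB j))).
Qed.

Section AverageDegree.
Import GRing.Theory Num.Theory.

Lemma avg_degree_le (G : sgraph) l : 0 < #|G| ->
  (avg_degree G <= l%:R)%R = (degree_sum G <= l * #|G|).
Proof.
by move=> G_gt0; rewrite /avg_degree ler_pdivrMr ?ltr0n // -natrM ler_nat.
Qed.

Lemma bounded_avg_degreeP (D : graph_class) :
  bounded_avg_degree D <-> exists l, forall G, D G -> degree_sum G <= l * #|G|.
Proof.
split=> [[M MP]|[l lP]].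
  exists (Num.bound `|M|%R) => G DG; case: (posnP #|G|) => [G0|G_gt0].
    by rewrite G0 muln0 /degree_sum big1 // => x; move: (card0_eq G0 x); rewrite inE.
  rewrite -avg_degree_le //; apply: (@Order.POrderTheory.le_trans _ _ M).
    by apply: MP; exists G.
  apply: Order.POrderTheory.le_trans (ler_norm _) _.
  exact/Order.POrderTheory.ltW/archi_boundP.
exists l%:R%R => _ [G DG <-]; case: (posnP #|G|) => [G0|G_gt0]; last by rewrite avg_degree_le ?lP.
by rewrite /avg_degree G0 invr0 mulr0 ler0n.
Qed.
End AverageDegree.

Section Implications.
Variable C : graph_class.
Hypothesis hC : hereditary C.

(** By heredity the r-subdivision of H is in C, and [g] is evaluated on it at most at
    [maxn 3 (omega H)]. As [g] need not be monotone, its maximum over that range is used. *)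
Lemma weakly_chi_p_bounded_ITMe r : weakly_chi_p_bounded r.+1 C ->
  chi_bounded (class_ITMe r C).
Proof.
case=> g gP; pose k n := \max_(t < (maxn 3 n).+1) g t.
exists (fun n => k n * (2 * r.+1).+1 ^ (2 ^ k n)) => H [G CG GH].
apply: chi_le_chi_p_subdivision; apply: leq_trans (gP _ (hC CG GH)) _.
by apply: leq_max_below; rewrite ltnS /= sup_omega_TM_subdivision.
Qed.

Lemma chi_bounded_of_ITMe0 : chi_bounded (class_ITMe 0 C) -> chi_bounded C.
Proof. by case=> f fP; exists f => G CG; apply: fP; exists G => //; apply: ITMe0. Qed.

Lemma bounded_avg_degree_of_chi_bounded :
  (forall r, 0 < r -> chi_bounded (class_ITMe r C)) ->
  forall r, 0 < r -> bounded_avg_degree (class_ITMe r C).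
Proof.
move=> hchi r r_gt0; apply/bounded_avg_degreeP.
have r2_gt0 : 0 < 2 * r + 1 by rewrite addn1.
have [c cP] := chi_bound_of_shift r2_gt0 (hchi _ r2_gt0).
exact: bounded_degree_of_bounded_chi r_gt0 cP.
Qed.

Lemma chi_p_bounded_of_bounded_avg_degree p : chi_bounded C ->
  (forall r, 0 < r -> bounded_avg_degree (class_ITMe r C)) ->
  exists f : nat -> nat, forall G, C G -> chi_p p G <= f (bomega G).
Proof.
move=> [f fP] hdeg.
have /choice[L LP] t : exists l, 0 < t -> forall H, class_ITMe t C H -> degree_sum H <= l * #|H|.
  case: t => [|t]; first by exists 0.
  by have /bounded_avg_degreeP[l lP] := hdeg t.+1 isT; exists l.
exists (fun b => chi_p_bound p (\max_(k < 2 * b.+1) f k) b.+1 L) => G CG.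
apply: chi_p_le_bound; [| exact: no_biclique_above_bomega |].
  apply: colorable_leq (chiP G); apply: leq_trans (fP _ CG) _.
  exact/leq_max_below/omega_lt_no_biclique/no_biclique_above_bomega.
by move=> t H t_gt0 GH; apply: LP => //; exists G.
Qed.

(** Each side of a biclique induces a member of C of clique number at most that of G, hence
    [F (omega G)]-colourable; more than [F (omega G) * s] vertices contain an independent s-set, and
    two such sets form an induced biclique. *)
Lemma bomega_bound_of_no_induced_biclique s : chi_bounded C -> 0 < s ->
  exists N : nat -> nat, forall G, C G -> ~~ induced_subgraph (Kmn s s) G ->
    bomega G < N (omega G).
Proof.
move=> [f fP] s_gt0; pose F w := \max_(k < w.+1) f k.
exists (fun w => (F w * s).+1) => G CG; apply: contraR; rewrite -leqNgt.
set n := (F (omega G) * s).+1 => nb.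
have : subgraph (Kmn n n) G.
  by apply: contraLR nb => /bomega_lt; rewrite -ltnNge.
case/existsP => phi /andP[/injectiveP phi_inj /forallP phiP].
have phi_adj u v : adj u v -> adj (phi u) (phi v).
  by move=> uv; have /forallP/(_ v)/implyP := phiP u; apply.
pose A := [set phi (inl i) | i : 'I_n]; pose B := [set phi (inr i) | i : 'I_n].
have cA : #|A| = n by rewrite card_imset ?card_ord // => i j /phi_inj [].
have cB : #|B| = n by rewrite card_imset ?card_ord // => i j /phi_inj [].
have sub (X : {set G}) : #|X| = n -> exists Y : {set G},
    [/\ Y \subset X, {in Y &, forall x y, ~~ adj x y} & s <= #|Y|].
  move=> cX; apply: (@large_independent_subset G X (F (omega G)) s) => //; last first.
    by rewrite cX /n.
  apply: colorable_leq (chiP _); apply: leq_trans (fP _ (hC CG (induced_induced_subgraph X))) _.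
  by apply: leq_max_below; rewrite ltnS omega_subgraph // induced_sub.
have [A' [AA Aind sA]] := sub A cA; have [B' [BB Bind sB]] := sub B cB.
apply: (induced_biclique sA sB) => // a b /(fintype.subsetP AA)/imsetP[i _ ->].
by move=> /(fintype.subsetP BB)/imsetP[j _ ->]; apply: phi_adj.
Qed.

Lemma strongly_chi_p_bounded_of_bomega s p : chi_bounded C -> 0 < s ->
  (exists f : nat -> nat, forall G, C G -> chi_p p G <= f (bomega G)) ->
  strongly_chi_p_bounded p (fun G => C G /\ ~~ induced_subgraph (Kmn s s) G).
Proof.
move=> hchi s_gt0 [f fP]; have [N NP] := bomega_bound_of_no_induced_biclique hchi s_gt0.
exists (fun w => \max_(k < N w) f k) => G [CG noG]; apply: leq_trans (fP _ CG) _.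
exact/leq_max_below/NP.
Qed.

Lemma weakly_chi_p_bounded_of_strongly p : 0 < p -> chi_bounded C ->
  (forall s, 0 < s ->
    strongly_chi_p_bounded p (fun G => C G /\ ~~ induced_subgraph (Kmn s s) G)) ->
  weakly_chi_p_bounded p C.
Proof.
(* For p = 1 the bound is in terms of [TM 0], which contains no properly subdivided edges and so
   does not control bicliques; there chi-boundedness gives the result directly. *)
case: p => // -[_ [f fP] _|p _ _ hs].
  exists (fun t => \max_(k < t.+1) f k) => G CG.
  apply: leq_trans (chi_1_le_chi G) (leq_trans (fP _ CG) _).
  by apply: leq_max_below; rewrite ltnS omega_le_sup_TM.
have /choice[f fP] s : exists f : nat -> nat, 0 < s -> forall G,
    C G /\ ~~ induced_subgraph (Kmn s s) G -> chi_p p.+2 G <= f (omega G).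
  case: s => [|s]; first by exists (fun=> 0).
  by have [f fP] := hs s.+1 isT; exists f.
exists (fun t => \max_(k < t.+1) f (t.+1 ^ 2) k) => G CG /=.
set t := sup_inv omega (TM p.+1 G).
apply: leq_trans (fP (t.+1 ^ 2) _ G _) _.
- by rewrite expn_gt0.
- split=> //; apply: contra (no_biclique_of_TM G (ltn0Sn p)).
  exact: induced_subgraph_sub.
- by apply: (@leq_max_below (f (t.+1 ^ 2))); rewrite ltnS omega_le_sup_TM.
Qed.
End Implications.

From mathcomp Require Import classical_sets.

Theorem theorem3 (C : graph_class) (hC : hereditary C) :
  [<->
    (* i *)
    forall p : nat, 0 < p -> weakly_chi_p_bounded p C;
    (* ii *)
    chi_bounded C /\ (forall r : nat, 0 < r -> chi_bounded (class_ITMe r C));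
    (* iii *)
    chi_bounded C /\ (forall r : nat, 0 < r -> bounded_avg_degree (class_ITMe r C));
    (* iv *)
    chi_bounded C /\
      (forall p : nat, 0 < p ->
        exists f : nat -> nat,
          forall G : sgraph, C G -> chi_p p G <= f (bomega G));
    (* v *)
    chi_bounded C /\
      (forall s : nat, 0 < s -> forall p : nat, 0 < p ->
        strongly_chi_p_bounded p
          (fun G : sgraph => C G /\ ~~ induced_subgraph (Kmn s s) G))
  ].
Proof.
tfae.
- move=> hw; split; first exact/chi_bounded_of_ITMe0/weakly_chi_p_bounded_ITMe/hw.
  by move=> r _; apply/weakly_chi_p_bounded_ITMe/hw.
- by case=> hchi hITM; split=> //; apply: bounded_avg_degree_of_chi_bounded.
- by case=> hchi hdeg; split=> // p _; apply: chi_p_bounded_of_bounded_avg_degree.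
- case=> hchi hb; split=> // s s_gt0 p p_gt0.
  exact: strongly_chi_p_bounded_of_bomega hchi s_gt0 (hb p p_gt0).
- case=> hchi hs p p_gt0; apply: weakly_chi_p_bounded_of_strongly => // s s_gt0.
  exact: hs.
Qed.
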